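(* Let $F|K$ be a one-dimensional separable function field over a field $K$ of characteristic $p>0$, and let $\mathfrak{p}$ be a singular prime of $F|K$. Then: (i) The restriction $\mathfrak{p}_n$ of $\mathfrak{p}$ to the $n$th Frobenius pullback $F_n|K = F^{p^n}K|K$ is separable for all integers $n \geq \log_p \big( 2 \, \frac{\delta(\mathfrak{p})}{[\kappa(\mathfrak{p}):K]_{sep}} + 1 \big)$; moreover, if the integer $\frac 2{p-1} \frac{\delta(\mathfrak{p})}{[\kappa(\mathfrak{p}):K]_{sep}}$ is not a sum of consecutive powers of $p$ (i.e. not of the form $p^j+p^{j+1}+\dots+p^i$ with $0\le j\le i$), then $\mathfrak{p}_n$ is separable for all $n \geq \log_p \big( 2 \, \frac{\delta(\mathfrak{p})}{[\kappa(\mathfrak{p}):K]_{sep}} + 1 \big) - 1$. (ii) If in addition $\mathfrak{p}$ is non-decomposed, then $\mathfrak{p}_n$ is rational for all $n \geq \log_p ( 2\delta(\mathfrak{p}) + 1 )$; moreover, if the integer $\frac 2{p-1}\delta(\mathfrak{p})$ is not a sum of consecutive powers of $p$, then $\mathfrak{p}_n$ is rational for all $n \geq \log_p ( 2\delta(\mathfrak{p}) + 1 ) - 1$.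
   Context: A one-dimensional separable function field $F|K$ is a finitely generated separable field extension of transcendence degree $1$ such that $K$ is algebraically closed in $F$. A prime $\mathfrak p$ of $F|K$ is (the maximal ideal of) a discrete valuation ring $\mathcal O_{\mathfrak p}\subset F$ containing $K$ with fraction field $F$; $\kappa(\mathfrak p)$ is its residue field, $\deg\mathfrak p=[\kappa(\mathfrak p):K]$, $\mathfrak p$ is rational if $\deg\mathfrak p=1$ and separable if $\kappa(\mathfrak p)|K$ is separable; $[\kappa(\mathfrak p):K]_{sep}$ denotes the separable degree. For an algebraic extension $K'|K$ put $K'\cdot\mathcal O_{\mathfrak p}=K'\otimes_K\mathcal O_{\mathfrak p}$, a domain with fraction field $K'\otimes_K F$. The geometric singularity degree $\delta(\mathfrak p)$ is $\dim_{\overline K}\widetilde{\overline K\cdot\mathcal O_{\mathfrak p}}/\overline K\cdot\mathcal O_{\mathfrak p}$, where $\overline K$ is an algebraic closure and the tilde denotes integral closure in $\overline K\otimes_K F$; $\mathfrak p$ is singular if $\delta(\mathfrak p)>0$. The $n$th Frobenius pullback is $F_n=KF^{p^n}$, and $\mathfrak p_n$ denotes the restriction of $\mathfrak p$ to $F_n$ (a prime of $F_n|K$). The prime $\mathfrak p$ is decomposed if more than one prime of the function field $\overline K F|\overline K$ lies over $\mathfrak p$, and non-decomposed otherwise. *)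

(* Defs.v *)
(* All fields are modelled as subfields (predicates) of an
   ambient algebraically closed field L. *)
From HB Require Import structures.
From mathcomp Require Import all_boot all_order all_algebra.
Set Implicit Arguments.
Unset Strict Implicit.
Unset Printing Implicit Defensive.
Import GRing.Theory Num.Theory.
Local Open Scope ring_scope.

Section FunctionFieldDefs.
Variable L : fieldType.

Definition is_subring (R : L -> Prop) : Prop :=
  R 1 /\ forall x y, R x -> R y -> R (x - y) /\ R (x * y).

Definition is_subfield (E : L -> Prop) : Prop :=
  is_subring E /\ forall x, E x -> x != 0 -> E x^-1.

Definition subset_p (A B : L -> Prop) : Prop := forall x, A x -> B x.

Definition poly_over (K : L -> Prop) (f : {poly L}) : Prop := forall i, K f`_i.

Definition algebraic_over (K : L -> Prop) (x : L) : Prop :=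
  exists f : {poly L}, f != 0 /\ poly_over K f /\ root f x.

Definition separable_over (K : L -> Prop) (x : L) : Prop :=
  exists f : {poly L}, [/\ f != 0, poly_over K f, root f x & coprimep f f^`()].

Definition ratfun_field (K : L -> Prop) (t : L) : L -> Prop := fun x =>
  exists a b : {poly L}, [/\ poly_over K a, poly_over K b, b.[t] != 0
                          & x = a.[t] / b.[t]].

Definition function_field (K F : L -> Prop) : Prop :=
  [/\ is_subfield K, is_subfield F, subset_p K F /\
      (exists s : seq L, (forall y, y \in s -> F y) /\
         forall x, F x <-> (forall E, is_subfield E -> subset_p K E ->
                             (forall y, y \in s -> E y) -> E x)),
      (exists t, [/\ F t, ~ algebraic_over K t &
                   forall x, F x -> separable_over (ratfun_field K t) x])
    & forall x, F x -> algebraic_over K x -> K x].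

Definition unit_of (O : L -> Prop) (u : L) : Prop := [/\ O u, u != 0 & O u^-1].

(* O is (the valuation ring of) a prime of F|K: a discrete valuation ring
   containing K with fraction field F (every nonzero x of F is a unit
   times an integral power of a uniformizer pi). *)
Definition is_prime (K F O : L -> Prop) : Prop :=
  [/\ is_subring O, subset_p K O, subset_p O F &
      exists pi, [/\ O pi, pi != 0, ~ O pi^-1 &
        forall x, F x -> x != 0 ->
          exists (u : L) (n : int), unit_of O u /\ x = u * pi ^ n]].

Definition maxideal (O : L -> Prop) : L -> Prop := fun x =>
  O x /\ (x = 0 \/ ~ O x^-1).

Definition indep_mod (K M : L -> Prop) (n : nat) (x : 'I_n -> L) : Prop :=
  forall c : 'I_n -> L, (forall i, K (c i)) ->
    M (\sum_i c i * x i) -> forall i, c i = 0.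

(* d is the maximal number of elements of P that are K-linearly independent
   modulo M, i.e. the K-dimension of the image of (span of) P modulo M *)
Definition dim_mod (P K M : L -> Prop) (d : nat) : Prop :=
  (exists x : 'I_d -> L, (forall i, P (x i)) /\ indep_mod K M x) /\
  forall x : 'I_d.+1 -> L, (forall i, P (x i)) -> ~ indep_mod K M x.

Definition res_deg (K O : L -> Prop) (d : nat) : Prop :=
  dim_mod O K (maxideal O) d.

Definition sep_mod (K O : L -> Prop) (x : L) : Prop :=
  exists f : {poly L}, [/\ f != 0, poly_over K f, coprimep f f^`()
                         & maxideal O f.[x]].

Definition sep_res_deg (K O : L -> Prop) (d : nat) : Prop :=
  dim_mod (fun x => O x /\ sep_mod K O x) K (maxideal O) d.

Definition prime_separable (K O : L -> Prop) : Prop :=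
  forall x, O x -> sep_mod K O x.

Definition prime_rational (K O : L -> Prop) : Prop := res_deg K O 1.

Definition span_prod (A B : L -> Prop) : L -> Prop := fun y =>
  exists (m : nat) (a b : 'I_m -> L),
    [/\ forall i, A (a i), forall i, B (b i) & y = \sum_i a i * b i].

Definition quot_field (R : L -> Prop) : L -> Prop := fun x =>
  exists a b, [/\ R a, R b, b != 0 & x = a / b].

Definition frob_pullback (p : nat) (K F : L -> Prop) (n : nat) : L -> Prop :=
  quot_field (span_prod K (fun z => exists y, F y /\ z = y ^+ (p ^ n)%N)).

Definition restr_prime (O E : L -> Prop) : L -> Prop := fun x => O x /\ E x.

(* algebraic closure of K in L (L algebraically closed) *)
Definition Kbar (K : L -> Prop) : L -> Prop := algebraic_over K.

Definition Kbar_ring (K O : L -> Prop) : L -> Prop := span_prod (Kbar K) O.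
Definition Kbar_field (K F : L -> Prop) : L -> Prop :=
  quot_field (span_prod (Kbar K) F).

Definition Kbar_closure (K F O : L -> Prop) : L -> Prop := fun x =>
  Kbar_field K F x /\
  exists f : {poly L}, [/\ f \is monic, poly_over (Kbar_ring K O) f & root f x].

Definition geom_sing_deg (K F O : L -> Prop) (d : nat) : Prop :=
  dim_mod (Kbar_closure K F O) (Kbar K) (Kbar_ring K O) d.

Definition prime_over (K F O P : L -> Prop) : Prop :=
  is_prime (Kbar K) (Kbar_field K F) P /\ forall x, F x -> (P x <-> O x).

Definition non_decomposed (K F O : L -> Prop) : Prop :=
  forall P1 P2, prime_over K F O P1 -> prime_over K F O P2 ->
    forall x, P1 x <-> P2 x.

End FunctionFieldDefs.

(* Main.v *)
(* Write F_a = K[F^(p^a)], O_a for the restriction of the prime to F_a, d_a for its degree, and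
   q_a = dim_K O_{a+1} / K[O_a^p].  Extracting p-power roots and using that F and Kbar are
   linearly disjoint over K, one finds that delta is the sum of the q_a; so q_a = 0 for large a.
   Computing the K-dimension of O_{a+1} / O_{a+2}[w] for a suitable w = z^p gives
   2 q_a = (p - 1) k_a d_{a+1} + 2 p q_{a+1} with k_a an integer, and d_{a+1} is d_{a+2} or
   p d_{a+2}.  If q_a = 0 and d_{a+1} = d_a then O_a has separable residue field, of degree equal
   to the separable degree s.  So let J be least with q_a = 0 for a >= J, and J + m the first
   separable level from J on: then d_J = p^m s and 2 delta = (p - 1) s p^m U with
   U >= 1 + p + ... + p^(J-1), whence p^(J+m) s <= 2 delta + p^m s, with equality only if
   2 delta / ((p - 1) s) is the sum of consecutive powers p^m + ... + p^(m+J-1).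
   Finally, at a separable level, two distinct conjugates over K of a residue generate ideals of
   Kbar O_a lying under two different primes; so s = 1 for a non-decomposed prime. *)
Require Import Defs.
From HB Require Import structures.
From mathcomp Require Import all_boot all_order all_algebra.
From mathcomp Require Import ring_quotient generic_quotient separable boolp zify ring.
Set Implicit Arguments.
Unset Strict Implicit.
Unset Printing Implicit Defensive.
Import Order.TTheory GRing.Theory Num.Theory.
Local Open Scope ring_scope.

(** * Subrings and subfields of L *)

Section SubringTypes.

(** Since Kbar is perfect, the [p ^ N]-th power map sends Kbar O onto the Kbar-span of O^(p^N). For
    large N it sends a given element of the integral closure into Kbar O_N: the finitely many
    coefficients involved become separable over K, and adjoining separable elements keeps an
    integrally closed ring integrally closed. So delta is the K-dimension of O_N / K[O^(p^N)] for
    large N, which a filtration cuts into the q_a. The obstacle in computing O_{a+1} / O_{a+2}[w] is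
    defect: if the extension of degree p were immediate, neither values nor residues would see it.
    It is excluded by the finiteness of delta, which yields an element whose approximations from the
    smaller field cannot be improved ([optimal]). The powers h^i of such an element split every ball
    of the larger field into balls of the smaller one, so codimensions become sums over i of the
    integer parts of i v(h) / eps1; pairing i with p - i is the origin of the factors 2 and p -
    1. *)

Record sub_carrier (L : fieldType) (S : {pred L}) :=
  SubCarrier { sub_val : L; sub_valP : sub_val \in S }.
HB.instance Definition _ (L : fieldType) (S : {pred L}) :=
  [isSub for @sub_val L S].
HB.instance Definition _ (L : fieldType) (S : {pred L}) :=
  [Choice of sub_carrier S by <:].
HB.instance Definition _ (L : fieldType) (S : subringClosed L) :=
  [SubChoice_isSubComNzRing of sub_carrier S by <:].
HB.instance Definition _ (L : fieldType) (S : divringClosed L) :=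
  [SubNzRing_isSubUnitRing of sub_carrier S by <:].
HB.instance Definition _ (L : fieldType) (S : divringClosed L) :=
  [SubComUnitRing_isSubIntegralDomain of sub_carrier S by <:].
HB.instance Definition _ (L : fieldType) (S : divringClosed L) :=
  [SubIntegralDomain_isSubField of sub_carrier S by <:].

Definition pred_of (L : fieldType) (R : L -> Prop) : {pred L} := fun x => `[< R x >].

Lemma in_pred_of (L : fieldType) (R : L -> Prop) x : (x \in pred_of R) = `[< R x >].
Proof. by []. Qed.

(** Subrings given as predicates on [L] become library structures here and, for subfields, in
    [subfield_type], so that quotient rings, matrix ranks, polynomial gcds and integrality apply to
    them. *)
Lemma subring_type (L : fieldType) (R : L -> Prop) : is_subring R ->
  exists (A : comNzRingType) (i : {rmorphism A -> L}),
    injective i /\ forall x, R x <-> exists a, x = i a.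
Proof.
move=> [R1 RBM].
have cl : subring_closed (pred_of R).
  split=> [|x y|x y]; rewrite !in_pred_of; first exact/asboolP.
    by move=> /asboolP Rx /asboolP Ry; apply/asboolP; case: (RBM x y Rx Ry).
  by move=> /asboolP Rx /asboolP Ry; apply/asboolP; case: (RBM x y Rx Ry).
pose S : subringClosed L :=
  HB.pack (pred_of R : L -> bool) (GRing.isSubringClosed.Build L (pred_of R) cl).
exists (sub_carrier S : comNzRingType), (val : {rmorphism sub_carrier S -> L}).
split; first exact: val_inj.
move=> x; split=> [Rx|[a ->]]; last exact/asboolP/(valP a).
have Sx : x \in S by exact/asboolP.
by exists (SubCarrier Sx).
Qed.

Lemma subfield_type (L : fieldType) (K : L -> Prop) : is_subfield K ->
  exists (E : fieldType) (i : {rmorphism E -> L}),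
    forall x, K x <-> exists a, x = i a.
Proof.
move=> [[K1 KBM] KV].
have cl : divring_closed (pred_of K).
  split=> [|x y|x y]; rewrite !in_pred_of; first exact/asboolP.
    by move=> /asboolP Rx /asboolP Ry; apply/asboolP; case: (KBM x y Rx Ry).
  move=> /asboolP Rx /asboolP Ry; apply/asboolP.
  have [->|y0] := eqVneq y 0; last by case: (KBM x _ Rx (KV y Ry y0)).
  by rewrite invr0 mulr0 -(subrr 1); case: (KBM 1 1 K1 K1).
pose S : divringClosed L :=
  HB.pack (pred_of K : L -> bool) (GRing.isDivringClosed.Build L (pred_of K) cl).
exists (sub_carrier S : fieldType), (val : {rmorphism sub_carrier S -> L}).
move=> x; split=> [Rx|[a ->]]; last exact/asboolP/(valP a).
have Sx : x \in S by exact/asboolP.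
by exists (SubCarrier Sx).
Qed.

End SubringTypes.

Section ResidueField.

(** [rho] is total on [L] but meaningful only on [A], which avoids subtypes later. The last
    hypothesis, invertibility modulo [M], makes the quotient a field. *)
Lemma residue_field (L : fieldType) (A M : L -> Prop) :
  is_subring A -> (forall x, M x -> A x) -> M 0 -> ~ M 1 ->
  (forall a x y, A a -> M x -> M y -> M (a * x + y)) ->
  (forall x, A x -> ~ M x -> exists2 y, A y & M (1 - x * y)) ->
  exists (k : fieldType) (rho : L -> k),
    [/\ rho 1 = 1,
        forall x y, A x -> A y -> rho (x - y) = rho x - rho y,
        forall x y, A x -> A y -> rho (x * y) = rho x * rho y &
        forall x, A x -> (rho x = 0 <-> M x)].
Proof.
move=> ringA sMA M0 M1 idM invM.
have [R [i [injR AP]]] := subring_type ringA.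
pose S : {pred R} := fun x => `[< M (i x) >].
have SE x : (x \in S) = `[< M (i x) >] by [].
have clS : idealr_closed S.
  split; first by rewrite SE rmorph0; apply/asboolP.
    by rewrite SE rmorph1; apply/asboolP.
  move=> a u v; rewrite !SE => /asboolP Mu /asboolP Mv.
  by apply/asboolP; rewrite rmorphD rmorphM; apply: idM => //; apply/AP; exists a.
pose I : idealr R := HB.pack (S : R -> bool) (isIdealr.Build R S clS).
pose Q : comNzRingType := {ideal_quot I}.
pose pi (x : R) : Q := (\pi_{ideal_quot I} x)%qT.
have piE x : (pi x == 0) = (x \in S).
  have -> : 0 = pi 0 by rewrite /pi; exact: esym (@pi_zeror _ _ _ _ _ {ideal_quot I}).
  rewrite /pi -Quotient.idealrBE subr0; by [].
have piM x y : pi (x * y) = pi x * pi y by exact: (@pi_mulr _ _ _ _ _ _ _ {ideal_quot I} x y).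
have pi1 : pi 1 = 1 by exact: (@pi_oner _ _ _ _ _ _ _ {ideal_quot I}).
have piB x y : pi (x - y) = pi x - pi y.
  rewrite (_ : pi (x - y) = pi x + pi (- y)); last exact: (@pi_addr _ _ _ _ _ {ideal_quot I} x (- y)).
  by congr (_ + _); exact: (@pi_oppr _ _ _ _ _ {ideal_quot I} y).
have pi_surj (z : Q) : exists x, z = pi x.
  by exists (repr (z : {ideal_quot I})); exact: esym (@reprK _ {ideal_quot I} z).
have inv_ex (z : Q) : exists w : Q, (z = 0 -> w = 0) /\ (z <> 0 -> w * z = 1).
  have [z0|z0] := EM (z = 0); first by exists 0; split.
  have [x zx] := pi_surj z; rewrite {}zx in z0 *.
  have [||y Ay My] := invM (i x); first by apply/AP; exists x.
    by move=> Mx; apply: z0; apply/eqP; rewrite piE SE; apply/asboolP.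
  have [y' yy'] := (AP y).1 Ay.
  exists (pi y'); split=> // _; rewrite -piM mulrC; apply/eqP; rewrite eq_sym -subr_eq0 -pi1 -piB piE SE.
  by apply/asboolP; rewrite rmorphB rmorph1 rmorphM -yy'.
have [inv invP] := choice inv_ex.
have fA (z : Q) : z != 0 -> inv z * z = 1.
  by move=> /eqP z0; apply: (invP z).2.
have f0 : inv 0 = 0 by apply: (invP 0).1.
pose k : fieldType := HB.pack Q (GRing.ComNzRing_isField.Build Q fA f0).
have pre_ex (x : L) : exists a : R, A x -> x = i a.
  have [Ax|nAx] := EM (A x); last by exists 0.
  by have [a ->] := (AP x).1 Ax; exists a.
have [pre preP] := choice pre_ex.
have A1 : A 1 by case: ringA.
have AB x y : A x -> A y -> A (x - y) by case: ringA => _ H Ax Ay; case: (H x y Ax Ay).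
have AM x y : A x -> A y -> A (x * y) by case: ringA => _ H Ax Ay; case: (H x y Ax Ay).
have preB x y : A x -> A y -> pre (x - y) = pre x - pre y.
  by move=> Ax Ay; apply: injR; rewrite rmorphB -!preP //; apply: AB.
have preM x y : A x -> A y -> pre (x * y) = pre x * pre y.
  by move=> Ax Ay; apply: injR; rewrite rmorphM -!preP //; apply: AM.
exists k, (fun x => pi (pre x)); split.
- by rewrite -[RHS]pi1; congr pi; apply: injR; rewrite rmorph1 -preP.
- by move=> x y Ax Ay; rewrite preB // piB.
- by move=> x y Ax Ay; rewrite preM // piM.
- move=> x Ax; split=> [/eqP|Mx].
    by rewrite piE SE -preP // => /asboolP.
  by apply/eqP; rewrite piE SE -preP //; apply/asboolP.
Qed.

End ResidueField.

Section SubfieldTheory.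
Variables (L : fieldType) (K : L -> Prop).
Hypothesis HK : is_subfield K.

Lemma sf1 : K 1. Proof. by case: HK => [[]]. Qed.
Lemma sfB x y : K x -> K y -> K (x - y).
Proof. by case: HK => [[_ H] _] Kx Ky; case: (H x y Kx Ky). Qed.
Lemma sfM x y : K x -> K y -> K (x * y).
Proof. by case: HK => [[_ H] _] Kx Ky; case: (H x y Kx Ky). Qed.
Lemma sf0 : K 0. Proof. by rewrite -(subrr 1); apply: sfB; apply: sf1. Qed.
Lemma sfN x : K x -> K (- x).
Proof. by move=> Kx; rewrite -sub0r; apply: sfB => //; apply: sf0. Qed.
Lemma sfD x y : K x -> K y -> K (x + y).
Proof. by move=> Kx Ky; rewrite -[y]opprK; apply: sfB => //; apply: sfN. Qed.
Lemma sfV x : K x -> K x^-1.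
Proof.
move=> Kx; have [->|x0] := eqVneq x 0; first by rewrite invr0; apply: sf0.
by case: HK => _; apply.
Qed.
Lemma sfX x n : K x -> K (x ^+ n).
Proof.
by move=> Kx; elim: n => [|n IH]; rewrite ?expr0 ?exprS; [apply: sf1|apply: sfM].
Qed.
Lemma sf_sum (I : Type) (r : seq I) (P : pred I) (f : I -> L) :
  (forall i, P i -> K (f i)) -> K (\sum_(i <- r | P i) f i).
Proof. by move=> H; elim/big_rec: _ => [|i x Pi Kx]; [apply: sf0|apply/sfD/Kx/H]. Qed.
Lemma sf_ring : is_subring K. Proof. by case: HK. Qed.

End SubfieldTheory.

Section SubringTheory.
Variables (L : fieldType) (R : L -> Prop).
Hypothesis HR : is_subring R.

Lemma sr1 : R 1. Proof. by case: HR. Qed.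
Lemma srB x y : R x -> R y -> R (x - y).
Proof. by case: HR => [_ H] Kx Ky; case: (H x y Kx Ky). Qed.
Lemma srM x y : R x -> R y -> R (x * y).
Proof. by case: HR => [_ H] Kx Ky; case: (H x y Kx Ky). Qed.
Lemma sr0 : R 0. Proof. by rewrite -(subrr 1); apply: srB; apply: sr1. Qed.
Lemma srN x : R x -> R (- x).
Proof. by move=> Kx; rewrite -sub0r; apply: srB => //; apply: sr0. Qed.
Lemma srD x y : R x -> R y -> R (x + y).
Proof. by move=> Kx Ky; rewrite -[y]opprK; apply: srB => //; apply: srN. Qed.
Lemma srX x n : R x -> R (x ^+ n).
Proof.
by move=> Kx; elim: n => [|n IH]; rewrite ?expr0 ?exprS; [apply: sr1|apply: srM].
Qed.
Lemma sr_sum (I : Type) (r : seq I) (P : pred I) (f : I -> L) :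
  (forall i, P i -> R (f i)) -> R (\sum_(i <- r | P i) f i).
Proof. by move=> H; elim/big_rec: _ => [|i x Pi Kx]; [apply: sr0|apply/srD/Kx/H]. Qed.
Lemma sr_nat n : R n%:R.
Proof. by elim: n => [|n IH]; [apply: sr0|rewrite -addn1 natrD; apply: srD => //; apply: sr1]. Qed.
Lemma sr_horner (f : {poly L}) x : poly_over R f -> R x -> R f.[x].
Proof.
move=> Rf Rx; rewrite horner_coef; apply: sr_sum => i _.
by apply: srM; [apply: Rf|apply: srX].
Qed.

End SubringTheory.

(** * Linear algebra modulo subspaces *)

Section LinearAlgebra.
Variable L : fieldType.
Implicit Types (K V W U : L -> Prop).

Definition subspace K V :=
  [/\ V 0, forall x y, V x -> V y -> V (x + y) & forall c x, K c -> V x -> V (c * x)].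
Definition zero_only : L -> Prop := fun x => x = 0.
Definition free_mod K W (I : finType) (x : I -> L) :=
  forall c : I -> L, (forall i, K (c i)) -> W (\sum_i c i * x i) -> forall i, c i = 0.
Definition gen_mod K W (I : finType) (x : I -> L) V :=
  forall v, V v -> exists c : I -> L, (forall i, K (c i)) /\ W (v - \sum_i c i * x i).
Definition basis_mod K V W (I : finType) (x : I -> L) :=
  [/\ forall i, V (x i), free_mod K W x & gen_mod K W x V].
(** Index types are arbitrary finite types, so that sums, products and dependent pairs of families
    serve as bases directly; [dimqE] relates this to the maximality form [dim_mod]. *)
Definition dimq K V W d :=
  exists (I : finType) (x : I -> L), #|I| = d /\ basis_mod K V W x.

Section OverK.
Variable K : L -> Prop.
Hypothesis HK : is_subfield K.

Lemma subspace_sum V (I : Type) (r : seq I) (P : pred I) (f : I -> L) :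
  subspace K V -> (forall i, P i -> V (f i)) -> V (\sum_(i <- r | P i) f i).
Proof. by move=> [V0 VD _] H; elim/big_rec: _ => [|i x Pi Vx] //; apply/VD/Vx/H. Qed.
Lemma subspaceN V x : subspace K V -> V x -> V (- x).
Proof. by move=> [_ _ VZ] Vx; rewrite -mulN1r; apply: VZ => //; exact: (sfN HK (sf1 HK)). Qed.
Lemma subspaceB V x y : subspace K V -> V x -> V y -> V (x - y).
Proof. by move=> sV Vx Vy; case: (sV) => _ VD _; apply: VD => //; apply: subspaceN. Qed.
Lemma subspace_lin V (I : finType) (c x : I -> L) :
  subspace K V -> (forall i, K (c i)) -> (forall i, V (x i)) -> V (\sum_i c i * x i).
Proof. by move=> sV Kc Vx; apply: subspace_sum => // i _; case: sV => _ _; apply. Qed.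
Lemma subspace_zero : subspace K zero_only.
Proof.
split=> [|x y -> ->|c x _ ->]; rewrite /zero_only ?addr0 ?mulr0 //.
Qed.

Lemma dependent_rows (I J : finType) (A : I -> J -> L) :
  (forall i j, K (A i j)) -> (#|J| < #|I|)%N ->
  exists c : I -> L, [/\ forall i, K (c i), exists i, c i != 0 &
                         forall j, \sum_i c i * A i j = 0].
Proof.
move=> KA ltJI; have [E [f fP]] := subfield_type HK.
have pre i : exists g : J -> E, forall j, A i j = f (g j).
  have H j : exists b, A i j = f b by exact/fP/KA.
  by have [g gP] := choice H; exists g.
have [B BP] := choice pre.
pose M := \matrix_(i < #|I|, j < #|J|) B (enum_val i) (enum_val j).
have : kermx M != 0.
  rewrite kermx_eq0 -row_leq_rank -ltnNge.
  by apply: leq_ltn_trans ltJI; apply: rank_leq_col.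
case/rowV0Pn=> v /sub_kermxP vM0 v0.
exists (fun i => f (v 0 (enum_rank i))); split=> [i||j].
- by apply/fP; eexists.
- move/eqP: v0 => v0; apply: contrapT => /forallNP H; apply: v0.
  apply/rowP => i; rewrite mxE; have := H (enum_val i); rewrite enum_valK.
  by move=> /negP; rewrite negbK fmorph_eq0 => /eqP.
- have := congr1 (fun w : 'rV_#|J| => f (w 0 (enum_rank j))) vM0.
  rewrite !mxE rmorph0 => vM; rewrite -[RHS]vM rmorph_sum /=.
  rewrite [LHS](reindex (@enum_val I I)) /=; last exact/onW_bij/enum_val_bij.
  by apply: eq_bigr => i _; rewrite rmorphM mxE enum_rankK BP enum_valK.
Qed.

(** The rank of a matrix over [K] is the same over [L]. This is what allows p-th roots, which exist
    in [L] only, to serve as coefficients of a relation. *)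
Lemma free_rows_ext (I J : finType) (A : I -> J -> L) :
  (forall i j, K (A i j)) ->
  (forall c : I -> L, (forall i, K (c i)) -> (forall j, \sum_i c i * A i j = 0) ->
     forall i, c i = 0) ->
  forall c : I -> L, (forall j, \sum_i c i * A i j = 0) -> forall i, c i = 0.
Proof.
move=> KA Afree; have [E [f fP]] := subfield_type HK.
have pre i : exists g : J -> E, forall j, A i j = f (g j).
  have H j : exists b, A i j = f b by exact/fP/KA.
  by have [g gP] := choice H; exists g.
have [B BP] := choice pre.
pose M := \matrix_(i < #|I|, j < #|J|) B (enum_val i) (enum_val j).
have freeM : row_free M.
  rewrite -kermx_eq0; apply: contrapT => /negP/rowV0Pn[v /sub_kermxP vM0 /eqP].
  apply; apply/rowP => i; rewrite mxE; apply: (fmorph_inj f); rewrite rmorph0.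
  have := Afree (fun i => f (v 0 (enum_rank i))) _ _ (enum_val i).
  rewrite enum_valK; apply=> [k|j]; first by apply/fP; eexists.
  have := congr1 (fun w : 'rV_#|J| => f (w 0 (enum_rank j))) vM0.
  rewrite !mxE rmorph0 => vM; rewrite -[RHS]vM rmorph_sum /=.
  rewrite [LHS](reindex (@enum_val I I)) /=; last exact/onW_bij/enum_val_bij.
  by apply: eq_bigr => k _; rewrite rmorphM mxE enum_rankK BP enum_valK.
move=> c cA0 i.
have : row_free (map_mx f M) by rewrite row_free_map.
rewrite -kermx_eq0 => /eqP kM0.
have /sub_kermxP : \row_k c (enum_val k) *m map_mx f M = 0.
  apply/rowP => j; rewrite !mxE -[RHS](cA0 (enum_val j)).
  rewrite [RHS](reindex (@enum_val I I)) /=; last exact/onW_bij/enum_val_bij.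
  by apply: eq_bigr => k _; rewrite !mxE BP.
rewrite kM0 submx0 => /eqP/rowP/(_ (enum_rank i)).
by rewrite !mxE enum_rankK.
Qed.

Lemma free_mod_reindex W (I J : finType) (h : J -> I) (x : I -> L) :
  bijective h -> free_mod K W x -> free_mod K W (x \o h).
Proof.
move=> [g hK gK] xfree c Kc Wc j; rewrite -[j]hK.
apply: (xfree (c \o g)) => [i|]; first exact: Kc.
rewrite (reindex h) /=; last by exists g => ? _; rewrite ?hK ?gK.
by under eq_bigr do rewrite /= hK.
Qed.

Lemma gen_mod_reindex V W (I J : finType) (h : J -> I) (x : I -> L) :
  bijective h -> gen_mod K W x V -> gen_mod K W (x \o h) V.
Proof.
move=> [g hK gK] xgen v /xgen[c [Kc Wc]]; exists (c \o h); split=> [i|]; first exact: Kc.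
by move: Wc; rewrite (reindex h) //=; exists g => ? _; rewrite ?hK ?gK.
Qed.

Lemma dimq_ord V W d : dimq K V W d -> exists x : 'I_d -> L, basis_mod K V W x.
Proof.
move=> [I [x [<- [Vx fx gx]]]]; exists (x \o enum_val); split=> [i||]; first exact: Vx.
  exact: free_mod_reindex (@enum_val_bij I) fx.
exact: gen_mod_reindex (@enum_val_bij I) gx.
Qed.

Lemma steinitz V W (I J : finType) (x : I -> L) (y : J -> L) :
  subspace K W -> gen_mod K W x V -> (forall j, V (y j)) -> free_mod K W y ->
  (#|J| <= #|I|)%N.
Proof.
move=> sW gx Vy fy; rewrite leqNgt; apply/negP => ltIJ.
have [a aP] := choice (fun j => gx _ (Vy j)).
have [||c [Kc [j0 cj0] c0]] := @dependent_rows J I a => // [j i|]; first by case: (aP j).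
move/eqP: cj0; apply; apply: fy => //.
have -> : \sum_j c j * y j = \sum_j c j * (y j - \sum_i a j i * x i).
  under [RHS]eq_bigr do rewrite mulrBr.
  rewrite sumrB [X in _ - X](_ : _ = 0) ?subr0 //.
  under eq_bigr do rewrite mulr_sumr.
  rewrite exchange_big big1 //= => i _.
  by under eq_bigr do rewrite mulrA; rewrite -mulr_suml c0 mul0r.
by apply: subspace_lin => // j; case: (aP j).
Qed.

Lemma dimq_unique V W d e : subspace K W -> dimq K V W d -> dimq K V W e -> d = e.
Proof.
move=> sW [I [x [<- [Vx fx gx]]]] [J [y [<- [Vy fy gy]]]].
by apply/eqP; rewrite eqn_leq; apply/andP; split; [apply: steinitz gy _ _|apply: steinitz gx _ _].
Qed.

Lemma free_dimq_le V W (I : finType) (x : I -> L) d : subspace K W ->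
  dimq K V W d -> (forall i, V (x i)) -> free_mod K W x -> (#|I| <= d)%N.
Proof. by move=> sW [J [y [<- [Vy fy gy]]]] Vx fx; apply: steinitz gy _ _. Qed.

Lemma big_option (I : finType) (f : option I -> L) :
  \sum_i f i = f None + \sum_i f (Some i).
Proof.
rewrite (bigD1 None) //=; congr (_ + _).
rewrite (reindex_omap Some id) //=; last by case.
by apply: eq_bigl => i; rewrite eqxx.
Qed.

Definition cons_fam (I : finType) (v : L) (x : I -> L) (o : option I) : L :=
  if o is Some i then x i else v.

Lemma free_cons W (I : finType) (x : I -> L) v : subspace K W -> free_mod K W x ->
  ~ (exists c : I -> L, (forall i, K (c i)) /\ W (v - \sum_i c i * x i)) ->
  free_mod K W (cons_fam v x).
Proof.
move=> sW fx nv c Kc; rewrite big_option /= => Wc.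
have c0 : c None = 0.
  apply: contrapT => /eqP c0; apply: nv.
  exists (fun i => - ((c None)^-1 * c (Some i))); split.
    by move=> i; apply/(sfN HK)/(sfM HK) => //; exact: (sfV HK).
  rewrite (_ : v - _ = (c None)^-1 * (c None * v + \sum_i c (Some i) * x i)).
    by case: sW => _ _; apply=> //; exact: (sfV HK).
  rewrite mulrDr mulKf // -sumrN mulr_sumr; congr (_ + _).
  by apply: eq_bigr => i _; rewrite !mulNr opprK mulrA.
move: Wc; rewrite c0 mul0r add0r => Wc.
by case=> [i|//]; apply: (fx (c \o Some)) => [k|//]; exact: Kc.
Qed.

Lemma gen_dimq_free V W (I : finType) (x : I -> L) : subspace K W ->
  dimq K V W #|I| -> gen_mod K W x V -> free_mod K W x.
Proof.
move=> sW [J [e [cJ [Ve fe ge]]]] gx c Kc Wc.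
have [a aP] := choice (fun j => gx _ (Ve j)).
(* The coordinates of the basis [e] and the relation [c] form more rows than columns. In a
   dependence [b] of these rows the part on [e] vanishes because [e] is free, so a nonzero multiple
   of [c] is 0. *)
pose A (o : option J) i := if o is Some j then a j i else c i.
have [||b [Kb [j0 bj0] b0]] := @dependent_rows _ _ A => [[j|] i||] //=.
- by case: (aP j).
- by rewrite card_option cJ.
have bS j : b (Some j) = 0.
  apply: (fe (b \o Some)) => [k|]; first exact: Kb.
  have -> : \sum_k (b \o Some) k * e k = \sum_k b (Some k) * (e k - \sum_i a k i * x i)
     - b None * (\sum_i c i * x i).
    under [X in _ = X - _]eq_bigr do rewrite mulrBr.
    rewrite sumrB -addrA -opprD [X in _ - X](_ : _ = 0) ?subr0 //.
    under eq_bigr do rewrite mulr_sumr.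
    rewrite exchange_big /= mulr_sumr -big_split big1 //= => i _.
    have bi := b0 i; rewrite big_option /= in bi.
    under eq_bigr do rewrite mulrA.
    by rewrite -mulr_suml mulrA -mulrDl addrC bi mul0r.
  apply: subspaceB => //; last by case: sW => _ _; apply.
  by apply: subspace_lin => // k; case: (aP k).
case: j0 bj0 => [j|]; first by rewrite bS eqxx.
move=> bN i; have := b0 i; rewrite big_option /= big1 ?addr0.
  by move/eqP; rewrite mulf_eq0 (negPf bN) => /eqP.
by move=> j _; rewrite bS mul0r.
Qed.

Lemma free_dimq_gen V W (I : finType) (x : I -> L) : subspace K W ->
  dimq K V W #|I| -> (forall i, V (x i)) -> free_mod K W x -> gen_mod K W x V.
Proof.
move=> sW dV Vx fx v Vv; apply: contrapT => nv.
have := free_dimq_le sW dV _ (free_cons sW fx nv).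
by rewrite card_option ltnn => H; have /H : forall i, V (cons_fam v x i) by case.
Qed.

Lemma free_ord V W (I : finType) (x : I -> L) :
  (forall i, V (x i)) -> free_mod K W x ->
  exists y : 'I_#|I| -> L, (forall i, V (y i)) /\ free_mod K W y.
Proof.
by move=> Vx fx; exists (x \o enum_val); split=> [i|]; [exact: Vx|exact: free_mod_reindex (@enum_val_bij I) fx].
Qed.

Lemma dimq_bounded V W B : subspace K W ->
  (forall n (y : 'I_n -> L), (forall i, V (y i)) -> free_mod K W y -> (n <= B)%N) ->
  exists2 d, (d <= B)%N & dimq K V W d.
Proof.
move=> sW bd.
pose P n := `[< exists y : 'I_n -> L, (forall i, V (y i)) /\ free_mod K W y >].
have P0 : exists n, P n.
  by exists 0; apply/asboolP; exists (fun=> 0); split=> [[]//|c _ _ []].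
have PB n : P n -> (n <= B)%N by move=> /asboolP[y [Vy fy]]; exact: bd Vy fy.
case: (ex_maxnP P0 PB) => d /asboolP[y [Vy fy]] dmax; exists d; first exact: bd Vy fy.
exists 'I_d, y; split; first by rewrite card_ord.
split=> // v Vv; apply: contrapT => nv.
have [|z [Vz fz]] := @free_ord V W _ (cons_fam v y) _ (free_cons sW fy nv); first by case.
suff /dmax : P d.+1 by rewrite ltnn.
by apply/asboolP; move: z Vz fz; rewrite card_option card_ord => z Vz fz; exists z.
Qed.

Lemma free_mod_sub W U (I : finType) (x : I -> L) :
  (forall z, U z -> W z) -> free_mod K W x -> free_mod K U x.
Proof. by move=> sUW fx c Kc Uc; apply: fx => //; apply: sUW. Qed.

Lemma dimq_sub V W U V' d : subspace K W -> subspace K U ->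
  (forall z, W z -> U z) -> (forall z, V' z -> V z) ->
  dimq K V W d -> exists2 e, (e <= d)%N & dimq K V' U e.
Proof.
move=> sW sU WU V'V dV; apply: dimq_bounded => // n y V'y fy.
rewrite -[n]card_ord; apply: free_dimq_le dV _ _ => // [i|]; first exact/V'V/V'y.
exact: free_mod_sub fy.
Qed.

Lemma dimqE V W d : subspace K V -> subspace K W -> dimq K V W d <-> dim_mod V K W d.
Proof.
move=> sV sW; split=> [dV|[[x [Vx fx]] max]].
  have [x [Vx fx gx]] := dimq_ord dV.
  split; first by exists x; split.
  move=> y Vy fy; have := free_dimq_le sW dV Vy fy; by rewrite card_ord ltnn.
exists 'I_d, x; split; first by rewrite card_ord.
split=> // v Vv; apply: contrapT => nv.
have [|z [Vz fz]] := @free_ord V W _ (cons_fam v x) _ (free_cons sW fx nv); first by case.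
by move: z Vz fz; rewrite card_option card_ord => z Vz fz; apply: max fz.
Qed.

Lemma dimq_refl V : subspace K V -> dimq K V V 0.
Proof.
move=> sV; exists 'I_0, (fun=> 0); split; first by rewrite card_ord.
split=> [[]//|c _ _ []//|v Vv]; exists (fun=> 0); split=> [[]//|].
by rewrite big_ord0 subr0.
Qed.

Lemma dimq0_sub V W : dimq K V W 0 -> forall v, V v -> W v.
Proof.
move=> /dimq_ord[x [_ _ gx]] v /gx[c [_]].
by rewrite big_ord0 subr0.
Qed.

Lemma dimq_add V W U a b : subspace K U -> subspace K W ->
  (forall z, W z -> V z) -> (forall z, U z -> W z) ->
  dimq K V W a -> dimq K W U b -> dimq K V U (a + b).
Proof.
move=> sU sW WV UW [I [x [<- [Vx fx gx]]]] [J [y [<- [Wy fy gy]]]].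
pose z (s : I + J) := match s with inl i => x i | inr j => y j end.
exists (I + J)%type, z; split; first by rewrite card_sum.
split=> [[i|j]|c Kc|v Vv] //=; first exact/WV/Wy.
- rewrite big_sumType /= => Uc.
  have c0 i : c (inl i) = 0.
    apply: (fx (c \o inl)) => [k|]; first exact: Kc.
    rewrite -[X in W X](addrK (\sum_j c (inr j) * y j)).
    by apply: subspaceB => //; [apply: UW|apply: subspace_lin].
  move=> [i|j] //; apply: (fy (c \o inr)) => [k|]; first exact: Kc.
  by move: Uc; rewrite big1 ?add0r // => i _; rewrite c0 mul0r.
- have [c [Kc Wc]] := gx _ Vv; have [d [Kd Ud]] := gy _ Wc.
  exists (fun s => match s with inl i => c i | inr j => d j end).
  by split=> [[]//|]; rewrite big_sumType /= opprD addrA.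
Qed.

End OverK.

End LinearAlgebra.

(** * Spans of products and direct sums *)

Section SpanProd.
Variable L : fieldType.
Implicit Types (A B K V W : L -> Prop).

Lemma span_prod_fin A B (I : finType) (a b : I -> L) :
  (forall i, A (a i)) -> (forall i, B (b i)) -> span_prod A B (\sum_i a i * b i).
Proof.
move=> Aa Bb; exists #|I|, (a \o enum_val), (b \o enum_val); split=> [i|i|]; [exact: Aa|exact: Bb|].
by rewrite (reindex (@enum_val I I)) //=; exact/onW_bij/enum_val_bij.
Qed.

Lemma span_prodM A B a b : A a -> B b -> span_prod A B (a * b).
Proof.
move=> Aa Bb; have := @span_prod_fin A B unit (fun=> a) (fun=> b).
by rewrite (big_pred1 tt) => [|[]//]; apply.
Qed.

Lemma span_prodD A B x y : span_prod A B x -> span_prod A B y -> span_prod A B (x + y).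
Proof.
move=> [m [a [b [Aa Bb ->]]]] [n [c [d [Ac Bd ->]]]].
pose f (s : 'I_m + 'I_n) := match s with inl i => a i | inr i => c i end.
pose g (s : 'I_m + 'I_n) := match s with inl i => b i | inr i => d i end.
have := @span_prod_fin A B _ f g.
by rewrite big_sumType; apply; case.
Qed.

Lemma span_prod0 A B : span_prod A B 0.
Proof. by exists 0, (fun=> 0), (fun=> 0); split=> [[]//|[]//|]; rewrite big_ord0. Qed.

Lemma span_prod_sum A B (I : Type) (r : seq I) (P : pred I) (f : I -> L) :
  (forall i, P i -> span_prod A B (f i)) -> span_prod A B (\sum_(i <- r | P i) f i).
Proof.
move=> H; elim/big_rec: _ => [|i x Pi]; first exact: span_prod0.
by apply: span_prodD; apply: H.
Qed.

Lemma span_prod_subspace A B : is_subfield A -> subspace A (span_prod A B).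
Proof.
move=> HA; split; [exact: span_prod0|by move=> x y; apply: span_prodD|].
move=> c x Ac [m [a [b [Aa Bb ->]]]]; rewrite mulr_sumr.
under eq_bigr do rewrite mulrA.
by apply: span_prod_fin => // i; apply: sfM.
Qed.

Lemma span_prod_min A B V : subspace A V -> (forall x, B x -> V x) ->
  forall x, span_prod A B x -> V x.
Proof.
move=> sV BV x [m [a [b [Aa Bb ->]]]].
by case: sV => V0 VD VZ; elim/big_rec: _ => // i y _ Vy; apply/VD/Vy/VZ/BV.
Qed.

Lemma span_prod_mono A B A' B' : (forall x, A x -> A' x) -> (forall x, B x -> B' x) ->
  forall x, span_prod A B x -> span_prod A' B' x.
Proof.
by move=> sA sB x [m [a [b [Aa Bb ->]]]]; apply: span_prod_fin => i; [apply: sA|apply: sB].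
Qed.

Lemma span_prod_subr A B : A 1 -> forall x, B x -> span_prod A B x.
Proof. by move=> A1 x Bx; rewrite -[x]mul1r; apply: span_prodM. Qed.

Lemma span_prod_subl A B : B 1 -> forall x, A x -> span_prod A B x.
Proof. by move=> A1 x Bx; rewrite -[x]mulr1; apply: span_prodM. Qed.

Lemma span_prod_ring A B : is_subring A -> is_subring B -> is_subring (span_prod A B).
Proof.
move=> HA HB; split; first exact: (span_prod_subl (sr1 HB) (sr1 HA)).
move=> x y Sx [n [c [d [Ac Bd yE]]]]; split.
  apply: span_prodD => //; rewrite {}yE -sumrN; under eq_bigr do rewrite -mulNr.
  by apply: span_prod_fin => // i; apply: srN.
case: Sx => m [a [b [Aa Bb ->]]]; rewrite yE mulr_suml.
apply: span_prod_sum => i _; rewrite mulr_sumr; apply: span_prod_sum => j _.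
by rewrite mulrACA; apply: span_prodM; apply: srM.
Qed.

Lemma subring_subspace K R : is_subring R -> (forall x, K x -> R x) -> subspace K R.
Proof.
move=> HR sKR; split=> [|x y|c x Kc]; [exact: sr0|exact: srD|].
by move=> Rx; apply: srM => //; apply: sKR.
Qed.

End SpanProd.

Section DirectSum.
Variables (L : fieldType) (K E1 : L -> Prop).
Hypotheses (HK : is_subfield K) (sKE : forall x, K x -> E1 x).

Definition direct_sum (n : nat) (V : 'I_n -> L -> Prop) (y : 'I_n -> L) (x : L) :=
  exists b : 'I_n -> L, (forall i, V i (b i)) /\ x = \sum_i b i * y i.

Lemma direct_sum_subspace n (V : 'I_n -> L -> Prop) y :
  (forall i, subspace K (V i)) -> subspace K (direct_sum V y).
Proof.
move=> sV; split.
- exists (fun=> 0); split=> [i|]; first by case: (sV i).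
  by rewrite big1 // => i _; rewrite mul0r.
- move=> x z [a [Va ->]] [b [Vb ->]]; exists (fun i => a i + b i); split=> [i|].
    by case: (sV i) => _ + _; apply.
  by rewrite -big_split; apply: eq_bigr => i _; rewrite mulrDl.
- move=> c x Kc [a [Va ->]]; exists (fun i => c * a i); split=> [i|].
    by case: (sV i) => _ _; apply.
  by rewrite mulr_sumr; apply: eq_bigr => i _; rewrite mulrA.
Qed.

(** All summands lie in [E1] and [y] is free over [E1], so coordinates along [y] are unique and the
    quotients can be treated one coordinate at a time. *)
Lemma dimq_direct_sum n (V W : 'I_n -> L -> Prop) (y : 'I_n -> L) (d : 'I_n -> nat) :
  is_subfield E1 -> free_mod E1 (@zero_only L) y ->
  (forall i, subspace K (V i)) -> (forall i, subspace K (W i)) ->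
  (forall i x, V i x -> E1 x) -> (forall i x, W i x -> E1 x) ->
  (forall i, dimq K (V i) (W i) (d i)) ->
  dimq K (direct_sum V y) (direct_sum W y) (\sum_i d i)%N.
Proof.
move=> HE1 fy sV sW VE WE dVW.
have uniq_coef (a b : 'I_n -> L) : (forall i, E1 (a i)) -> (forall i, E1 (b i)) ->
    \sum_i a i * y i = \sum_i b i * y i -> a =1 b.
  move=> Ea Eb ab i; apply/eqP; rewrite -subr_eq0; apply/eqP.
  apply: (fy (fun i => a i - b i)) => [k|]; first exact: sfB.
  rewrite /zero_only; under eq_bigr do rewrite mulrBl.
  by rewrite sumrB ab subrr.
have ex_basis i : exists x : 'I_(d i) -> L, basis_mod K (V i) (W i) x.
  exact: dimq_ord.
pose x i := projT1 (cid (ex_basis i)).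
have xP i : basis_mod K (V i) (W i) (x i) := projT2 (cid (ex_basis i)).
exists {i : 'I_n & 'I_(d i)}, (fun t => x (tag t) (tagged t) * y (tag t)); split.
  rewrite card_tagged sumnE big_map big_enum /=.
  by apply: eq_bigr => i _; rewrite card_ord.
have sigE (c : {i : 'I_n & 'I_(d i)} -> L) :
    \sum_t c t * (x (tag t) (tagged t) * y (tag t)) =
    \sum_i (\sum_j c (Tagged (fun i => 'I_(d i)) j) * x i j) * y i.
  under [RHS]eq_bigr do rewrite mulr_suml.
  rewrite (sig_big_dep xpredT (fun _ => xpredT)) /=.
  by apply: eq_bigr => -[i j] _ /=; rewrite mulrA.
split.
- move=> [i j] /=; exists (fun k => if k == i then x i j else 0); split=> [k|].
    by case: eqP => [->|_]; [case: (xP i)|case: (sV k)].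
  by rewrite (bigD1 i) //= eqxx big1 ?addr0 // => k /negPf->; rewrite mul0r.
- move=> c Kc; rewrite sigE => -[b [Wb bE]] [i j].
  have := uniq_coef _ b _ _ bE i.
  case: (xP i) => Vx fx _ H; apply: (fx (fun j => c (Tagged (fun i => 'I_(d i)) j))) => [k|]; first exact: Kc.
  rewrite H //= => [k|k]; last exact: WE (Wb k).
  by apply: (VE k); apply: subspace_lin => // l; case: (xP k).
- move=> v [b [Vb ->]].
  have ex_c i : exists c : 'I_(d i) -> L, (forall j, K (c j)) /\
      W i (b i - \sum_j c j * x i j) by case: (xP i) => _ _; apply.
  pose c i := projT1 (cid (ex_c i)).
  have cP i : (forall j, K (c i j)) /\ W i (b i - \sum_j c i j * x i j) :=
    projT2 (cid (ex_c i)).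
  exists (fun t => c (tag t) (tagged t)); split=> [[i j]|] /=.
    by case: (cP i).
  rewrite sigE /= -sumrB; exists (fun i => b i - \sum_j c i j * x i j).
  split=> [i|]; first by case: (cP i).
  by apply: eq_bigr => i _; rewrite mulrBl.
Qed.

End DirectSum.

(** * Frobenius powers *)

Section PowersOfP.
Variables (L : comNzRingType) (p : nat).
Hypothesis (pchL : p \in [pchar L]).

Lemma pow_nat b : [pchar L].-nat (p ^ b)%N.
Proof. by rewrite pnatX pnatE ?pchL // (pcharf_prime pchL). Qed.

Lemma powD b (x y : L) : (x + y) ^+ (p ^ b) = x ^+ (p ^ b) + y ^+ (p ^ b).
Proof. exact: exprDn_pchar (pow_nat b). Qed.

Lemma pow0 b : (0 : L) ^+ (p ^ b) = 0.
Proof. by rewrite expr0n expn_eq0 eqn0Ngt prime_gt0 // (pcharf_prime pchL). Qed.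

Lemma powN b (x : L) : (- x) ^+ (p ^ b) = - (x ^+ (p ^ b)).
Proof.
by apply/eqP; rewrite -addr_eq0 -powD addNr pow0.
Qed.

Lemma powB b (x y : L) : (x - y) ^+ (p ^ b) = x ^+ (p ^ b) - y ^+ (p ^ b).
Proof. by rewrite powD powN. Qed.

Lemma pow_sum b (I : Type) (r : seq I) (P : pred I) (f : I -> L) :
  (\sum_(i <- r | P i) f i) ^+ (p ^ b) = \sum_(i <- r | P i) f i ^+ (p ^ b).
Proof.
by elim/big_rec2: _ => [|i x y _ <-]; rewrite ?pow0 ?powD.
Qed.

End PowersOfP.

Section FrobeniusPower.
Variables (L : fieldType) (p : nat).
Hypothesis (pchL : p \in [pchar L]).

Lemma pow_inj b (x y : L) : x ^+ (p ^ b) = y ^+ (p ^ b) -> x = y.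
Proof.
move=> xy; apply/eqP; rewrite -subr_eq0.
have : (x - y) ^+ (p ^ b) = 0 by rewrite (powB pchL) xy subrr.
by move/eqP; rewrite expf_eq0 => /andP[].
Qed.

Definition frob_set b (V : L -> Prop) : L -> Prop := fun z => exists y, V y /\ z = y ^+ (p ^ b).
(* The [K]-span [K[V^(p^b)]]; for [V = F] this is the Frobenius pullback [F_b]. *)
Definition frob_span K b (V : L -> Prop) : L -> Prop := span_prod K (frob_set b V).

Implicit Types (K V W F : L -> Prop).

Lemma frob_set_sub b V W : (forall x, V x -> W x) -> forall x, frob_set b V x -> frob_set b W x.
Proof. by move=> sVW x [y [Vy ->]]; exists y; split=> //; apply: sVW. Qed.

Lemma frob_span_mono K b V W : (forall x, V x -> W x) ->
  forall x, frob_span K b V x -> frob_span K b W x.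
Proof. by move=> sVW; apply: span_prod_mono => //; apply: frob_set_sub. Qed.

Lemma frob_span_pow K b V x : K 1 -> V x -> frob_span K b V (x ^+ (p ^ b)).
Proof. by move=> K1 Vx; apply: span_prod_subr => //; exists x. Qed.

Lemma frob_set_ring b R : is_subring R -> is_subring (frob_set b R).
Proof.
move=> HR; split; first by exists 1; rewrite expr1n; split=> //; apply: sr1.
move=> _ _ [x [Rx ->]] [y [Ry ->]]; split.
  by exists (x - y); rewrite (powB pchL); split=> //; apply: srB.
by exists (x * y); rewrite exprMn; split=> //; apply: srM.
Qed.

Lemma frob_span_ring K b R : is_subfield K -> is_subring R -> is_subring (frob_span K b R).
Proof. by move=> HK HR; apply: span_prod_ring; [apply: sf_ring|apply: frob_set_ring]. Qed.

Lemma frob_span_subK K b V : V 1 -> forall x, K x -> frob_span K b V x.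
Proof. by move=> V1; apply: span_prod_subl; exists 1; rewrite expr1n. Qed.

Lemma frob_span0 K V : is_subfield K -> subspace K V -> frob_span K 0 V = V.
Proof.
move=> HK sV; apply/predeqP => x; split.
  by apply: span_prod_min => // _ [y [Vy ->]]; rewrite expn0 expr1.
move=> Vx; apply: span_prod_subr; first exact: sf1.
by exists x; rewrite expn0 expr1.
Qed.

Lemma frob_span_comp K a b V : is_subfield K ->
  frob_span K b (frob_span K a V) = frob_span K (a + b) V.
Proof.
move=> HK; apply/predeqP => x; split.
  apply: span_prod_min; first exact: span_prod_subspace.
  move=> _ [_ [[m [c [y [Kc Vy ->]]]] ->]]; rewrite (pow_sum pchL).
  apply: span_prod_sum => i _; rewrite exprMn; apply: span_prodM; first exact: sfX.
  by case: (Vy i) => z [Vz ->]; exists z; rewrite -exprM -expnD.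
apply: span_prod_mono => // _ [y [Vy ->]].
by exists (y ^+ (p ^ a)); rewrite -exprM -expnD; split=> //; apply: frob_span_pow => //; apply: sf1.
Qed.

(* The hypothesis [powfree] says that [F] is linearly disjoint over [K] from the
   field of [p ^ b]-th roots of [K']. *)
Lemma free_mod_frob K K' F b W (I : finType) (x : I -> L) :
  is_subfield K -> (forall c, K c -> K' (c ^+ (p ^ b))) -> is_subfield K' ->
  (forall (J : finType) (f : J -> L), (forall j, F (f j)) ->
     free_mod K (@zero_only L) f -> free_mod K' (@zero_only L) (fun j => f j ^+ (p ^ b))) ->
  subspace K W -> (forall z, W z -> F z) -> (forall i, F (x i)) ->
  free_mod K W x ->
  free_mod K' (span_prod K' (frob_set b W)) (fun i => x i ^+ (p ^ b)).
Proof.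
move=> HK KK' HK' powfree sW WF Fx fx c Kc [m [d [w [Kd Ww wE]]]].
have [u uP] := choice Ww.
(* Only the finitely many [u j] of the given relation matter. A [K]-basis [v] of their span together
   with [x] is free over [K], as [x] is free modulo [W]; [powfree] applies to this joint family. *)
pose W0 z := exists a : 'I_m -> L, (forall j, K (a j)) /\ z = \sum_j a j * u j.
have W0W z : W0 z -> W z.
  by move=> [a [Ka ->]]; apply: (subspace_lin sW) => // j; case: (uP j).
have [|e _ /dimq_ord[v [Wv fv gv]]] := @dimq_bounded _ _ HK W0 (@zero_only L) m (subspace_zero K).
  move=> n y W0y fy; rewrite -[n]card_ord -[m]card_ord.
  apply: (steinitz HK (subspace_zero K) (V := W0) (x := u)) => // z [a [Ka ->]].
  by exists a; split=> //; rewrite /zero_only subrr.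
have W0u j : W0 (u j).
  exists (fun k => (k == j)%:R); split=> [k|].
    by case: (k == j); [apply: sf1|apply: sf0].
  by rewrite (bigD1 j) //= eqxx mul1r big1 ?addr0 // => k /negPf->; rewrite mul0r.
have [g gP] := choice (fun j => gv _ (W0u j)).
pose f (s : I + 'I_e) := match s with inl i => x i | inr j => v j end.
have ff : free_mod K (@zero_only L) f.
  move=> h Kh; rewrite /zero_only big_sumType /= => h0.
  have hi i : h (inl i) = 0.
    apply: (fx (h \o inl)) => [k|]; first exact: Kh.
    move/eqP: h0; rewrite addr_eq0 => /eqP ->; apply: (subspaceN HK sW) => /=.
    by apply: (subspace_lin sW) => // j; apply: W0W.
  move=> [i|j]; first exact: hi.
  apply: (fv (h \o inr)) => [k|]; first exact: Kh.
  by move: h0; rewrite big1 ?add0r // => i _; rewrite hi mul0r.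
have Ff s : F (f s) by case: s => [i|j] //=; apply/WF/W0W.
have := powfree _ f Ff ff.
pose h (s : I + 'I_e) := match s with inl i => c i
  | inr k => - \sum_j d j * g j k ^+ (p ^ b) end.
move/(_ h) => H i; apply: (H _ _ (inl i)) => [[k|k]|] /=; first exact: Kc.
  apply: sfN => //; apply: sf_sum => // j _; apply: sfM => //; apply: KK'.
  by case: (gP j).
rewrite /zero_only big_sumType /= wE.
under [X in _ + X]eq_bigr do rewrite mulNr.
rewrite sumrN; apply/eqP; rewrite subr_eq0; apply/eqP.
under [RHS]eq_bigr do rewrite mulr_suml.
rewrite exchange_big; apply: eq_bigr => j _ /=.
have [_ ->] := uP j; have [_ /eqP] := gP j; rewrite subr_eq0 => /eqP ->.
rewrite (pow_sum pchL) mulr_sumr; apply: eq_bigr => k _.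
by rewrite exprMn mulrA.
Qed.

Lemma dimq_frob K F b V W d : is_subfield K ->
  (forall (J : finType) (f : J -> L), (forall j, F (f j)) ->
     free_mod K (@zero_only L) f -> free_mod K (@zero_only L) (fun j => f j ^+ (p ^ b))) ->
  subspace K W -> (forall z, W z -> F z) -> (forall z, V z -> F z) ->
  dimq K V W d -> dimq K (frob_span K b V) (frob_span K b W) d.
Proof.
move=> HK powfree sW WF VF [I [x [cI [Vx fx gx]]]].
exists I, (fun i => x i ^+ (p ^ b)); split=> //; split.
- by move=> i; apply: frob_span_pow => //; apply: sf1.
- apply: (free_mod_frob (F := F) (K := K)) => //; first by move=> c; apply: sfX.
  by move=> i; apply: VF.
- move=> v [m [c [y [Kc Vy ->]]]].
  have [u uP] := choice Vy.
  have [a aP] := choice (fun j => gx _ (proj1 (uP j))).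
  exists (fun i => \sum_j c j * a j i ^+ (p ^ b)); split=> [i|].
    by apply: sf_sum => // j _; apply: sfM => //; apply: sfX => //; case: (aP j).
  rewrite (_ : _ - _ = \sum_j c j * (u j - \sum_i a j i * x i) ^+ (p ^ b)).
    apply: span_prod_fin => // j; exists (u j - \sum_i a j i * x i); split=> //.
    by case: (aP j).
  under [RHS]eq_bigr do rewrite (powB pchL) mulrBr.
  rewrite sumrB; congr (_ - _); first by apply: eq_bigr => j _; case: (uP j) => _ ->.
  under eq_bigr do rewrite mulr_suml.
  rewrite exchange_big; apply: eq_bigr => j _ /=.
  rewrite (pow_sum pchL) mulr_sumr; apply: eq_bigr => i _.
  by rewrite exprMn mulrA.
Qed.

End FrobeniusPower.

(** * Polynomials and finite extensions *)

Section PolyOver.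
Variables (L : fieldType).
Implicit Types (K E A : L -> Prop) (f g : {poly L}).

Lemma poly_over_map (E : fieldType) (i : {rmorphism E -> L}) K f :
  (forall x, K x <-> exists a, x = i a) -> poly_over K f ->
  exists g : {poly E}, f = map_poly i g.
Proof.
move=> iP Kf; have H j : exists a, f`_j = i a by apply/iP.
have [c cP] := choice H; exists (\poly_(j < size f) c j).
apply/polyP => j; rewrite coef_map coef_poly; case: ltnP => lej; first exact: cP.
by rewrite raddf0 nth_default.
Qed.

Lemma map_poly_over (E : fieldType) (i : {rmorphism E -> L}) K (g : {poly E}) :
  (forall x, K x <-> exists a, x = i a) -> poly_over K (map_poly i g).
Proof. by move=> iP j; rewrite coef_map; apply/iP; eexists. Qed.

Lemma poly_over_sub K E f : (forall x, K x -> E x) -> poly_over K f -> poly_over E f.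
Proof. by move=> sKE Kf i; apply: sKE. Qed.

Section Ring.
Variable A : L -> Prop.
Hypothesis HA : is_subring A.

Lemma poly_overC c : A c -> poly_over A c%:P.
Proof. by move=> Ac i; rewrite coefC; case: eqP => // _; apply: sr0. Qed.
Lemma poly_overX : poly_over A 'X.
Proof. by move=> i; rewrite coefX; apply: sr_nat. Qed.
Lemma poly_overD f g : poly_over A f -> poly_over A g -> poly_over A (f + g).
Proof. by move=> Af Ag i; rewrite coefD; apply: srD. Qed.
Lemma poly_overN f : poly_over A f -> poly_over A (- f).
Proof. by move=> Af i; rewrite coefN; apply: srN. Qed.
Lemma poly_overB f g : poly_over A f -> poly_over A g -> poly_over A (f - g).
Proof. by move=> Af Ag; apply/poly_overD/poly_overN. Qed.
Lemma poly_overM f g : poly_over A f -> poly_over A g -> poly_over A (f * g).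
Proof. by move=> Af Ag i; rewrite coefM; apply: sr_sum => // j _; apply: srM. Qed.
Lemma poly_overXn n f : poly_over A f -> poly_over A (f ^+ n).
Proof.
move=> Af; elim: n => [|n IH]; last by rewrite exprS; apply: poly_overM.
by rewrite expr0; apply: poly_overC; apply: sr1.
Qed.
Lemma poly_overZ c f : A c -> poly_over A f -> poly_over A (c *: f).
Proof. by move=> Ac Af i; rewrite coefZ; apply: srM. Qed.
Lemma poly_over_sum (I : Type) (r : seq I) (P : pred I) (F : I -> {poly L}) :
  (forall i, P i -> poly_over A (F i)) -> poly_over A (\sum_(i <- r | P i) F i).
Proof. by move=> H i; rewrite coef_sum; apply: sr_sum => // j Pj; apply: H. Qed.
Lemma poly_over_prod (I : Type) (r : seq I) (P : pred I) (F : I -> {poly L}) :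
  (forall i, P i -> poly_over A (F i)) -> poly_over A (\prod_(i <- r | P i) F i).
Proof.
move=> H; elim/big_rec: _ => [|i x Pi Ax]; first by apply: poly_overC; apply: sr1.
by apply: poly_overM => //; apply: H.
Qed.
Lemma poly_over_poly n (c : nat -> L) :
  (forall i, A (c i)) -> poly_over A (\poly_(i < n) c i).
Proof. by move=> Ac i; rewrite coef_poly; case: ifP => // _; apply: sr0. Qed.
Lemma poly_over_comp f g : poly_over A f -> poly_over A g -> poly_over A (f \Po g).
Proof.
move=> Af Ag; rewrite comp_polyE; apply: poly_over_sum => i _.
by apply: poly_overZ => //; apply: poly_overXn.
Qed.

End Ring.

Section Field.
Variable K : L -> Prop.
Hypothesis HK : is_subfield K.

Lemma poly_over_mod f g : poly_over K f -> poly_over K g -> poly_over K (f %% g).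
Proof.
have [E [i iP]] := subfield_type HK.
move=> /(poly_over_map iP)[f' ->] /(poly_over_map iP)[g' ->].
by rewrite -map_modp; apply: map_poly_over.
Qed.

Lemma poly_over_div f g : poly_over K f -> poly_over K g -> poly_over K (f %/ g).
Proof.
have [E [i iP]] := subfield_type HK.
move=> /(poly_over_map iP)[f' ->] /(poly_over_map iP)[g' ->].
by rewrite -map_divp; apply: map_poly_over.
Qed.

Lemma poly_over_gcd f g : poly_over K f -> poly_over K g -> poly_over K (gcdp f g).
Proof.
have [E [i iP]] := subfield_type HK.
move=> /(poly_over_map iP)[f' ->] /(poly_over_map iP)[g' ->].
by rewrite -gcdp_map; apply: map_poly_over.
Qed.

End Field.

End PolyOver.

(** * Separable polynomials and p-th powers *)

Section SeparableFrobenius.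
Variables (L : closedFieldType) (p : nat) (K : L -> Prop).
Hypotheses (pchL : p \in [pchar L]) (HK : is_subfield K).

Lemma proot (x : L) b : exists y, y ^+ (p ^ b) = x.
Proof.
have q0 : (0 < p ^ b)%N by rewrite expn_gt0 prime_gt0 // (pcharf_prime pchL).
have : size ('X^(p ^ b) - x%:P) != 1 by rewrite size_XnsubC // eqSS -lt0n.
by case/closed_rootP => y; rewrite rootE !hornerE subr_eq0 => /eqP; exists y.
Qed.

Lemma proot_fun (c : nat -> L) : exists d : nat -> L, forall i, d i ^+ p = c i.
Proof.
have H i : exists y, y ^+ p = c i by have [y] := proot (c i) 1; rewrite expn1; exists y.
by have [d dP] := choice H; exists d.
Qed.

Lemma pchar_poly : p \in [pchar {poly L}].
Proof. exact: (rmorph_pchar (@polyC L)). Qed.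

(** The coefficients of [B] are p-th roots of those of [A]; they exist in [L], in general not in the
    subfield containing the coefficients of [A]. *)
Lemma comp_Xp_is_power (A : {poly L}) :
  exists B : {poly L}, (size B <= size A)%N /\ A \Po 'X^p = B ^+ p.
Proof.
have [b bP] := proot_fun (fun i => A`_i).
exists (\poly_(i < size A) b i); split; first exact: size_poly.
rewrite -[in RHS](expn1 p) poly_def (pow_sum pchar_poly) expn1 comp_polyE.
apply: eq_bigr => i _; by rewrite -bP exprZn -!exprM mulnC.
Qed.

(** The roots of [f] are simple, and each is a root of [B ^+ p], hence of [B]. *)
Lemma coprime_deriv_dvd (f B : {poly L}) : f != 0 -> coprimep f f^`() ->
  f %| B ^+ p -> f %| B.
Proof.
move=> f0 cop fB; have [r fE] := closed_field_poly_normal f.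
have lc0 : lead_coef f != 0 by rewrite lead_coef_eq0.
set P := \prod_(z <- r) _ in fE.
have Pf : P %| f by rewrite fE dvdpZr.
have sepf : separable_poly f by rewrite unlock.
have ur : uniq r by rewrite -separable_prod_XsubC; exact: dvdp_separable Pf sepf.
rewrite fE dvdpZl //.
apply: uniq_roots_dvdp; last by rewrite uniq_rootsE.
apply/allP => x xr; have : root (B ^+ p) x.
  rewrite -dvdp_XsubCl; apply: dvdp_trans (dvdp_trans Pf fB).
  by rewrite /P (big_rem x) //= dvdp_mulIl.
by rewrite !rootE horner_exp expf_eq0 => /andP[].
Qed.

(* For separable [f] the powers [X^(p i)], [i < deg f], stay independent modulo [f],
   so [X] is a polynomial in [X^p] modulo [f]. *)
Lemma separable_frob (f : {poly L}) : f != 0 -> poly_over K f -> coprimep f f^`() ->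
  exists2 h, poly_over K h & f %| 'X - (h \Po 'X^p).
Proof.
move=> f0 Kf cop; set n := (size f).-1.
have sf : size f = n.+1 by rewrite prednK // lt0n size_poly_eq0.
have p0 : (0 < p)%N by rewrite prime_gt0 // (pcharf_prime pchL).
have KR := sf_ring HK.
pose A (o : option 'I_n) (j : 'I_n) :=
  ((if o is Some i then 'X^(p * i) else 'X) %% f : {poly L})`_j.
have [||c [Kc [o co] c0]] := @dependent_rows _ _ HK _ _ A.
- move=> o j; apply: poly_over_mod => //.
  by case: o => [i|]; [apply: (poly_overXn KR)|]; apply: (poly_overX KR).
- by rewrite card_option !card_ord.
pose a i := if insub i is Some j then c (Some j) else 0 : L.
have aE (i : 'I_n) : a i = c (Some i) by rewrite /a valK.
have Ka i : K (a i) by rewrite /a; case: insub => [j|] //; apply: sf0.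
pose g := \poly_(i < n) a i.
have gXp : g \Po 'X^p = \sum_(i < n) c (Some i) *: 'X^(p * i).
  rewrite /g poly_def raddf_sum; apply: eq_bigr => i _ /=.
  by rewrite -aE comp_polyZ comp_Xn_poly -exprM.
have fdvd : f %| c None *: 'X + (g \Po 'X^p).
  apply/modp_eq0P; apply/polyP => j; rewrite coef0.
  have [jn|nj] := ltnP j n; last first.
    by rewrite nth_default //; apply: leq_trans nj; rewrite -ltnS -sf ltn_modp.
  have := c0 (Ordinal jn); rewrite big_option /A /= => cj0.
  rewrite -[RHS]cj0 gXp modpD modpZl coefD coefZ; congr (_ + _).
  rewrite (big_morph (fun q => q %% f) (fun u v => modpD f u v) (mod0p f)) coef_sum.
  by apply: eq_bigr => i _; rewrite modpZl coefZ.
(* Otherwise [f] divides g(X^p) = B^p, hence [B], whose degree is below that of [f]; then all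
   coefficients of the dependence vanish. *)
have cN : c None != 0.
  apply/eqP => cN; move: fdvd; rewrite cN scale0r add0r.
  have [B [sB gB]] := comp_Xp_is_power g.
  rewrite gB => /coprime_deriv_dvd-/(_ f0 cop) fB.
  have B0 : B = 0.
    apply/eqP/negPn/negP => B0; have := dvdp_leq B0 fB; rewrite sf ltnNge => /negP[].
    exact: leq_trans sB (size_poly _ _).
  have g0 : g = 0.
    apply/polyP => i; have := congr1 (fun q : {poly L} => q`_(i * p)) gB.
    by rewrite B0 expr0n eqn0Ngt p0 coef_comp_poly_Xn // dvdn_mull // mulnK // !coef0.
  move/eqP: co; case: o => [i|//] []; rewrite -aE.
  by have := congr1 (fun q : {poly L} => q`_i) g0; rewrite coef_poly ltn_ord coef0.
exists (- (c None)^-1 *: g).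
  by apply: poly_overZ => //; [apply/(sfN HK)/(sfV HK)|apply: poly_over_poly].
rewrite comp_polyZ scaleNr opprK -(dvdpZr _ _ cN) scalerDr scalerA divff //.
by rewrite scale1r.
Qed.

End SeparableFrobenius.

Section PurelyInseparable.
Variables (k : fieldType) (p : nat) (E : k -> Prop).
Hypotheses (pchk : p \in [pchar k]) (HE : is_subfield E).

(** A relation [g] has a common divisor over [E] with X^p - y^p = (X - y)^p, necessarily (X - y)^m
    with 0 < m < p. Its coefficient of degree m - 1 is -m y, and m is invertible, so y would lie in
    [E]. *)
Lemma powers_free (y : k) : ~ E y -> E (y ^+ p) ->
  free_mod E (@zero_only k) (fun i : 'I_p => y ^+ i).
Proof.
move=> nEy Eyp c Ec; rewrite /zero_only => c0.
have p0 : (0 < p)%N by rewrite prime_gt0 // (pcharf_prime pchk).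
have ER := sf_ring HE.
pose a i := if insub i is Some j then c j else 0 : k.
have aE (i : 'I_p) : a i = c i by rewrite /a valK.
have Ea i : E (a i) by rewrite /a; case: insub => [j|] //; apply: sf0.
pose g := \poly_(i < p) a i.
suff g0 : g = 0.
  move=> i; rewrite -aE; have := congr1 (fun q : {poly k} => q`_i) g0.
  by rewrite coef_poly ltn_ord coef0.
apply: contrapT => /eqP g0.
have gy : g.[y] = 0.
  by rewrite horner_poly -[RHS]c0; apply: eq_bigr => i _; rewrite aE.
pose h : {poly k} := 'X^p - (y ^+ p)%:P.
have hE : h = ('X - y%:P) ^+ p.
  have pchP : p \in [pchar {poly k}] by exact: (rmorph_pchar (@polyC k)).
  by rewrite -[in RHS](expn1 p) (powB pchP) expn1 /h polyC_exp.
pose d := gcdp g h.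
have dE : poly_over E d.
  apply: poly_over_gcd => //; first exact: poly_over_poly.
  by apply: (poly_overB ER); [apply/(poly_overXn ER)/(poly_overX ER)|apply: (poly_overC ER)].
have [m lemp dm] : exists2 m, (m <= p)%N & d %= ('X - y%:P) ^+ m.
  by apply/dvdp_exp_XsubCP; rewrite -hE dvdp_gcdr.
have sd : size d = m.+1 by rewrite (eqp_size dm) size_exp_XsubC.
have d0 : d != 0 by rewrite -size_poly_gt0 sd.
have ltmp : (m < p)%N.
  by rewrite -sd; apply: leq_trans (size_poly _ a); apply: dvdp_leq => //; apply: dvdp_gcdl.
have dy : root d y.
  by rewrite /d root_gcd !rootE gy eqxx hE horner_exp !hornerE subrr expr0n eqn0Ngt p0 /=.
have m0 : (0 < m)%N.
  rewrite lt0n; apply/eqP => m0; move: dm; rewrite m0 expr0 => /eqp_root/(_ y).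
  by rewrite dy /root hornerC oner_eq0.
pose d1 := (lead_coef d)^-1 *: d.
have d1E : d1 = ('X - y%:P) ^+ m.
  apply/eqP; rewrite -eqp_monic ?monic_exp ?monicXsubC //; last first.
    by rewrite monicE lead_coefZ mulVf // lead_coef_eq0.
  by apply: eqp_trans dm; rewrite /d1 eqp_scale // invr_eq0 lead_coef_eq0.
have : E (d1`_m.-1).
  by apply: poly_overZ => //; apply: (sfV HE); rewrite lead_coefE.
have -> : d1 = \prod_(z <- nseq m y) ('X - z%:P).
  by rewrite d1E big_nseq; elim: (m) => [|l IH]; rewrite ?expr0 // exprS IH.
have := @coefPn_prod_XsubC k (nseq m y); rewrite size_nseq -lt0n m0 => -> //.
rewrite big_nseq -Monoid.iteropE; have -> : iterop m +%R y 0 = y *+ m by [].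
move=> Emy; apply: nEy.
have mk : m%:R != 0 :> k by rewrite -(dvdn_pcharf pchk) gtnNdvd.
rewrite -[y](mulfK mk) mulr_natr -[_ *+ m]opprK.
by apply: sfM => //; [apply: sfN|apply: sfV => //; apply: sr_nat].
Qed.

End PurelyInseparable.

Section FiniteExtensions.
Variable L : fieldType.
Implicit Types (K E A V : L -> Prop).

Definition fin_gen E V := exists n (x : 'I_n -> L), gen_mod E (@zero_only L) x V.

Lemma fin_gen_fin E V (I : finType) (x : I -> L) :
  gen_mod E (@zero_only L) x V -> fin_gen E V.
Proof.
by move=> gx; exists #|I|, (x \o enum_val); apply: gen_mod_reindex (@enum_val_bij I) gx.
Qed.

Lemma fin_gen_dimq E V : is_subfield E -> fin_gen E V -> exists d, dimq E V (@zero_only L) d.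
Proof.
move=> HE [n [x gx]]; have [||d _ dV] := @dimq_bounded _ E HE V (@zero_only L) n; last by exists d.
  exact: subspace_zero.
move=> m y Vy fy; have := steinitz HE (subspace_zero E) gx Vy fy.
by rewrite !card_ord.
Qed.

Lemma gen_dependent E V (I J : finType) (x : I -> L) (y : J -> L) : is_subfield E ->
  gen_mod E (@zero_only L) x V -> (forall j, V (y j)) -> (#|I| < #|J|)%N ->
  exists c : J -> L, [/\ forall j, E (c j), exists j, c j != 0 & \sum_j c j * y j = 0].
Proof.
move=> HE gx Vy ltIJ; apply: contrapT => nc.
have : free_mod E (@zero_only L) y.
  move=> c Ec c0 j; apply: contrapT => /eqP cj; apply: nc; exists c; split=> //.
  by exists j.
move=> fy; have := steinitz HE (subspace_zero E) gx Vy fy.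
by rewrite leqNgt ltIJ.
Qed.

Lemma algebraic_inv E (z : L) : is_subfield E -> algebraic_over E z -> z != 0 ->
  exists2 g, poly_over E g & z^-1 = g.[z].
Proof.
move=> HE [f [f0 [Ef]]] + z0; rewrite rootE; elim/poly_ind: f f0 Ef => [|f c IH].
  by rewrite eqxx.
move=> f0 Ef; rewrite hornerMXaddC.
have Ec : E c by have := Ef 0; rewrite coefD coefMX coefC add0r.
have Ef' : poly_over E f.
  by move=> i; have := Ef i.+1; rewrite coefD coefMX coefC addr0.
have [c0|c0] := eqVneq c 0.
  rewrite c0 addr0 mulf_eq0 (negPf z0) orbF => fz; apply: IH => //.
  by apply: contraNneq f0 => ->; rewrite c0 mul0r add0r polyC0.
rewrite addr_eq0 => /eqP fz; exists (- c^-1 *: f).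
  by apply: poly_overZ => //; [apply: sf_ring|apply/(sfN HE)/(sfV HE)].
rewrite hornerZ; apply: (mulIf z0); rewrite mulVf // -mulrA fz.
by rewrite mulrN mulNr opprK mulVf.
Qed.

Lemma fin_gen_algebraic E A z : is_subfield E -> is_subring A -> fin_gen E A -> A z ->
  algebraic_over E z.
Proof.
move=> HE HA [n [x gx]] Az.
have [||c [Ec [j cj] c0]] := @gen_dependent E A 'I_n 'I_n.+1 x (fun i => z ^+ i) HE gx.
- by move=> j; apply: srX.
- by rewrite !card_ord.
exists (\poly_(i < n.+1) c (inord i)); split; last split.
- apply/eqP => P0; move/eqP: cj; apply.
  have := congr1 (fun q : {poly L} => q`_j) P0.
  by rewrite coef_poly ltn_ord coef0 inord_val.
- exact: (poly_over_poly (sf_ring HE)).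
- rewrite rootE horner_poly; apply/eqP; rewrite -[RHS]c0.
  by apply: eq_bigr => i _; rewrite inord_val.
Qed.

Lemma subring_subfield E A : is_subfield E -> is_subring A -> (forall x, E x -> A x) ->
  (forall z, A z -> algebraic_over E z) -> is_subfield A.
Proof.
move=> HE HA sEA algA; split=> // z Az z0.
have [g Eg ->] := algebraic_inv HE (algA z Az) z0.
by apply: sr_horner => // i; apply: sEA.
Qed.

Lemma algebraic_sub E E' z : (forall x, E x -> E' x) -> algebraic_over E z -> algebraic_over E' z.
Proof. by move=> sE [f [f0 [Ef fz]]]; exists f; split=> //; split=> //; apply: poly_over_sub Ef. Qed.

Definition adjoin E (y : L) : L -> Prop := fun x => exists2 g, poly_over E g & x = g.[y].

Lemma adjoin_ring E y : is_subring E -> is_subring (adjoin E y).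
Proof.
move=> HE; split; first by exists 1; rewrite ?hornerC //; apply: poly_overC => //; apply: sr1.
move=> _ _ [f Ef ->] [g Eg ->]; split.
  by exists (f - g); rewrite ?hornerE //; apply: poly_overB.
by exists (f * g); rewrite ?hornerE //; apply: poly_overM.
Qed.

Lemma adjoin_sub E y : is_subring E -> forall x, E x -> adjoin E y x.
Proof. by move=> HE x Ex; exists x%:P; rewrite ?hornerC //; apply: poly_overC. Qed.

Lemma adjoin_gen E y : is_subring E -> adjoin E y y.
Proof. by move=> HE; exists 'X; rewrite ?hornerX //; apply: poly_overX. Qed.

Lemma adjoin_min E A y : is_subring A -> (forall x, E x -> A x) -> A y ->
  forall x, adjoin E y x -> A x.
Proof. by move=> HA sEA Ay x [g Eg ->]; apply: sr_horner => // i; apply: sEA. Qed.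

Lemma adjoin_fin E y : is_subfield E -> algebraic_over E y -> fin_gen E (adjoin E y).
Proof.
move=> HE [f [f0 [Ef fy]]]; exists (size f), (fun i => y ^+ i) => _ [g Eg ->].
exists (fun i : 'I_(size f) => (g %% f)`_i); split=> [i|]; first exact: poly_over_mod.
rewrite /zero_only /= -(@horner_coef_wide _ (size f) (g %% f) y); last by rewrite ltnW // ltn_modp.
rewrite {1}(divp_eq g f) hornerD hornerM; move: fy; rewrite rootE => /eqP ->.
by rewrite mulr0 add0r subrr.
Qed.

Lemma adjoin_field E y : is_subfield E -> algebraic_over E y -> is_subfield (adjoin E y).
Proof.
move=> HE algy; have HA := adjoin_ring y (sf_ring HE).
apply: (subring_subfield HE HA); first exact: adjoin_sub (sf_ring HE).
by move=> z; apply: fin_gen_algebraic => //; apply: adjoin_fin.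
Qed.

Lemma fin_gen_trans E E' V : is_subfield E -> fin_gen E E' -> fin_gen E' V -> fin_gen E V.
Proof.
move=> HE [m [x gx]] [n [y gy]].
apply: (@fin_gen_fin _ _ ('I_m * 'I_n)%type (fun ij => x ij.1 * y ij.2)) => v /gy[c [Ec cv]].
have [a aP] := choice (fun j => gx _ (Ec j)).
exists (fun ij => a ij.2 ij.1); split=> [[i j]|]; first by case: (aP j).
move: cv; rewrite /zero_only => /eqP; rewrite subr_eq0 => /eqP ->.
apply/eqP; rewrite subr_eq0; apply/eqP.
rewrite -(pair_bigA _ (fun i j => a j i * (x i * y j))) exchange_big /=.
apply: eq_bigr => j _; have [_ /eqP] := aP j; rewrite subr_eq0 => /eqP ->.
by rewrite mulr_suml; apply: eq_bigr => i _; rewrite mulrA.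
Qed.

Lemma fin_gen_sub E V W : (forall x, W x -> V x) -> fin_gen E V -> fin_gen E W.
Proof. by move=> sWV [n [x gx]]; exists n, x => v /sWV/gx. Qed.

Lemma fin_gen_refl E : is_subfield E -> fin_gen E E.
Proof.
move=> HE; exists 1, (fun=> 1) => v Ev; exists (fun=> v); split=> //.
by rewrite big_ord1 mulr1 /zero_only subrr.
Qed.

Lemma finite_extension E (s : seq L) : is_subfield E ->
  (forall y, y \in s -> algebraic_over E y) ->
  exists E', [/\ is_subfield E', forall x, E x -> E' x, forall y, y \in s -> E' y & fin_gen E E'].
Proof.
move=> HE; elim: s => [|y s IH] algs.
  by exists E; split=> //; apply: fin_gen_refl.
have [|E1 [HE1 sE1 sE1s fE1]] := IH; first by move=> z zs; apply: algs; rewrite inE zs orbT.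
have algy : algebraic_over E1 y by apply: algebraic_sub sE1 _; apply: algs; rewrite mem_head.
exists (adjoin E1 y); split=> [|x Ex|z|]; first exact: adjoin_field.
- by apply: adjoin_sub; [apply: sf_ring|apply: sE1].
- rewrite inE => /orP[/eqP->|zs]; first exact: (adjoin_gen y (sf_ring HE1)).
  by apply: adjoin_sub; [apply: sf_ring|apply: sE1s].
- by apply: fin_gen_trans fE1 (adjoin_fin HE1 algy).
Qed.

End FiniteExtensions.

(** * Rational function fields generated by one element *)

Section RationalFunctions.
Variables (L : fieldType) (K : L -> Prop).
Hypothesis HK : is_subfield K.
Implicit Types t x : L.
Let KR := sf_ring HK.

Lemma ratfun_subfield t : is_subfield (ratfun_field K t).
Proof.
split; first split.
- by exists 1, 1; split; rewrite ?hornerC ?oner_eq0 ?divr1 //; apply: poly_overC => //; apply: sf1.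
- move=> _ _ [a [b [Ka Kb b0 ->]]] [c [d [Kc Kd d0 ->]]]; split.
    exists (a * d - c * b), (b * d); split; rewrite ?hornerE ?mulf_neq0 //.
    + by apply: poly_overB => //; apply: poly_overM.
    + exact: poly_overM.
    by rewrite -mulNr addf_div // mulNr.
  exists (a * c), (b * d); split; rewrite ?hornerM ?mulf_neq0 //; try exact: poly_overM.
  by rewrite mulf_div.
- move=> _ [a [b [Ka Kb b0 ->]]]; rewrite mulf_eq0 invr_eq0 (negPf b0) orbF => a0.
  by exists b, a; split=> //; rewrite invf_div.
Qed.

Lemma ratfun_poly t (g : {poly L}) : poly_over K g -> ratfun_field K t g.[t].
Proof.
move=> Kg; exists g, 1; split; rewrite ?hornerC ?oner_eq0 ?divr1 //.
by apply: poly_overC => //; apply: sf1.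
Qed.

Lemma ratfun_sub t x : K x -> ratfun_field K t x.
Proof. by move=> Kx; rewrite -(hornerC x t); apply/ratfun_poly/(poly_overC KR). Qed.

Lemma ratfun_gen t : ratfun_field K t t.
Proof. by rewrite -{2}(hornerX t); apply/ratfun_poly/(poly_overX KR). Qed.

Lemma ratfun_min E t : is_subfield E -> (forall x, K x -> E x) -> E t ->
  forall x, ratfun_field K t x -> E x.
Proof.
move=> HE sKE Et _ [a [b [Ka Kb b0 ->]]]; apply: sfM => //; last apply: sfV => //.
  by apply: sr_horner => //; [apply: sf_ring|apply: poly_over_sub Ka].
by apply: sr_horner => //; [apply: sf_ring|apply: poly_over_sub Kb].
Qed.

Lemma common_denominator t (I : finType) (g : I -> L) :
  (forall i, ratfun_field K t (g i)) ->
  exists (G : I -> {poly L}) (b : {poly L}), [/\ forall i, poly_over K (G i), poly_over K b,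
     b.[t] != 0 & forall i, g i = (G i).[t] / b.[t]].
Proof.
move=> Kg.
have [a aP] := choice Kg; have [b bP] := choice aP.
pose B := \prod_i b i.
have b0 i : (b i).[t] != 0 by case: (bP i).
exists (fun i => a i * \prod_(j | j != i) b j), B; split.
- by move=> i; case: (bP i) => Ka _ _ _; apply: poly_overM => //; apply: poly_over_prod => // j _; case: (bP j).
- by apply: poly_over_prod => // j _; case: (bP j).
- by rewrite /B horner_prod; apply/prodf_neq0 => i _.
- move=> i; case: (bP i) => _ _ _ ->; rewrite /B hornerM !horner_prod [X in _ = _ / X](bigD1 i) //=.
  rewrite invfM mulrACA divff ?mulr1 //.
  by apply/prodf_neq0 => j _.
Qed.

(** After clearing denominators the equation of [x] is a polynomial in two variables. Reordered by
    powers of [t] it has the coefficients [(h j).[x]], and one of these is nonzero because [x] is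
    transcendental over [K]. *)
Lemma algebraic_exchange t x : algebraic_over (ratfun_field K t) x -> ~ algebraic_over K x ->
  algebraic_over (ratfun_field K x) t.
Proof.
move=> [f [f0 [Ef fx]]] trx.
have [G [b [KG Kb b0 GP]]] := @common_denominator t 'I_(size f) (fun i => f`_i) (fun i => Ef i).
pose N := \max_(i < size f) size (G i).
pose h j := \poly_(i < size f) (if insub i is Some i then (G i)`_j else 0).
have Kh j : poly_over K (h j).
  by apply: poly_over_poly => // i; case: insub => [k|] //; [apply: KG|apply: sf0].
have hE j : (h j).[x] = \sum_(i < size f) (G i)`_j * x ^+ i.
  by rewrite horner_poly; apply: eq_bigr => i _; rewrite valK.
exists (\poly_(j < N) (h j).[x]); split; last split.
- have sf0 : (0 < size f)%N by rewrite size_poly_gt0.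
  have sf1 : ((size f).-1 < size f)%N by rewrite prednK.
  pose i0 := Ordinal sf1.
  have Gi0 : G i0 != 0.
    apply/eqP => Gi0; have := GP i0; rewrite Gi0 horner0 mul0r => /eqP.
    by rewrite -lead_coefE lead_coef_eq0 (negPf f0).
  pose j0 := (size (G i0)).-1.
  have hj0 : h j0 != 0.
    apply/eqP => /(congr1 (fun q : {poly L} => q`_i0)).
    rewrite coef_poly ltn_ord valK coef0 => /eqP.
    by rewrite -lead_coefE lead_coef_eq0 (negPf Gi0).
  have hx : (h j0).[x] != 0.
    by apply/eqP => hx0; apply: trx; exists (h j0); split=> //; split=> //; apply/rootP.
  apply/eqP => /(congr1 (fun q : {poly L} => q`_j0)); rewrite coef_poly coef0.
  have -> : (j0 < N)%N.
    rewrite /j0 prednK ?size_poly_gt0 //.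
    exact: (leq_bigmax (F := fun i => size (G i)) i0).
  by move/eqP; rewrite (negPf hx).
- apply: poly_over_poly; first exact: sf_ring (ratfun_subfield x).
  by move=> j; apply: ratfun_poly.
- rewrite rootE horner_poly.
  under eq_bigr do rewrite hE mulr_suml.
  rewrite exchange_big /=.
  have -> : \sum_(i < size f) \sum_(j < N) (G i)`_j * x ^+ i * t ^+ j = b.[t] * f.[x].
    rewrite (horner_coef f) mulr_sumr; apply: eq_bigr => i _.
    rewrite GP mulrA mulrCA divff // mulr1.
    rewrite (@horner_coef_wide _ N (G i)) ?mulr_suml; last first.
      exact: (leq_bigmax (F := fun i => size (G i)) i).
    by apply: eq_bigr => j _; rewrite mulrAC.
  by move: fx; rewrite rootE => /eqP ->; rewrite mulr0.
Qed.

End RationalFunctions.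

(** * Separably generated function fields *)

Section Transcendental.
Variables (L : fieldType) (p : nat) (K : L -> Prop) (t : L).
Hypotheses (pchL : p \in [pchar L]) (HK : is_subfield K) (trt : ~ algebraic_over K t).
Let p0 : (0 < p)%N. Proof. by rewrite prime_gt0 // (pcharf_prime pchL). Qed.
Let KR := sf_ring HK.

Lemma transcendental_poly (Q : {poly L}) : poly_over K Q -> Q.[t] = 0 -> Q = 0.
Proof.
by move=> KQ Qt; apply: contrapT => /eqP Q0; apply: trt; exists Q; split=> //; split=> //; apply/rootP.
Qed.

Lemma comp_Xp_over (Q : {poly L}) : poly_over K Q -> poly_over K (Q \Po 'X^p).
Proof. by move=> KQ; apply: poly_over_comp => //; apply/(poly_overXn KR)/(poly_overX KR). Qed.

Lemma transcendental_poly_pow (Q : {poly L}) : poly_over K Q -> Q.[t ^+ p] = 0 -> Q = 0.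
Proof.
move=> KQ Qt; have C0 : Q \Po 'X^p = 0.
  by apply: transcendental_poly; [apply: comp_Xp_over|rewrite horner_comp hornerXn].
apply/polyP => i; have := congr1 (fun q : {poly L} => q`_(i * p)) C0.
by rewrite coef_comp_poly_Xn // dvdn_mull // mulnK // !coef0.
Qed.

Lemma transcendental_notin_pow : ~ ratfun_field K (t ^+ p) t.
Proof.
move=> [a [b [Ka Kb b0 tE]]].
have P0 : 'X * (b \Po 'X^p) - (a \Po 'X^p) = 0.
  apply: transcendental_poly.
    by apply: (poly_overB KR); [apply: (poly_overM KR); [exact: (poly_overX KR)|]|]; apply: comp_Xp_over.
  rewrite hornerD hornerN hornerM hornerX !horner_comp hornerXn.
  by rewrite [X in X * _]tE divfK // subrr.
move/negP: b0; apply; suff -> : b = 0 by rewrite horner0.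
(* Exponents congruent to 1 modulo p occur in X b(X^p) but not in a(X^p). *)
apply/polyP => i; have := congr1 (fun q : {poly L} => q`_(i * p).+1) P0.
rewrite coefB coefXM /= !coef_comp_poly_Xn // dvdn_mull // mulnK // coef0.
have -> : (p %| (i * p).+1)%N = false.
  by rewrite -addn1 dvdn_addr ?dvdn_mull // dvdn1; apply/eqP => p1; have := pcharf_prime pchL; rewrite p1.
by rewrite subr0 coef0.
Qed.

Lemma frob_poly (a : {poly L}) : poly_over K a ->
  exists2 a', poly_over K a' & forall x, a.[x] ^+ p = a'.[x ^+ p].
Proof.
move=> Ka; exists (\poly_(i < size a) (a`_i ^+ p)).
  by apply: poly_over_poly => // i; apply: sfX.
move=> x; rewrite horner_poly horner_coef -[X in _ ^+ X](expn1 p) (pow_sum pchL) expn1.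
by apply: eq_bigr => i _; rewrite exprMn -!exprM mulnC.
Qed.

Lemma ratfun_pow x : ratfun_field K t x -> ratfun_field K (t ^+ p) (x ^+ p).
Proof.
move=> [a [b [/frob_poly[a' Ka' aE] /frob_poly[b' Kb' bE] b0 ->]]].
exists a', b'; split=> //; first by rewrite -bE expf_neq0.
by rewrite expr_div_n aE bE.
Qed.

End Transcendental.

Section SeparablyGenerated.
Variables (L : closedFieldType) (p : nat) (K F : L -> Prop) (t : L).
Hypotheses (pchL : p \in [pchar L]) (HK : is_subfield K) (HF : is_subfield F).
Hypotheses (sKF : forall x, K x -> F x) (Ft : F t) (trt : ~ algebraic_over K t).
Hypothesis sepF : forall x, F x -> separable_over (ratfun_field K t) x.
Hypothesis finF : fin_gen (ratfun_field K t) F.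

Local Notation E := (ratfun_field K t).
Local Notation Fa a := (frob_span p K a F).
Let HE : is_subfield E := ratfun_subfield HK t.
Let p0 : (0 < p)%N. Proof. by rewrite prime_gt0 // (pcharf_prime pchL). Qed.
Let sEF : forall x, E x -> F x.
Proof. exact: ratfun_min HF sKF Ft. Qed.
Let KR := sf_ring HK.

Lemma poly_in_pow x : F x -> exists2 h, poly_over E h & x = h.[x ^+ p].
Proof.
move=> /sepF[f [f0 Ef fx cop]].
have [h Eh /dvdpP[q qE]] := separable_frob pchL HE f0 Ef cop; exists h => //.
have := congr1 (fun q => q.[x]) qE; move: fx; rewrite rootE => /eqP fx.
rewrite !hornerE horner_comp hornerXn fx mulr0 => /eqP; rewrite subr_eq0.
by move/eqP.
Qed.

(** By [poly_in_pow] every element of [F] is an [E]-combination of p-th powers, so the p-th powers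
    of a basis generate [F]; being as many as the dimension, they are free. *)
Lemma basis_pow : exists (D : nat) (e : 'I_D -> L),
  [/\ basis_mod E F (@zero_only L) e & free_mod E (@zero_only L) (fun j => e j ^+ p)].
Proof.
have [D dF] := fin_gen_dimq HE finF.
have [e [Fe fe ge]] := dimq_ord dF.
exists D, e; split=> //.
apply: (gen_dimq_free HE (V := F)) => //; first exact: subspace_zero.
  by rewrite card_ord.
move=> x Fx; have [h Eh xE] := poly_in_pow Fx.
have [a aP] := choice (fun i : 'I_(size h) => ge _ (sfX HF i Fx)).
exists (fun j => \sum_(i < size h) h`_i * a i j ^+ p); split.
  move=> j; apply: sf_sum => // i _; apply: sfM => //; apply: sfX => //.
  by case: (aP i).
apply/eqP; rewrite subr_eq0 {1}xE horner_coef; apply/eqP.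
under [RHS]eq_bigr do rewrite mulr_suml.
rewrite exchange_big; apply: eq_bigr => i _ /=.
rewrite exprAC; have [_ /eqP] := aP i; rewrite subr_eq0 => /eqP ->.
rewrite -[X in _ ^+ X](expn1 p) (pow_sum pchL) expn1 mulr_sumr.
by apply: eq_bigr => j _; rewrite exprMn mulrA.
Qed.

(** MacLane's criterion. In the basis of [basis_pow], with a common denominator, the coordinates of
    [f] are polynomials G in t. A relation among the f_i^p holds coordinatewise and is polynomial in
    t^p, so it holds for each coefficient of the G: the c_i annihilate the p-th powers of these
    coefficients. *)
Lemma pow_free1 (I : finType) (f : I -> L) : (forall i, F (f i)) ->
  free_mod K (@zero_only L) f -> free_mod K (@zero_only L) (fun i => f i ^+ p).
Proof.
move=> Ff ff c Kc; rewrite /zero_only => c0.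
have [D [e [[Fe fe ge] fep]]] := basis_pow.
have [a aP] := choice (fun i => ge _ (Ff i)).
have fE i : f i = \sum_j a i j * e j.
  by have [_ /eqP] := aP i; rewrite subr_eq0 => /eqP.
have [G [b [KG Kb b0 GP]]] := @common_denominator _ _ HK t _
   (fun ij : I * 'I_D => a ij.1 ij.2) (fun ij => proj1 (aP ij.1) ij.2).
have c1 j : \sum_i c i * (G (i, j)).[t] ^+ p = 0.
  have : \sum_i c i * a i j ^+ p = 0.
    apply: (fep (fun j => \sum_i c i * a i j ^+ p)).
      move=> k; apply: sf_sum => // i _; apply: sfM => //; first exact: ratfun_sub.
      by apply: sfX => //; case: (aP i).
    rewrite /zero_only -[RHS]c0; under eq_bigr do rewrite mulr_suml.
    rewrite exchange_big; apply: eq_bigr => i _ /=.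
    rewrite fE -[X in _ = _ * _ ^+ X](expn1 p) (pow_sum pchL) expn1 mulr_sumr.
    by apply: eq_bigr => k _; rewrite exprMn mulrA.
  move=> H; apply: (mulIf (x := (b.[t] ^+ p)^-1)).
    by rewrite invr_eq0 expf_neq0.
  rewrite mul0r -[RHS]H mulr_suml; apply: eq_bigr => i _.
  by rewrite -mulrA (GP (i, j)) expr_div_n.
pose N := \max_ij size (G ij).
have sG ij : (size (G ij) <= N)%N by exact: (leq_bigmax (F := fun ij => size (G ij))).
have c2 j l : \sum_i c i * (G (i, j))`_l ^+ p = 0.
  have [lN|Nl] := ltnP l N; last first.
    rewrite big1 // => i _; rewrite nth_default ?(leq_trans (sG _)) //.
    by rewrite expr0n eqn0Ngt p0 mulr0.
  pose Q := \poly_(l < N) (\sum_i c i * (G (i, j))`_l ^+ p).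
  have : Q = 0.
    apply: (transcendental_poly_pow pchL HK trt).
      apply: poly_over_poly => // m; apply: sf_sum => // i _; apply: sfM => //.
      by apply: sfX => //; apply: KG.
    rewrite horner_poly -[RHS](c1 j).
    under eq_bigr do rewrite mulr_suml.
    rewrite exchange_big; apply: eq_bigr => i _ /=.
    rewrite (horner_coef_wide _ (sG _)) -[X in _ = _ * _ ^+ X](expn1 p).
    rewrite (pow_sum pchL) expn1 mulr_sumr; apply: eq_bigr => m _.
    by rewrite exprMn -!exprM mulrA mulnC.
  by move=> /(congr1 (fun q : {poly L} => q`_l)); rewrite coef_poly lN coef0.
(* The p-th roots of the [c i] lie in [L] and annihilate a matrix over [K] whose rows are
   independent over [K], hence over [L]. *)
have [g gP] := choice (fun i => proot pchL (c i) 1).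
have := @free_rows_ext _ _ HK I ('I_D * 'I_N)%type (fun i jl => (G (i, jl.1))`_jl.2).
move/(_ (fun i jl => KG _ _)) => H i.
have gi0 : g i = 0.
  apply: H => [d Kd d0|[j l]] /=; last first.
    apply: (pow_inj pchL (b := 1)); rewrite (pow_sum pchL) (pow0 pchL) -[RHS](c2 j l).
    by apply: eq_bigr => k _; rewrite exprMn gP expn1.
  apply: ff => //; rewrite /zero_only.
  under eq_bigr do rewrite fE mulr_sumr.
  rewrite exchange_big big1 //= => j _.
  under eq_bigr do rewrite mulrA.
  rewrite -mulr_suml [X in X * _](_ : _ = 0) ?mul0r //.
  under eq_bigr do rewrite (GP (_, j)) mulrA (horner_coef_wide _ (sG _)).
  rewrite -mulr_suml [X in X * _](_ : _ = 0) ?mul0r //.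
  under eq_bigr do rewrite mulr_sumr.
  rewrite exchange_big big1 //= => l _.
  under eq_bigr do rewrite mulrA.
  by rewrite -mulr_suml (d0 (j, l)) mul0r.
by rewrite -(gP i) gi0 (pow0 pchL).
Qed.

Lemma pow_free b (I : finType) (f : I -> L) : (forall i, F (f i)) ->
  free_mod K (@zero_only L) f -> free_mod K (@zero_only L) (fun i => f i ^+ (p ^ b)).
Proof.
move=> Ff ff; elim: b => [|b IH]; first by under eq_fun do rewrite expn0 expr1.
have -> : (fun i => f i ^+ (p ^ b.+1)) = (fun i => (f i ^+ (p ^ b)) ^+ p).
  by apply: funext => i; rewrite -exprM expnSr.
by apply: pow_free1 => // i; apply: sfX.
Qed.

(** The case of a one-element family in [free_mod_frob]. *)
Lemma frob_span_notin b W y : subspace K W -> (forall z, W z -> F z) -> F y ->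
  ~ W y -> ~ frob_span p K b W (y ^+ (p ^ b)).
Proof.
move=> sW WF Fy nWy; have fy : free_mod K W (fun _ : 'I_1 => y).
  move=> c Kc; rewrite big_ord1 => Wcy i; apply: contrapT => /eqP ci; apply: nWy.
  rewrite (ord1 i) in ci; rewrite -[y](mulKf ci).
  by case: sW => _ _; apply=> //; apply: sfV.
have := free_mod_frob pchL HK (fun c Kc => sfX HK (p ^ b) Kc) HK (@pow_free b) sW WF
  (fun=> Fy) fy.
move=> H Wy; suff /eqP : (1 : L) = 0 by rewrite oner_eq0.
by apply: (H (fun=> 1) _ _ ord0) => [_|]; [apply: sf1|rewrite big_ord1 mul1r].
Qed.

Lemma Fa_sub a : forall x, Fa a x -> F x.
Proof.
apply: span_prod_min; first exact: subring_subspace (sf_ring HF) sKF.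
by move=> _ [y [Fy ->]]; apply: sfX.
Qed.

Lemma Fa_K a : forall x, K x -> Fa a x.
Proof. exact: frob_span_subK (sf1 HF). Qed.

(** With q = p^a the identity x^-1 = x^(q-1) (x^-1)^q exhibits inverses in the span, which therefore
    agrees with [frob_pullback]. *)
Lemma Fa_field a : is_subfield (Fa a).
Proof.
split=> [|x Fx x0]; first exact: frob_span_ring (sf_ring HF).
have FR : is_subring (Fa a) by exact: frob_span_ring (sf_ring HF).
have q0 : (0 < p ^ a)%N by rewrite expn_gt0 p0.
have -> : x^-1 = x ^+ (p ^ a).-1 * (x^-1) ^+ (p ^ a).
  by rewrite -{2}(prednK q0) exprS mulrCA -exprMn divff // expr1n mulr1.
apply: (srM FR); first exact: (srX FR).
by apply: frob_span_pow; [apply: sf1|apply: sfV => //; apply: Fa_sub Fx].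
Qed.

Lemma Fa_succ a : Fa a.+1 = frob_span p K 1 (Fa a).
Proof. by rewrite frob_span_comp // addn1. Qed.

Lemma Fa_pow a b x : Fa a x -> Fa (a + b) (x ^+ (p ^ b)).
Proof. by move=> Fx; rewrite -frob_span_comp //; apply: frob_span_pow => //; apply: sf1. Qed.

Lemma Fa_anti a : forall x, Fa a.+1 x -> Fa a x.
Proof.
rewrite Fa_succ; apply: span_prod_min.
  by apply: subring_subspace; [apply: (sf_ring (Fa_field _))|apply: Fa_K].
by move=> _ [y [Fy ->]]; apply: sfX => //; apply: Fa_field.
Qed.

(** Coordinates along the basis e_j^p are compared. Writing 1 as the sum of the g_j e_j gives t the
    coordinates t g_j^p, while an element of K[F^p] has coordinates in K(t^p). As g_j^p also lies in
    K(t^p) and some g_j is nonzero, t would lie in K(t^p). *)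
Lemma t_notin_F1 : ~ Fa 1 t.
Proof.
move=> [m [c [w [Kc Fw tE]]]].
have [D [e [[Fe fe ge] fep]]] := basis_pow.
have [y yP] := choice Fw.
have [a aP] := choice (fun l => ge _ (proj1 (yP l))).
have [g [Eg]] := ge _ (sf1 HF); move/eqP; rewrite subr_eq0 => /eqP gE.
pose R := ratfun_field K (t ^+ p).
have HR : is_subfield R := ratfun_subfield HK _.
pose beta j := \sum_l c l * a l j ^+ p.
have Rb j : R (beta j).
  apply: sf_sum => // l _; apply: sfM => //; first exact: ratfun_sub.
  by apply: ratfun_pow => //; case: (aP l).
have sRE x : R x -> E x.
  apply: ratfun_min => //; first by move=> z; apply: ratfun_sub.
  by apply: sfX => //; apply: ratfun_gen.
have bE j : beta j - t * g j ^+ p = 0.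
  apply: (fep (fun j => beta j - t * g j ^+ p)) => [k|].
    apply: sfB => //; first exact: sRE.
    by apply: sfM => //; [apply: ratfun_gen|apply: sfX].
  rewrite /zero_only; under eq_bigr do rewrite mulrBl -mulrA.
  rewrite sumrB -mulr_sumr; apply/eqP; rewrite subr_eq0; apply/eqP.
  have -> : \sum_j g j ^+ p * e j ^+ p = 1.
    rewrite -[RHS](expr1n _ (p ^ 1)) gE (pow_sum pchL) expn1.
    by apply: eq_bigr => i _; rewrite exprMn.
  rewrite mulr1 [RHS]tE; under eq_bigr do rewrite mulr_suml.
  rewrite exchange_big; apply: eq_bigr => l _ /=.
  have [_ ->] := yP l; have [_ /eqP] := aP l; rewrite subr_eq0 => /eqP ->.
  rewrite (pow_sum pchL) expn1 mulr_sumr; apply: eq_bigr => i _.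
  by rewrite exprMn mulrA.
have [j gj] : exists j, g j != 0.
  apply: contrapT => ng; have /eqP := gE; rewrite big1 ?oner_eq0 // => j _.
  have [->|gj] := eqVneq (g j) 0; first by rewrite mul0r.
  by case: ng; exists j.
apply: (transcendental_notin_pow pchL HK trt).
have tb : t = beta j / g j ^+ p.
  by have /eqP := bE j; rewrite subr_eq0 => /eqP ->; rewrite mulfK // expf_neq0.
rewrite [X in ratfun_field _ _ X]tb.
exact: (sfM HR (Rb j) (sfV HR (ratfun_pow pchL HK (Eg j)))).
Qed.

(** By [poly_in_pow] it suffices to treat elements a(t) / b(t) of K(t), and these equal (1 / b)^p a
    b^(p-1); powers of t are reduced modulo X^p - t^p. *)
Lemma F_span x : F x -> exists b : 'I_p -> L, (forall i, Fa 1 (b i)) /\ x = \sum_i b i * t ^+ i.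
Proof.
have H1 := Fa_field 1; have H1R := sf_ring H1.
pose S := direct_sum (fun _ : 'I_p => Fa 1) (fun i : 'I_p => t ^+ i).
have sS : subspace (Fa 1) S.
  by apply: direct_sum_subspace => i; apply: subring_subspace.
have Ftp : Fa 1 (t ^+ p) by have := @Fa_pow 0 1 t; rewrite add0n expn1; apply; rewrite frob_span0 //; apply: subring_subspace (sf_ring HF) sKF.
have Spoly (g : {poly L}) : poly_over (Fa 1) g -> S g.[t].
  move=> Fg; pose m : {poly L} := 'X^p - (t ^+ p)%:P.
  have sm : size m = p.+1 by rewrite size_XnsubC.
  have m0 : m != 0 by rewrite -size_poly_gt0 sm.
  have -> : g.[t] = (g %% m).[t].
    by rewrite {1}(divp_eq g m) hornerD hornerM /m !hornerE subrr mulr0 add0r.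
  exists (fun i : 'I_p => (g %% m)`_i); split=> [i|].
    apply: poly_over_mod => //; apply: (poly_overB H1R); last exact: poly_overC.
    exact/(poly_overXn H1R)/(poly_overX H1R).
  by apply: horner_coef_wide; rewrite -ltnS -sm ltn_modp.
have SE c : E c -> S c.
  move=> [a [b [Ka Kb b0 ->]]].
  have -> : a.[t] / b.[t] = (b.[t]^-1) ^+ p * (a * b ^+ p.-1).[t].
    rewrite hornerM horner_exp exprVn mulrCA; congr (_ * _).
    by rewrite -{1}(prednK p0) exprS invfM -mulrA mulVf ?mulr1 // expf_neq0.
  case: (sS) => _ _; apply.
    have := @frob_span_pow _ p K 1 F (b.[t]^-1); rewrite expn1; apply; first exact: sf1.
    by apply: sfV => //; apply: sEF; apply: ratfun_poly.
  apply: Spoly => i; apply: Fa_K; move: i.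
  by apply: (poly_overM KR) => //; apply: (poly_overXn KR).
move=> Fx; have [h Eh xE] := poly_in_pow Fx.
suff : S x by case=> b [Fb bE]; exists b.
rewrite xE horner_coef; apply: (subspace_sum _ sS) => i _.
rewrite mulrC; case: sS => _ _; apply; last exact: SE.
rewrite exprAC; have := @frob_span_pow _ p K 1 F (x ^+ i); rewrite expn1; apply.
  exact: sf1.
exact: sfX.
Qed.

Lemma Fa_gen a : exists ta, [/\ Fa a ta, ~ Fa a.+1 ta & forall x, Fa a x ->
   exists b : 'I_p -> L, (forall i, Fa a.+1 (b i)) /\ x = \sum_i b i * ta ^+ i].
Proof.
have F0 : Fa 0 = F by apply: frob_span0 => //; apply: subring_subspace (sf_ring HF) sKF.
exists (t ^+ (p ^ a)); split.
- by rewrite -[a]add0n; apply: Fa_pow; rewrite F0.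
- have := @frob_span_notin a (Fa 1) t; rewrite frob_span_comp // add1n; apply=> //.
  + by apply: subring_subspace; [apply: (sf_ring (Fa_field _))|apply: Fa_K].
  + exact: Fa_sub.
  + exact: t_notin_F1.
- pose S := direct_sum (fun _ : 'I_p => Fa a.+1) (fun i : 'I_p => (t ^+ (p ^ a)) ^+ i).
  suff H x : Fa a x -> S x by move=> x /H[b [Fb bE]]; exists b.
  apply: span_prod_min x.
    by apply: direct_sum_subspace => i; apply: subring_subspace; [apply: (sf_ring (Fa_field _))|apply: Fa_K].
  move=> _ [y [/F_span[b [Fb ->]] ->]]; exists (fun i => b i ^+ (p ^ a)); split.
    by move=> i; rewrite -add1n; apply: Fa_pow.
  by rewrite (pow_sum pchL); apply: eq_bigr => i _; rewrite exprMn exprAC.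
Qed.

(** F_a has degree p over F_{a+1} by [Fa_gen], and the p powers of any such [y] are free by
    [powers_free]. *)
Lemma Fa_basis a y : Fa a y -> ~ Fa a.+1 y -> forall x, Fa a x ->
   exists b : 'I_p -> L, (forall i, Fa a.+1 (b i)) /\ x = \sum_i b i * y ^+ i.
Proof.
move=> Fy nFy x Fx; have H1 := Fa_field a.+1.
have [ta [Fta nFta tagen]] := Fa_gen a.
have powFa z : Fa a z -> Fa a.+1 (z ^+ p).
  by move=> Fz; have := @Fa_pow a 1 z; rewrite addn1 expn1; apply.
have da : dimq (Fa a.+1) (Fa a) (@zero_only L) p.
  exists 'I_p, (fun i : 'I_p => ta ^+ i); split; first by rewrite card_ord.
  split; first by move=> i; apply: sfX => //; apply: Fa_field.
    by apply: powers_free => //; apply: powFa.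
  move=> v /tagen[b [Fb ->]]; exists b; split=> //; by rewrite /zero_only subrr.
have gy : gen_mod (Fa a.+1) (@zero_only L) (fun i : 'I_p => y ^+ i) (Fa a).
  apply: (free_dimq_gen H1) => //; first exact: subspace_zero.
  - by rewrite card_ord.
  - by move=> i; apply: sfX => //; apply: Fa_field.
  - by apply: powers_free => //; apply: powFa.
have [b [Fb /eqP]] := gy x Fx; rewrite subr_eq0 => /eqP xE.
by exists b.
Qed.

End SeparablyGenerated.

Section FunctionField.
Variables (L : closedFieldType) (p : nat) (K F : L -> Prop).
Hypotheses (pchL : p \in [pchar L]) (ffF : function_field K F).

Lemma function_field_sep : exists t, [/\ F t, ~ algebraic_over K t,
  forall x, F x -> separable_over (ratfun_field K t) x & fin_gen (ratfun_field K t) F].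
Proof.
case: ffF => HK HF [sKF [s [sF gF]]] [t [Ft trt sepF]] _.
exists t; split=> //.
have HE := ratfun_subfield HK t.
have [|E' [HE' sEE' sE' fE']] := @finite_extension _ _ s HE.
  by move=> y /sF/sepF[f [f0 Ef fy _]]; exists f.
apply: fin_gen_sub fE' => x /gF; apply=> // y Ky.
by apply: sEE'; apply: ratfun_sub.
Qed.

Lemma function_field_fin x : F x -> ~ K x -> fin_gen (ratfun_field K x) F.
Proof.
case: ffF => HK HF [sKF [s [sF gF]]] [t [Ft trt sepF]] algK Fx nKx.
have HE := ratfun_subfield HK x.
have algt y : F y -> algebraic_over (ratfun_field K t) y.
  by move=> /sepF[f [f0 Ef fy _]]; exists f.
have tx : algebraic_over (ratfun_field K x) t.
  by apply: algebraic_exchange => //; [apply: algt|move=> /(algK x Fx)].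
have [|E1 [HE1 sE1 E1t fE1]] := @finite_extension _ _ [:: t] HE.
  by move=> y; rewrite inE => /eqP->.
have [|E2 [HE2 sE2 E2s fE2]] := @finite_extension _ _ s HE1.
  move=> y /sF/algt; apply: algebraic_sub; apply: ratfun_min => //.
    by move=> z Kz; apply/sE1/ratfun_sub.
  by apply: E1t; rewrite mem_head.
apply: (@fin_gen_sub _ _ E2); last exact: fin_gen_trans fE1 fE2.
by move=> y /gF; apply=> // z Kz; apply/sE2/sE1/ratfun_sub.
Qed.

End FunctionField.

(** * Integral closure and linear disjointness from Kbar *)

Section IntegralClosure.
Variable L : fieldType.
Implicit Types (R K : L -> Prop).

Definition integral_over R (x : L) :=
  exists f : {poly L}, [/\ f \is monic, poly_over R f & root f x].

Lemma integral_overP R (A : comNzRingType) (i : {rmorphism A -> L}) x :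
  injective i -> (forall x, R x <-> exists a, x = i a) ->
  integral_over R x <-> integralOver i x.
Proof.
move=> injA iP; split=> [[f [mf Rf fx]]|[g mg gx]].
  have H j : exists a, f`_j = i a by apply/iP.
  have [c cP] := choice H.
  have fE : f = map_poly i (\poly_(j < size f) c j).
    apply/polyP => j; rewrite coef_map coef_poly; case: ltnP => lej; first exact: cP.
    by rewrite raddf0 nth_default.
  exists (\poly_(j < size f) c j); last by rewrite -fE.
  move: mf; rewrite !monicE {1}fE lead_coef_map_inj ?rmorph0 // => /eqP H1.
  by apply/eqP/injA; rewrite rmorph1.
exists (map_poly i g); split=> //; first by rewrite monic_map.
by move=> j; rewrite coef_map; apply/iP; eexists.
Qed.

Section Ring.
Variable R : L -> Prop.
Hypothesis HR : is_subring R.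

Lemma integral_ring : is_subring (integral_over R).
Proof.
have [A [i [injA iP]]] := subring_type HR.
split; first by apply/(integral_overP _ injA iP); apply: integral1.
move=> x y /(integral_overP _ injA iP) ix /(integral_overP _ injA iP) iy.
by split; apply/(integral_overP _ injA iP); [apply: integral_sub|apply: integral_mul].
Qed.

Lemma integral_self x : R x -> integral_over R x.
Proof.
move=> Rx; exists ('X - x%:P); rewrite monicXsubC root_XsubC eqxx; split=> //.
by apply: (poly_overB HR); [apply: poly_overX|apply: poly_overC].
Qed.

Lemma integral_trans f x : f \is monic -> poly_over (integral_over R) f -> root f x ->
  integral_over R x.
Proof.
have [A [i [injA iP]]] := subring_type HR.
move=> mf If fx; apply/(integral_overP _ injA iP).
apply: (integral_root_monic mf fx).
by apply/integral_poly => j; apply/(integral_overP _ injA iP).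
Qed.

End Ring.

Lemma integral_sub_ring R R' x : (forall z, R z -> R' z) -> integral_over R x -> integral_over R' x.
Proof. by move=> sR [f [mf Rf fx]]; exists f; split=> //; apply: poly_over_sub Rf. Qed.

Lemma integral_algebraicP K x : is_subfield K -> integral_over K x <-> algebraic_over K x.
Proof.
move=> HK; split=> [[f [mf Kf fx]]|[f [f0 [Kf fx]]]].
  by exists f; split; [apply: monic_neq0|].
exists ((lead_coef f)^-1 *: f); split.
- by rewrite monicE lead_coefZ mulVf // lead_coef_eq0.
- by apply: poly_overZ => //; [apply: sf_ring|apply: (sfV HK); rewrite lead_coefE].
- by rewrite rootZ // invr_eq0 lead_coef_eq0.
Qed.

Lemma Kbar_subfield K : is_subfield K -> is_subfield (Kbar K).
Proof.
move=> HK; have KR := sf_ring HK.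
have -> : Kbar K = integral_over K.
  by apply/predeqP => x; split=> [/(integral_algebraicP x HK)|/(integral_algebraicP x HK)].
apply: (subring_subfield HK); [exact: integral_ring|exact: integral_self|].
by move=> z /(integral_algebraicP z HK).
Qed.

Lemma Kbar_sub K : is_subfield K -> forall x, K x -> Kbar K x.
Proof. by move=> HK x Kx; apply/(integral_algebraicP _ HK)/integral_self => //; apply: sf_ring. Qed.

Lemma Kbar_closed K x : is_subfield K -> algebraic_over (Kbar K) x -> Kbar K x.
Proof.
move=> HK; have KR := sf_ring HK.
move/(integral_algebraicP _ (Kbar_subfield HK)) => [f [mf Kf fx]].
apply/(integral_algebraicP _ HK); apply: (integral_trans KR mf) fx => i.
exact/(integral_algebraicP _ HK)/Kf.
Qed.

Lemma minimal_poly E (a : L) : is_subfield E -> algebraic_over E a ->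
  exists m : {poly L}, [/\ m \is monic, poly_over E m, root m a &
    forall g, poly_over E g -> g.[a] = 0 -> m %| g].
Proof.
move=> HE [f [f0 [Ef fa]]].
pose P n := `[< exists g : {poly L}, [/\ g != 0, poly_over E g, root g a & size g = n] >].
have exP : exists n, P n by exists (size f); apply/asboolP; exists f.
case: (ex_minnP exP) => n /asboolP[g [g0 Eg ga sg]] minn.
exists ((lead_coef g)^-1 *: g).
have lg : (lead_coef g)^-1 != 0 by rewrite invr_eq0 lead_coef_eq0.
have gdvd h : poly_over E h -> h.[a] = 0 -> g %| h.
  move=> Eh ha; apply/modp_eq0P; apply: contrapT => /eqP r0.
  have : P (size (h %% g)).
    apply/asboolP; exists (h %% g); split=> //; first exact: poly_over_mod.
    move: ha; rewrite {1}(divp_eq h g) hornerD hornerM; move: ga; rewrite !rootE => /eqP ->.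
    by rewrite mulr0 add0r => ->.
  by move/minn; rewrite -sg leqNgt ltn_modp g0.
split.
- by rewrite monicE lead_coefZ mulVf // lead_coef_eq0.
- by apply: poly_overZ => //; [apply: sf_ring|apply: (sfV HE); rewrite lead_coefE].
- by rewrite rootZ.
- by move=> h Eh ha; rewrite dvdpZl //; apply: gdvd.
Qed.

(** Lagrange's formula. It is applied to an integral closure [I] and to the conjugates [rs] of a
    separable element, whose differences are invertible in [I] because they are algebraic over
    [K]. *)
Lemma interpolation (I : L -> Prop) (rs : seq L) (g : {poly L}) : is_subring I ->
  uniq rs -> (forall r s, r \in rs -> s \in rs -> I r /\ I (r - s)^-1) ->
  (size g <= size rs)%N -> (forall r, r \in rs -> I g.[r]) -> poly_over I g.
Proof.
move=> HI ur Irs sg Ig.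
pose l (r : L) : {poly L} :=
  \prod_(s <- rem r rs) (r - s)^-1 *: \prod_(s <- rem r rs) ('X - s%:P).
have sl r : r \in rs -> (size (l r) <= size rs)%N.
  move=> rrs; apply: leq_trans (size_scale_leq _ _) _.
  by rewrite size_prod_XsubC size_rem // prednK //; case: (rs) rrs.
suff -> : g = \sum_(r <- rs) g.[r] *: l r.
  rewrite big_seq; apply: (poly_over_sum HI) => r rrs.
  apply: (poly_overZ HI); first exact: Ig.
  apply: (poly_overZ HI); rewrite big_seq.
    apply: (big_ind I); [exact: sr1|exact: srM|move=> s /mem_rem srs].
    by case: (Irs r s rrs srs).
  apply: (poly_over_prod HI) => s /mem_rem srs; have [Is _] := Irs s r srs rrs.
  by apply: (poly_overB HI); [apply: poly_overX|apply: poly_overC].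
apply/eqP; rewrite -subr_eq0; apply/eqP.
apply: (@roots_geq_poly_eq0 _ _ rs) => //.
  apply/allP => x xrs; rewrite rootE hornerD hornerN horner_sum subr_eq0 (big_rem x) //=.
  rewrite !hornerZ horner_prod -big_split big1_seq ?mulr1 /=; last first.
    move=> s; rewrite mem_rem_uniq // inE hornerXsubC => /andP[sx srs].
    by rewrite mulVf // subr_eq0 eq_sym.
  rewrite big_seq big1 ?addr0 // => r; rewrite mem_rem_uniq // inE => /andP[rx rrs].
  have xr : x \in rem r rs by rewrite mem_rem_uniq // inE eq_sym rx.
  rewrite !hornerZ horner_prod [X in _ * (_ * X)](big_rem x) //=.
  by rewrite hornerXsubC subrr mul0r !mulr0.
apply: leq_trans (size_polyD _ _) _; rewrite geq_max sg size_polyN /=.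
apply: leq_trans (size_sum _ _ _) _; apply/bigmax_leqP_seq => r rrs _.
by apply: leq_trans (size_scale_leq _ _) (sl r rrs).
Qed.

End IntegralClosure.

(** * Adjoining separable elements *)

Section SeparableDescent.
Variables (L : closedFieldType) (K F : L -> Prop) (a : L).
Hypotheses (HK : is_subfield K) (HF : is_subfield F) (sKF : forall x, K x -> F x).
Hypothesis algK : forall x, F x -> Kbar K x -> K x.
Hypothesis sepa : separable_over K a.
Let KR := sf_ring HK.
Let FR := sf_ring HF.
Let BR := sf_ring (Kbar_subfield HK).

(* The minimal polynomial of [a] over [F] has coefficients algebraic over [K], hence in [K]. *)
Lemma descent_conjugates : exists rs : seq L, let m := \prod_(r <- rs) ('X - r%:P) in
  [/\ uniq rs, forall r, r \in rs -> Kbar K r, poly_over K m, root m a &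
      forall g, poly_over F g -> g.[a] = 0 -> m %| g].
Proof.
case: sepa => f [f0 Kf fa cop].
have [|m [mm Fm ma mdvd]] := @minimal_poly _ F a HF.
  by exists f; split=> //; split=> //; apply: poly_over_sub Kf.
have [rs mE] := closed_field_poly_normal m; rewrite (monicP mm) scale1r in mE.
have mf : m %| f by apply: mdvd; [apply: poly_over_sub Kf|apply/rootP].
have rsK r : r \in rs -> Kbar K r.
  move=> rrs; exists f; split=> //; split=> //.
  rewrite -dvdp_XsubCl; apply: dvdp_trans mf.
  by rewrite mE (big_rem r) //= dvdp_mulIl.
have sepf : separable_poly f by rewrite unlock.
exists rs; rewrite /= -mE; split=> //.
- by rewrite -separable_prod_XsubC -mE; exact: dvdp_separable mf sepf.
- move=> i; apply: algK; first exact: Fm.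
  rewrite mE big_seq; move: i; apply: (poly_over_prod BR) => r rrs.
  by apply: (poly_overB BR); [apply: poly_overX|apply: (poly_overC BR); apply: rsK].
Qed.

Lemma sep_algebraic : algebraic_over K a.
Proof. by case: sepa => f [f0 Kf fa _]; exists f. Qed.

(** Let x = g(a) with deg g < deg m. Conjugating the integral equation of x shows that g(r) is
    integral over [R] for every root r of m; by interpolation the coefficients of g are integral
    over [R], and they lie in [F], hence in [R]. *)
Lemma adjoin_int_closed R : is_subring R -> (forall x, K x -> R x) -> (forall x, R x -> F x) ->
  (forall x, F x -> integral_over R x -> R x) ->
  forall x, adjoin F a x -> integral_over (adjoin R a) x -> adjoin R a x.
Proof.
move=> HR sKR sRF intR x [g0 Fg0 xE] [P [mP RaP Px]].
have [rs [urs rsK Km ma mdvd]] := descent_conjugates.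
set m := \prod_(r <- rs) _ in Km ma mdvd.
have sm : size m = (size rs).+1 by rewrite size_prod_XsubC.
have m0 : m != 0 by rewrite -size_poly_gt0 sm.
have am : m.[a] = 0 by apply/rootP.
pose g := g0 %% m.
have Fg : poly_over F g by apply: poly_over_mod => //; apply: poly_over_sub Km.
have xg : x = g.[a].
  by rewrite xE {1}(divp_eq g0 m) hornerD hornerM am mulr0 add0r.
have sg : (size g <= size rs)%N by rewrite -ltnS -sm ltn_modp.
exists g => // i; apply: intR => //; move: i.
have IR := integral_ring HR.
have KI z : Kbar K z -> integral_over R z.
  by move=> /(integral_algebraicP z HK); apply: integral_sub_ring.
apply: (interpolation (rs := rs)) => //.
  move=> r s rrs srs; split; first exact/KI/rsK.
  by apply: KI; apply: sfV; [apply: Kbar_subfield|apply: (srB BR); apply: rsK].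
move=> r rrs.
have exQ i : exists Q, poly_over R Q /\ P`_i = Q.[a] by have [Q RQ QE] := RaP i; exists Q.
have [Q QP] := choice exQ.
have P0 : P != 0 by apply: monic_neq0.
pose n := (size P).-1; have sP : size P = n.+1 by rewrite prednK // size_poly_gt0.
(* The equation of x lifted to a polynomial over [F]. It vanishes at [a], so m divides it and it
   vanishes at every conjugate. *)
pose Phi := \sum_(i < n) Q i * g ^+ i + g ^+ n.
have FPhi : poly_over F Phi.
  apply: (poly_overD FR); last exact: poly_overXn.
  apply: (poly_over_sum FR) => i _; apply: (poly_overM FR); last exact: poly_overXn.
  by case: (QP i) => RQ _; apply: poly_over_sub RQ.
have Pn : P`_n = 1 by move/monicP: mP.
have Phia : Phi.[a] = 0.
  move: Px; rewrite rootE horner_coef sP big_ord_recr /= Pn mul1r => /eqP Px.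
  rewrite hornerD horner_sum horner_exp -xg -[RHS]Px; congr (_ + _).
  by apply: eq_bigr => i _; rewrite hornerM horner_exp -xg; case: (QP i) => _ ->.
have Phir : Phi.[r] = 0.
  apply/rootP; rewrite -dvdp_XsubCl; apply: dvdp_trans (mdvd _ FPhi Phia).
  by rewrite /m (big_rem r) //= dvdp_mulIl.
pose S := \poly_(i < n) (Q i).[r].
apply: (integral_trans HR (f := 'X^n + S)).
- by rewrite monicE lead_coefDl ?lead_coefXn // size_polyXn ltnS size_poly.
- apply: (poly_overD IR); first exact/(poly_overXn IR)/(poly_overX IR).
  apply: (poly_over_poly IR) => i; apply: (sr_horner IR); last exact/KI/rsK.
  by case: (QP i) => RQ _ j; apply: (integral_self HR); apply: RQ.
- rewrite rootE hornerD hornerXn horner_poly -[X in _ == X]Phir addrC hornerD horner_sum.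
  rewrite horner_exp; apply/eqP; congr (_ + _).
  by apply: eq_bigr => i _; rewrite hornerM horner_exp.
Qed.

(** The minimal polynomial m of [a] over [F] has coefficients in [K]. A relation over K[a] is thus a
    polynomial over [F] of degree below deg m that vanishes at [a], so it vanishes
    coefficientwise. *)
Lemma adjoin_free (I : finType) (f : I -> L) : (forall i, F (f i)) ->
  free_mod K (@zero_only L) f -> free_mod (adjoin K a) (@zero_only L) f.
Proof.
move=> Ff ff c Kc; rewrite /zero_only => c0.
have [rs [urs rsK Km ma mdvd]] := descent_conjugates.
set m := \prod_(r <- rs) _ in Km ma mdvd.
have sm : size m = (size rs).+1 by rewrite size_prod_XsubC.
have m0 : m != 0 by rewrite -size_poly_gt0 sm.
have am : m.[a] = 0 by apply/rootP.
have exQ i : exists Q, [/\ poly_over K Q, (size Q < size m)%N & c i = Q.[a]].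
  have [Q KQ cE] := Kc i; exists (Q %% m); split.
  - exact: poly_over_mod.
  - by rewrite ltn_modp.
  - by rewrite cE {1}(divp_eq Q m) hornerD hornerM am mulr0 add0r.
have [Q QP] := choice exQ.
have S0 : \sum_i f i *: Q i = 0.
  apply: contrapT => /eqP S0.
  have := mdvd (\sum_i f i *: Q i).
  move=> /(_ _ _)/(dvdp_leq S0) H.
  have : (size m <= size (\sum_i f i *: Q i)%R)%N.
    apply: H.
      apply: (poly_over_sum FR) => i _; apply: (poly_overZ FR) => //.
      by case: (QP i) => KQ _ _; apply: poly_over_sub KQ.
    rewrite horner_sum -[RHS]c0; apply: eq_bigr => i _.
    by rewrite hornerZ mulrC; case: (QP i) => _ _ ->.
  rewrite leqNgt => /negP; apply; rewrite sm ltnS.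
  apply: leq_trans (size_sum _ _ _) _; apply/bigmax_leqP => i _.
  apply: leq_trans (size_scale_leq _ _) _.
  by case: (QP i); rewrite sm ltnS.
move=> i; case: (QP i) => _ _ ->; suff -> : Q i = 0 by rewrite horner0.
apply/polyP => l; rewrite coef0; apply: (ff (fun i => (Q i)`_l)) => [j|].
  by case: (QP j) => KQ _ _; apply: KQ.
have := congr1 (fun q : {poly L} => q`_l) S0; rewrite coef_sum coef0 => H.
by rewrite /zero_only -[RHS]H; apply: eq_bigr => j _; rewrite coefZ mulrC.
Qed.

End SeparableDescent.

Section SeparableTower.
Variable L : closedFieldType.
Implicit Types (K R F : L -> Prop).

Lemma separable_sub K K' a : (forall x, K x -> K' x) -> separable_over K a -> separable_over K' a.
Proof. by move=> sK [f [f0 Kf fa cop]]; exists f; split=> //; apply: poly_over_sub Kf. Qed.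

Lemma separable_tower K F (s : seq L) : is_subfield K -> is_subfield F ->
  (forall x, K x -> F x) -> (forall x, F x -> Kbar K x -> K x) ->
  (forall a, a \in s -> separable_over K a) ->
  exists K' F', [/\ is_subfield K', is_subfield F',
    (forall x, K x -> K' x) /\ (forall a, a \in s -> K' a),
    (forall x, K' x -> Kbar K x) /\ (forall x, F x -> F' x) &
    [/\ forall x, K' x -> F' x,
    forall (I : finType) (f : I -> L), (forall i, F (f i)) ->
      free_mod K (@zero_only L) f -> free_mod K' (@zero_only L) f &
    forall R, is_subring R -> (forall x, K x -> R x) -> (forall x, R x -> F x) ->
      (forall x, F x -> integral_over R x -> R x) ->
      exists R', [/\ is_subring R', forall x, K' x -> R' x, forall x, R x -> R' x,
        forall x, R' x -> span_prod (Kbar K) R x &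
        forall x, F' x -> integral_over R' x -> R' x]]].
Proof.
move=> HK HF sKF algK seps.
(* The induction also carries that [K'] is algebraically closed in [F'] and that [R'] lies in [F'];
   the next adjunction requires both. *)
suff : exists K' F', [/\ is_subfield K', is_subfield F',
    (forall x, K x -> K' x) /\ (forall a, a \in s -> K' a),
    (forall x, K' x -> Kbar K x) /\ (forall x, F x -> F' x) &
    [/\ forall x, K' x -> F' x, forall x, F' x -> Kbar K' x -> K' x,
    forall (I : finType) (f : I -> L), (forall i, F (f i)) ->
      free_mod K (@zero_only L) f -> free_mod K' (@zero_only L) f &
    forall R, is_subring R -> (forall x, K x -> R x) -> (forall x, R x -> F x) ->
      (forall x, F x -> integral_over R x -> R x) ->
      exists R', [/\ is_subring R', forall x, K' x -> R' x, forall x, R x -> R' x,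
        forall x, R' x -> span_prod (Kbar K) R x /\ F' x &
        forall x, F' x -> integral_over R' x -> R' x]]].
  move=> [K' [F' [HK' HF' sK sF [sKF' _ fr intR]]]]; exists K', F'; split=> //; split=> //.
  move=> R HR sKR sRF /(intR R HR sKR sRF)[R' [? ? ? RR' ?]]; exists R'; split=> // x R'x.
  by case: (RR' x R'x).
elim: s seps => [|a s IH] seps.
  exists K, F; split=> //; split=> //; first exact: Kbar_sub.
  move=> R HR sKR sRF intR; exists R; split=> // x Rx; split; last exact: sRF.
  by apply: span_prod_subr => //; apply/(Kbar_sub HK)/(sf1 HK).
have [|K1 [F1 [HK1 HF1 [sK sK1] [K1b sF] [sKF1 algK1 fr intR]]]] := IH.
  by move=> b bs; apply: seps; rewrite inE bs orbT.
have sepa : separable_over K1 a by apply: (separable_sub sK); apply: seps; rewrite mem_head.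
have alga : algebraic_over K1 a := sep_algebraic sepa.
have algaF : algebraic_over F1 a := algebraic_sub sKF1 alga.
have HK2 : is_subfield (adjoin K1 a) by exact: adjoin_field.
have HF2 : is_subfield (adjoin F1 a) by exact: adjoin_field.
have BF := Kbar_subfield HK; have BR := sf_ring BF.
have Ba : Kbar K a.
  by apply: (Kbar_closed HK); apply: algebraic_sub K1b alga.
have K1R := sf_ring HK1; have F1R := sf_ring HF1.
exists (adjoin K1 a), (adjoin F1 a); split=> //.
- split=> [x Kx|b]; first exact/(adjoin_sub a K1R)/sK.
  rewrite inE => /orP[/eqP->|bs]; first exact: adjoin_gen.
  exact/(adjoin_sub a K1R)/sK1.
- split=> [x|x Fx]; last exact/(adjoin_sub a F1R)/sF.
  by apply: adjoin_min.
split.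
- by apply: adjoin_min => //; [exact: sf_ring|move=> x K1x; apply/(adjoin_sub a F1R)/sKF1|exact: adjoin_gen].
(* Algebraic over K1[a] means integral over it, so this is [adjoin_int_closed] with the field [K1]
   as the ring [R]. *)
- move=> x F2x /(integral_algebraicP x HK2).
  apply: (adjoin_int_closed HK1 HF1 sKF1 algK1 sepa K1R) => // y Fy iy.
  by apply: algK1 => //; apply/(integral_algebraicP y HK1).
- move=> I f Ff ff; apply: (adjoin_free HK1 HF1 sKF1 algK1 sepa).
    by move=> i; apply: sF.
  exact: fr.
- move=> R HR sKR sRF /(intR R HR sKR sRF)[R1 [HR1 sKR1 sRR1 R1B int1]].
  exists (adjoin R1 a); split.
  + exact: adjoin_ring.
  + by apply: adjoin_min => //; [exact: adjoin_ring|move=> x K1x; apply/(adjoin_sub a HR1)/sKR1|exact: adjoin_gen].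
  + by move=> x Rx; apply/(adjoin_sub a HR1)/sRR1.
  + have spR : is_subring (span_prod (Kbar K) R) by exact: span_prod_ring.
    move=> x R2x; split.
      apply: adjoin_min R2x => //; first by move=> z /R1B[].
      by apply: span_prod_subl => //; apply: sr1.
    apply: adjoin_min R2x; first exact: sf_ring.
      by move=> z /R1B[_ F1z]; apply: adjoin_sub.
    exact: adjoin_gen.
  + apply: (adjoin_int_closed HK1 HF1 sKF1 algK1 sepa HR1 sKR1 _ int1).
    by move=> x /R1B[].
Qed.

End SeparableTower.

Section LinearDisjointness.
Variables (L : closedFieldType) (p : nat) (K : L -> Prop).
Hypotheses (pchL : p \in [pchar L]) (HK : is_subfield K).

(** Induction on the degree of an equation [f]: if f' = 0, then f is a polynomial in X^p and c^p has
    a smaller equation; otherwise, unless f is separable, gcd(f, f') or its cofactor is a smaller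
    equation of c. *)
Lemma separable_power (c : L) : Kbar K c -> exists N, separable_over K (c ^+ (p ^ N)).
Proof.
have p0 : (0 < p)%N by rewrite prime_gt0 // (pcharf_prime pchL).
have p1 : (1 < p)%N by rewrite prime_gt1 // (pcharf_prime pchL).
have KR := sf_ring HK.
move=> [f [f0 [Kf fc]]]; have [n] := ubnP (size f); elim: n c f f0 Kf fc => // n IH c f f0 Kf fc.
rewrite ltnS => sfn.
have [cop|ncop] := boolP (coprimep f f^`()).
  by exists 0, f; rewrite expn0 expr1; split.
have Kf' : poly_over K f^`().
  by move=> i; rewrite coef_deriv -mulr_natr; apply: (srM KR) => //; apply: (sr_nat KR).
have [f'0|f'0] := eqVneq f^`() 0.
  pose g := \poly_(i < size f) f`_(i * p).
  have fE : f = g \Po 'X^p.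
    apply/polyP => i; rewrite coef_comp_poly_Xn //.
    case: ifPn => [/dvdnP[j ->]|npi].
      rewrite mulnK // coef_poly; case: ltnP => // lj.
      by rewrite nth_default // (leq_trans lj) // leq_pmulr.
    case: i npi => [|i] npi; first by rewrite dvdn0 in npi.
    have /eqP := congr1 (fun q : {poly L} => q`_i) f'0; rewrite coef_deriv coef0.
    by rewrite -mulr_natr mulf_eq0 -(dvdn_pcharf pchL) (negPf npi) orbF => /eqP.
  have Kg : poly_over K g by apply: poly_over_poly.
  have g0 : g != 0 by apply: contraNneq f0 => g0; rewrite fE g0 comp_poly0.
  have gc : root g (c ^+ p).
    by move: fc; rewrite {1}fE !rootE horner_comp hornerXn.
  have sg : (size g < n)%N.
    have sg1 : (1 < size g)%N by apply: root_size_gt1 gc.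
    have sg0 : (0 < (size g).-1)%N by rewrite -ltnS prednK // size_poly_gt0.
    have sf : (size f).-1 = ((size g).-1 * p)%N.
      by rewrite {1}fE size_comp_poly size_polyXn.
    have : ((size g).-1 < (size f).-1)%N by rewrite sf ltn_Pmulr.
    move: sfn f0 g0; rewrite -!size_poly_gt0; lia.
  have [N sN] := IH _ g g0 Kg gc sg.
  by exists N.+1; rewrite expnS exprM.
pose h := gcdp f f^`().
have Kh : poly_over K h by exact: poly_over_gcd.
have hf : h %| f := dvdp_gcdl _ _.
have h0 : h != 0 by apply: contraNneq f0 => h0; move: hf; rewrite h0 dvd0p.
have sh1 : (1 < size h)%N.
  rewrite ltn_neqAle size_poly_gt0 h0 andbT eq_sym.
  by move: ncop; rewrite coprimep_def.
have shf : (size h < size f)%N.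
  apply: leq_ltn_trans (lt_size_deriv f0).
  by apply: dvdp_leq => //; apply: dvdp_gcdr.
have fE := divpK hf.
have q0 : f %/ h != 0 by apply: contraNneq f0 => q0; rewrite -fE q0 mul0r.
have := fc; rewrite -fE rootM => /orP[qc|hc].
  apply: (IH c (f %/ h)) => //; first exact: poly_over_div.
  apply: leq_trans sfn; rewrite size_divp // ltn_subrL -subn1 subn_gt0 sh1 /=.
  exact: leq_ltn_trans shf.
by apply: (IH c h) => //; apply: leq_trans sfn.
Qed.

Lemma separable_powers (I : finType) (c : I -> L) : (forall i, Kbar K (c i)) ->
  exists N (s : seq L), (forall a, a \in s -> separable_over K a) /\
    forall K', is_subfield K' -> (forall a, a \in s -> K' a) -> forall i, K' (c i ^+ (p ^ N)).
Proof.
move=> Kc; have [n nP] := choice (fun i => separable_power (Kc i)).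
exists (\max_i n i), [seq c i ^+ (p ^ n i) | i : I]; split=> [a /mapP[i _ ->] //|].
move=> K' HK' sK' i.
have -> : c i ^+ (p ^ \max_i n i) = (c i ^+ (p ^ n i)) ^+ (p ^ (\max_i n i - n i)).
  by rewrite -exprM -expnD subnKC // leq_bigmax.
by apply: sfX => //; apply: sK'; apply: map_f; rewrite mem_enum.
Qed.

Variable F : L -> Prop.
Hypotheses (HF : is_subfield F) (sKF : forall x, K x -> F x).
Hypothesis algK : forall x, F x -> Kbar K x -> K x.
Hypothesis powfree : forall b (I : finType) (f : I -> L), (forall i, F (f i)) ->
  free_mod K (@zero_only L) f -> free_mod K (@zero_only L) (fun i => f i ^+ (p ^ b)).

(** A relation is raised to the power p^N until its coefficients lie in an extension generated by
    separable elements. [powfree] keeps the powers of [f] free over [K], and [separable_tower] keeps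
    them free over that extension. *)
Lemma Kbar_free (I : finType) (f : I -> L) : (forall i, F (f i)) ->
  free_mod K (@zero_only L) f -> free_mod (Kbar K) (@zero_only L) f.
Proof.
move=> Ff ff c Kc; rewrite /zero_only => c0 i.
have [N [s [seps sP]]] := separable_powers Kc.
have [K' [F' [HK' HF' [sK sK'] _ [_ fr _]]]] := separable_tower HK HF sKF algK seps.
apply: (pow_inj pchL (b := N)); rewrite (pow0 pchL).
have Fq j : F (f j ^+ (p ^ N)) by exact: sfX.
apply: (fr _ _ Fq (powfree Ff ff) (fun i => c i ^+ (p ^ N)) _ _ i) => [j|]; first exact: sP.
have cN := congr1 (fun z => z ^+ (p ^ N)) c0; rewrite /= (pow_sum pchL) (pow0 pchL) in cN.
rewrite /zero_only -[RHS]cN.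
by apply: eq_bigr => j _; rewrite exprMn.
Qed.

End LinearDisjointness.

(** * Discrete valuations *)

Section Valuation.
Variables (L : fieldType) (F : L -> Prop) (v : L -> int).

Definition is_valuation :=
  (forall x y, F x -> F y -> x != 0 -> y != 0 -> v (x * y) = v x + v y) /\
  (forall x y n, F x -> F y -> x != 0 -> y != 0 -> x + y != 0 ->
     n <= v x -> n <= v y -> n <= v (x + y)).

(* [v 0] is a junk value, so [0] is declared to have infinite valuation here. *)
Definition vge (n : int) (x : L) := x = 0 \/ n <= v x.

Definition ball (E : L -> Prop) (n : int) (x : L) := E x /\ vge n x.

Hypotheses (HF : is_subfield F) (Hv : is_valuation).

Lemma vM x y : F x -> F y -> x != 0 -> y != 0 -> v (x * y) = v x + v y.
Proof. by case: Hv => H _; apply: H. Qed.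

Lemma v1 : v 1 = 0.
Proof.
have := vM (sf1 HF) (sf1 HF) (oner_neq0 L) (oner_neq0 L); rewrite mulr1 => /eqP.
by rewrite -subr_eq subrr eq_sym => /eqP.
Qed.

Lemma vV x : F x -> x != 0 -> v x^-1 = - v x.
Proof.
move=> Fx x0; have := vM Fx (sfV HF Fx) x0; rewrite invr_eq0 divff // v1 => /(_ x0) /eqP.
by rewrite eq_sym addrC addr_eq0 => /eqP.
Qed.

Lemma vX x n : F x -> x != 0 -> v (x ^+ n) = v x *+ n.
Proof.
move=> Fx x0; elim: n => [|n IH]; first by rewrite expr0 v1 mulr0n.
by rewrite exprS vM ?IH ?mulrS ?expf_neq0 //; apply: sfX.
Qed.

Lemma vN x : F x -> v (- x) = v x.
Proof.
move=> Fx; have [->|x0] := eqVneq x 0; first by rewrite oppr0.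
have FN : F (-1) := sfN HF (sf1 HF); have N0 : (-1 : L) != 0 by rewrite oppr_eq0 oner_neq0.
have H : v (-1) + v (-1) = 0 by rewrite -vM // mulrNN mulr1 v1.
by rewrite -mulN1r vM //; lia.
Qed.

Lemma vgeE n x : x != 0 -> vge n x <-> n <= v x.
Proof. by move=> x0; split=> [[x00|//]|]; [rewrite x00 eqxx in x0|right]. Qed.

Lemma vge0 n : vge n 0. Proof. by left. Qed.

Lemma vge_le m n x : m <= n -> vge n x -> vge m x.
Proof. by move=> mn [->|nx]; [left|right; apply: le_trans nx]. Qed.

Lemma vgeD n x y : F x -> F y -> vge n x -> vge n y -> vge n (x + y).
Proof.
move=> Fx Fy nx ny; have [->|x0] := eqVneq x 0; first by rewrite add0r.
have [->|y0] := eqVneq y 0; first by rewrite addr0.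
have [->|xy0] := eqVneq (x + y) 0; first exact: vge0.
move: nx ny => /(vgeE n x0) nx /(vgeE n y0) ny; right.
by case: Hv => _; apply.
Qed.

Lemma vgeN n x : F x -> vge n x -> vge n (- x).
Proof. by move=> Fx [->|nx]; [left; rewrite oppr0|right; rewrite vN]. Qed.

Lemma vgeB n x y : F x -> F y -> vge n x -> vge n y -> vge n (x - y).
Proof. by move=> Fx Fy nx ny; apply: vgeD => //; [apply: sfN|apply: vgeN]. Qed.

Lemma vgeM m n x y : F x -> F y -> vge m x -> vge n y -> vge (m + n) (x * y).
Proof.
move=> Fx Fy; have [->|x0] := eqVneq x 0; first by move=> _ _; rewrite mul0r; apply: vge0.
have [->|y0] := eqVneq y 0; first by move=> _ _; rewrite mulr0; apply: vge0.
by move=> /(vgeE m x0) mx /(vgeE n y0) ny; right; rewrite vM // lerD.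
Qed.

Lemma vge0M n x y : F x -> F y -> vge 0 x -> vge n y -> vge n (x * y).
Proof. by move=> Fx Fy x0 ny; have := vgeM Fx Fy x0 ny; rewrite add0r. Qed.

Lemma vge_sum n (I : Type) (r : seq I) (P : pred I) (f : I -> L) :
  (forall i, P i -> F (f i)) -> (forall i, P i -> vge n (f i)) ->
  vge n (\sum_(i <- r | P i) f i).
Proof.
move=> Ff nf; suff : F (\sum_(i <- r | P i) f i) /\ vge n (\sum_(i <- r | P i) f i) by case.
elim/big_rec: _ => [|i x Pi [Fx nx]]; first by split; [apply: sf0|left].
by split; [apply: sfD => //; apply: Ff|apply: vgeD => //; [apply: Ff|apply: nf]].
Qed.

Lemma vgeX n x : F x -> vge 0 x -> vge 0 (x ^+ n).
Proof.
move=> Fx x0; elim: n => [|n IH]; first by right; rewrite expr0 v1.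
by rewrite exprS -[0]addr0; apply: vgeM => //; apply: sfX.
Qed.

Lemma vge1 : vge 0 1. Proof. by right; rewrite v1. Qed.

Lemma v_neg x : F x -> ~ vge 0 x -> x != 0 /\ vge 1 x^-1.
Proof.
move=> Fx nx; have x0 : x != 0 by apply/eqP => x0; apply: nx; left.
split=> //; right; rewrite vV //.
have : ~ (0 <= v x) by move=> H; apply: nx; right.
by move/negP; rewrite -ltNge; lia.
Qed.

Lemma vge_unit x : F x -> vge 0 x -> ~ vge 1 x -> x != 0 /\ v x = 0.
Proof.
move=> Fx x0 nx; have xn0 : x != 0 by apply/eqP => xx; apply: nx; left.
split=> //; move: x0 nx; rewrite !vgeE // => x0 /negP; rewrite -ltNge; lia.
Qed.

(** The nonzero term of least value is unique, so it cannot be cancelled by the others. *)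
Lemma distinct_values n (I : finType) (z : I -> L) : (forall i, F (z i)) ->
  (forall i j, z i != 0 -> z j != 0 -> v (z i) = v (z j) -> i = j) ->
  vge n (\sum_i z i) -> forall i, vge n (z i).
Proof.
move=> Fz dz nz i; have [->|zi] := eqVneq (z i) 0; first by left.
right; rewrite leNgt; apply/negP => zin.
case: (@Order.TotalTheory.arg_minP _ int I i (fun i => z i != 0) (fun i => v (z i)) zi) => i0 zi0 minz.
have lt0 : v (z i0) < n by apply: le_lt_trans (minz i zi) zin.
set m0 := v (z i0) in lt0 minz; have : vge (m0 + 1) (z i0).
  have -> : z i0 = \sum_j z j - \sum_(j | j != i0) z j by rewrite (bigD1 i0) //= addrK.
  apply: vgeB; [by apply: sf_sum|by apply: sf_sum| |].
    by apply: vge_le nz; lia.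
  apply: vge_sum => // j ji0; have [->|zj] := eqVneq (z j) 0; first by left.
  right; have := minz j zj; rewrite le_eqVlt => /orP[/eqP e|]; last by lia.
  by move: ji0; rewrite -(dz _ _ zi0 zj e) eqxx.
by rewrite vgeE // -/m0; lia.
Qed.

Section Ball.
Variables (K E : L -> Prop).
Hypotheses (HE : is_subfield E) (sEF : forall x, E x -> F x).
Hypotheses (sKE : forall x, K x -> E x) (K0 : forall x, K x -> vge 0 x).

Lemma ball_subspace n : subspace K (ball E n).
Proof.
split.
- by split; [apply: sf0|left].
- by move=> x y [Ex nx] [Ey ny]; split; [apply: sfD|apply: vgeD => //; apply: sEF].
- move=> c x Kc [Ex nx]; split; first by apply: sfM => //; apply: sKE.
  rewrite -[n]add0r; apply: vgeM => //; [apply/sEF/sKE => //|exact: sEF|exact: K0].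
Qed.

Lemma ball_ring : is_subring (ball E 0).
Proof.
split; first by split; [apply: sf1|apply: vge1].
move=> x y [Ex x0] [Ey y0]; split; split; [exact: sfB|by apply: vgeB => //; apply: sEF|exact: sfM|].
by rewrite -[0]addr0; apply: vgeM => //; apply: sEF.
Qed.

Lemma ball_le m n : m <= n -> forall x, ball E n x -> ball E m x.
Proof. by move=> mn x [Ex nx]; split=> //; apply: vge_le nx. Qed.

Variables (eps : nat) (pi : L).
Hypotheses (eps0 : (0 < eps)%N) (Epi : E pi) (pi0 : pi != 0) (vpi : v pi = eps%:Z).
Hypothesis eps_dvd : forall x, E x -> x != 0 -> (eps%:Z %| v x)%Z.

Lemma ball_scale (z : L) n : E z -> z != 0 -> forall x, ball E (v z + n) x <-> ball E n (x / z).
Proof.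
move=> Ez z0 x; have Fz := sEF Ez; have FzV := sfV HF Fz.
split=> [[Ex nx]|[Exz nx]].
  split; first by apply: sfM => //; apply: sfV.
  rewrite (_ : n = v z + n + v z^-1); last by rewrite vV //; lia.
  by apply: vgeM => //; [apply: sEF|right].
have -> : x = z * (x / z) by rewrite mulrC divfK.
by split; [apply: sfM|apply: vgeM => //; [apply: sEF|right]].
Qed.

Lemma pi_power (m : int) : (eps%:Z %| m)%Z -> exists z, [/\ E z, z != 0 & v z = m].
Proof.
case/dvdzP => q ->; case: (intP q) => [|n|n].
- by exists 1; rewrite oner_neq0 v1 mul0r; split=> //; apply: sf1.
- exists (pi ^+ n.+1); rewrite expf_neq0 // vX ?vpi //; last exact: sEF.
  by split=> //; [apply: sfX|rewrite -mulr_natl natz].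
- exists (pi ^+ n.+1)^-1; rewrite invr_eq0 expf_neq0 // vV ?expf_neq0 //; last by apply: sfX => //; apply: sEF.
  rewrite vX ?vpi //; last exact: sEF.
  by split=> //; [apply: sfV => //; apply: sfX|rewrite -mulr_natl natz mulNr].
Qed.

Variable d : nat.
Hypotheses (HK : is_subfield K) (dimE : dimq K (ball E 0) (ball E 1) d).

(** If eps divides m, multiplication by an element of value m carries the residue field onto this
    quotient; otherwise no element has value m. *)
Lemma dimq_ball_step (m : int) :
  dimq K (ball E m) (ball E (m + 1)) (if (eps%:Z %| m)%Z then d else 0).
Proof.
case: ifP => [/pi_power[z [Ez z0 vz]]|ndvd].
  have [I [x [cI [Ex fx gx]]]] := dimE.
  have b0 y : ball E m y <-> ball E 0 (y / z) by rewrite -vz -{1}[v z]addr0; apply: ball_scale.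
  have b1 y : ball E (m + 1) y <-> ball E 1 (y / z) by rewrite -vz; apply: ball_scale.
  exists I, (fun i => x i * z); split=> //; split.
  - by move=> i; apply/b0; rewrite mulfK.
  - move=> c Kc /b1; rewrite mulr_suml => bc; apply: fx => //.
    by move: bc; under eq_bigr do rewrite mulrA mulfK //.
  - move=> y /b0/gx[c [Kc bc]]; exists c; split=> //; apply/b1.
    rewrite mulrBl mulr_suml; move: bc.
    by under [in X in _ -> X]eq_bigr do rewrite mulrA mulfK //.
suff -> : ball E (m + 1) = ball E m.
  by apply: dimq_refl => //; apply: ball_subspace.
apply/predeqP => y; split; first by apply: ball_le; lia.
move=> [Ey ym]; split=> //; have [->|y0] := eqVneq y 0; first by left.
move: ym; rewrite !vgeE // le_eqVlt => /orP[/eqP ym|]; last by lia.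
by move: (eps_dvd Ey y0); rewrite -ym ndvd.
Qed.

Lemma dimq_ball (r : nat) : dimq K (ball E (- r%:Z)) (ball E 0) (r %/ eps * d).
Proof.
elim: r => [|r IH].
  by rewrite oppr0 div0n mul0n; apply: dimq_refl => //; apply: ball_subspace.
have -> : (r.+1 %/ eps * d = (if (eps%:Z %| - r.+1%:Z)%Z then d else 0) + r %/ eps * d)%N.
  rewrite divnS // mulnDl dvdzE abszN !absz_nat.
  by case: (eps %| r.+1)%N; rewrite ?mul1n ?mul0n.
apply: (dimq_add (W := ball E (- r%:Z)) HK) => //; try exact: ball_subspace.
- by apply: ball_le; lia.
- by apply: ball_le; lia.
- have := dimq_ball_step (- r.+1%:Z).
  by rewrite (_ : - r.+1%:Z + 1 = - r%:Z) //; lia.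
Qed.

End Ball.

Lemma value_group E : is_subfield E -> (forall x, E x -> F x) ->
  (exists x, [/\ E x, x != 0 & 0 < v x]) ->
  exists (eps : nat) (pi : L), [/\ (0 < eps)%N, E pi, pi != 0, v pi = eps%:Z &
    forall x, E x -> x != 0 -> (eps%:Z %| v x)%Z].
Proof.
move=> HE sEF [x0 [Ex0 x00 vx0]].
pose P n := `[< (0 < n)%N /\ exists x, [/\ E x, x != 0 & v x = n%:Z] >].
have exP : exists n, P n.
  exists `|v x0|%N; apply/asboolP; split; first by rewrite absz_gt0; lia.
  by exists x0; split=> //; lia.
case: (ex_minnP exP) => eps /asboolP[eps0 [pi [Epi pi0 vpi]]] mineps.
exists eps, pi; split=> // x Ex xn0.
have vd : v x = (v x %/ eps%:Z)%Z * eps%:Z + (v x %% eps%:Z)%Z by apply: divz_eq.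
have [z [Ez z0 vz]] := pi_power HE sEF Epi pi0 vpi (dvdz_mull (v x %/ eps%:Z)%Z (dvdzz eps%:Z)).
apply/dvdz_mod0P; apply: contrapT => r0.
have r1 : 0 <= (v x %% eps%:Z)%Z by apply: modz_ge0; lia.
have r2 : (v x %% eps%:Z)%Z < eps%:Z by apply: ltz_pmod; lia.
have : P `|(v x %% eps%:Z)%Z|%N.
  apply/asboolP; split; first by lia.
  exists (x / z); split.
  - by apply: sfM => //; apply: sfV.
  - by rewrite mulf_neq0 // invr_eq0.
  - rewrite vM ?invr_eq0 //; [|exact: sEF|by apply: sfV => //; apply: sEF].
    by rewrite vV //; [lia|exact: sEF].
by move/mineps; lia.
Qed.

Lemma residue_of_valuation : exists (k : fieldType) (rho : L -> k),
  [/\ rho 1 = 1,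
      forall x y, ball F 0 x -> ball F 0 y -> rho (x - y) = rho x - rho y,
      forall x y, ball F 0 x -> ball F 0 y -> rho (x * y) = rho x * rho y &
      forall x, ball F 0 x -> (rho x = 0 <-> vge 1 x)].
Proof.
have BR : is_subring (ball F 0) by apply: ball_ring.
have [|||||k [rho [r1 rB rM r0]]] := @residue_field L (ball F 0) (ball F 1) BR.
- by move=> x; apply: ball_le.
- by split; [apply: sf0|left].
- by case=> _; rewrite vgeE ?oner_neq0 // v1.
- move=> a x y [Fa a0] [Fx x1] [Fy y1]; split; first by apply: sfD => //; apply: sfM.
  by apply: vgeD => //; [apply: sfM|rewrite -[1]add0r; apply: vgeM].
- move=> x [Fx x0] nx; have [|xn0 vx] := vge_unit Fx x0; first by move=> x1; apply: nx.
  exists x^-1; first by split; [apply: sfV|right; rewrite vV // vx].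
  by rewrite divff // subrr; split; [apply: sf0|left].
- exists k, rho; split=> // x [Fx x0]; rewrite (r0 x) //; split=> [[]//|x1].
  by split.
Qed.

End Valuation.

Section PrimeValuation.
Variables (L : fieldType) (K F O : L -> Prop).
Hypotheses (HF : is_subfield F) (primeO : is_prime K F O).

(** [v x] is the exponent n in x = u pi^n; it is unique because pi^-1 is not in [O]. *)
Lemma prime_valuation : exists v : L -> int,
  [/\ is_valuation F v, forall x, F x -> (O x <-> vge v 0 x) &
      exists pi, [/\ F pi, pi != 0 & v pi = 1]].
Proof.
case: primeO => HO sKO sOF [pi [Opi pi0 nOpi repr]].
have unitM u w : unit_of O u -> unit_of O w -> unit_of O (u * w).
  move=> [Ou u0 Ou'] [Ow w0 Ow']; split; [exact: srM|by rewrite mulf_neq0|].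
  by rewrite invfM; apply: srM.
have unitV u : unit_of O u -> unit_of O u^-1.
  by move=> [Ou u0 Ou']; split; rewrite ?invr_eq0 ?invrK.
have Opos (u : L) (n : int) : O u -> 0 <= n -> O (u * pi ^ n).
  by move=> Ou; case: n => n // _; apply: srM => //; rewrite -exprnP; apply: srX.
have npos (u : L) (n : int) : unit_of O u -> O (u * pi ^ n) -> 0 <= n.
  move=> [Ou u0 Ou'] Oun; rewrite leNgt; apply/negP => n0; apply: nOpi.
  have -> : pi^-1 = u^-1 * (u * pi ^ n) * pi ^ (- n - 1).
    by rewrite mulKf // -expfzDr // (_ : n + (- n - 1) = - 1) ?exprN1 //; lia.
  by apply: Opos; [apply: srM|lia].
have ex_v x : exists n : int, F x -> x != 0 -> exists2 u, unit_of O u & x = u * pi ^ n.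
  have [[Fx x0]|nx] := EM (F x /\ x != 0).
    by have [u [n [Ou xE]]] := repr x Fx x0; exists n => _ _; exists u.
  by exists 0 => Fx x0; case: nx.
have [v vP] := choice ex_v; exists v.
have v_uniq x u n : F x -> x != 0 -> unit_of O u -> x = u * pi ^ n -> v x = n.
  move=> Fx x0 Ou xE; have [w Ow xE'] := vP x Fx x0.
  have key (a b : L) (m l : int) : unit_of O a -> unit_of O b -> a * pi ^ m = b * pi ^ l -> l <= m.
    move=> Oa Ob ab; rewrite -subr_ge0; apply: (npos (a / b)); first by apply: unitM => //; apply: unitV.
    have b0 : b != 0 by case: Ob.
    rewrite expfzDr // -invr_expz mulrACA -invfM ab divff.
      exact: sr1.
    by rewrite mulf_neq0 // expfz_neq0.
  apply/eqP; rewrite eq_le; apply/andP; split.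
    by apply: (key u w); rewrite // -xE.
  by apply: (key w u); rewrite // -xE.
have vmul x y : F x -> F y -> x != 0 -> y != 0 -> v (x * y) = v x + v y.
  move=> Fx Fy x0 y0; have [u Ou xE] := vP x Fx x0; have [w Ow yE] := vP y Fy y0.
  apply: (v_uniq _ (u * w)); [exact: sfM|exact: mulf_neq0|exact: unitM|].
  by rewrite expfzDr // mulrACA -xE -yE.
have Ov x : F x -> (O x <-> vge v 0 x).
  move=> Fx; have [->|x0] := eqVneq x 0; first by split=> _; [left|apply: sr0].
  have [u Ou xE] := vP x Fx x0; rewrite vgeE //.
  by split=> H; [apply: npos Ou _; rewrite -xE|rewrite xE; apply: Opos => //; case: Ou].
split=> //.
- split=> // x y n Fx Fy x0 y0 xy0 nx ny.
  have [u Ou xE] := vP x Fx x0; have [w Ow yE] := vP y Fy y0.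
  have [z Oz zE] := vP (x + y) (sfD HF Fx Fy) xy0.
  rewrite -subr_ge0; apply: (npos z) => //.
  have -> : z * pi ^ (v (x + y) - n) = u * pi ^ (v x - n) + w * pi ^ (v y - n).
    by rewrite !expfzDr // !mulrA -zE -xE -yE mulrDl.
  by apply: srD => //; apply: Opos; rewrite ?subr_ge0 //; [case: Ou|case: Ow].
- exists pi; split=> //; first exact: sOF.
  apply: (v_uniq _ 1); rewrite ?expr1z ?mul1r //; first exact: sOF.
  by split; rewrite ?oner_neq0 ?invr1 //; apply: sr1.
Qed.

End PrimeValuation.

(** * Purely inseparable extensions of degree p *)

Section InseparablePair.
Variables (L : fieldType) (p : nat) (K F E E1 : L -> Prop) (v : L -> int).
Hypotheses (pchL : p \in [pchar L]) (HK : is_subfield K) (HF : is_subfield F).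
Hypotheses (HE : is_subfield E) (HE1 : is_subfield E1).
Hypotheses (Hv : is_valuation F v) (sE1E : forall x, E1 x -> E x) (sEF : forall x, E x -> F x).
Hypotheses (sKE1 : forall x, K x -> E1 x) (K0 : forall x, K x -> vge v 0 x).
Hypothesis Epow : forall x, E x -> E1 (x ^+ p).
Hypothesis basis : forall y, E y -> ~ E1 y -> forall x, E x ->
  exists b : 'I_p -> L, (forall i, E1 (b i)) /\ x = \sum_i b i * y ^+ i.
Variables (eps1 : nat) (pi1 : L).
Hypotheses (eps10 : (0 < eps1)%N) (Epi1 : E1 pi1) (pi10 : pi1 != 0) (vpi1 : v pi1 = eps1%:Z).
Hypothesis eps1_dvd : forall x, E1 x -> x != 0 -> (eps1%:Z %| v x)%Z.

Let p_pr : prime p := pcharf_prime pchL.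
Let p0 : (0 < p)%N. Proof. exact: prime_gt0. Qed.
Let sE1F x (H : E1 x) : F x := sEF (sE1E H).
Let sKE x (H : K x) : E x := sE1E (sKE1 H).

(* [v (h - g) <= v h] for all [g] in [E1]: no element of [E1] improves on [0] as an
   approximation of [h]. *)
Definition optimal h := [/\ E h, ~ E1 h & forall g, E1 g -> ~ vge v (v h + 1) (h - g)].

Lemma optimal_neq0 h : optimal h -> h != 0.
Proof. by move=> [_ nh _]; apply/eqP => h0; apply: nh; rewrite h0; apply: sf0. Qed.

(** The residue of [y] lies outside the residue field [k1] of [E1], but its p-th power lies in [k1].
    By [powers_free] in the residue field, the terms with coefficients of least value cannot
    cancel. *)
Lemma residue_independent (y : L) (n : int) (b : 'I_p -> L) :
  E y -> v y = 0 -> y != 0 -> (forall g, E1 g -> ~ vge v 1 (y - g)) ->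
  (forall i, E1 (b i)) -> vge v n (\sum_i b i * y ^+ i) -> forall i, vge v n (b i).
Proof.
move=> Ey vy y0 ny E1b nb i; have [->|bi] := eqVneq (b i) 0; first by left.
right; rewrite leNgt; apply/negP => bin.
have [k [rho [rho1 rhoB rhoM rho0]]] := residue_of_valuation HF Hv.
case: (@Order.TotalTheory.arg_minP _ int _ i (fun i => b i != 0) (fun i => v (b i)) bi) => i0 bi0 mini.
set m := v (b i0) in mini.
have ltmn : m < n by apply: le_lt_trans (mini i bi) bin.
pose a j := b j / b i0.
have E1a j : E1 (a j) by apply: sfM => //; apply: sfV.
have a0 j : vge v 0 (a j).
  rewrite /a; have [->|bj] := eqVneq (b j) 0; first by left; rewrite mul0r.
  right; rewrite (vM Hv) ?invr_eq0 //; [|exact: sE1F|by apply/sE1F/(sfV HE1)].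
  by rewrite (vV HF Hv) //; [have := mini j bj; rewrite /m; lia|exact: sE1F].
have Fy := sEF Ey.
have y0' : ball v F 0 y by split=> //; right; rewrite vy.
have BR : is_subring (ball v F 0) by apply: (ball_ring HF Hv).
have rho00 : rho 0 = 0 by apply/(rho0 0); [exact: sr0|left].
have rhoN x : ball v F 0 x -> rho (- x) = - rho x.
  by move=> Bx; rewrite -sub0r rhoB ?rho00 ?sub0r //; apply: sr0.
have rhoD x z : ball v F 0 x -> ball v F 0 z -> rho (x + z) = rho x + rho z.
  by move=> Bx Bz; rewrite -[z]opprK rhoB ?rhoN ?opprK //; apply: (srN BR).
have rhoX x l : ball v F 0 x -> rho (x ^+ l) = rho x ^+ l.
  by move=> Bx; elim: l => [|l IH]; rewrite ?expr0 ?exprS // rhoM ?IH //; apply: (srX BR).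
have rhoS (I : finType) (f : I -> L) : (forall j, ball v F 0 (f j)) ->
    rho (\sum_j f j) = \sum_j rho (f j).
  move=> Bf; suff : ball v F 0 (\sum_j f j) /\ rho (\sum_j f j) = \sum_j rho (f j) by case.
  elim/big_rec2: _ => [|j x z _ [Bz zE]]; first by split=> //; apply: sr0.
  by split; [apply: srD|rewrite rhoD // zE].
have Ba j : ball v F 0 (a j) by split=> //; apply: sE1F.
pose k1 c := exists x, [/\ E1 x, vge v 0 x & c = rho x].
have Hk1 : is_subfield k1.
  have B1 x : E1 x -> vge v 0 x -> ball v F 0 x by move=> E1x x0; split=> //; apply: sE1F.
  split; first split.
  - by exists 1; split; [apply: sf1|apply: (vge1 HF Hv)|].
  - move=> _ _ [x [E1x x0 ->]] [z [E1z z0 ->]]; split.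
      exists (x - z); split; [exact: sfB|by apply: (vgeB HF Hv) => //; apply: sE1F|].
      by rewrite rhoB //; apply: B1.
    exists (x * z); split; [exact: sfM| |by rewrite rhoM //; apply: B1].
    by apply: (vge0M Hv) => //; apply: sE1F.
  - move=> _ [x [E1x x0 ->]] rx0; have Bx := B1 x E1x x0.
    have [|xn0 vx] := vge_unit (sE1F E1x) x0.
      by move=> /(rho0 x Bx) /eqP; rewrite (negPf rx0).
    have vxV : vge v 0 x^-1 by right; rewrite (vV HF Hv) ?vx //; apply: sE1F.
    exists x^-1; split=> //; first exact: sfV.
    apply: (mulfI rx0); rewrite divff // -rhoM ?divff //.
    by apply: B1 => //; apply: sfV.
have pchk : p \in [pchar k].
  rewrite inE p_pr /=; apply/eqP.
  have -> : p%:R = rho p%:R.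
    have : forall l, ball v F 0 l%:R /\ rho l%:R = l%:R :> k.
      elim=> [|l [Bl IH]]; first by split=> //; apply: sr0.
      rewrite -addn1 !natrD; split; first by apply: (srD BR) => //; apply: sr1.
      by rewrite rhoD ?IH ?rho1 //; apply: sr1.
    by move=> /(_ p)[].
  by rewrite (pcharf0 pchL).
have nk1 : ~ k1 (rho y).
  move=> [g [E1g g0 yg]]; apply: (ny g E1g); apply/rho0.
    by apply: (srB BR) => //; split=> //; apply: sE1F.
  by rewrite rhoB ?yg ?subrr //; split=> //; apply: sE1F.
have k1p : k1 (rho y ^+ p).
  exists (y ^+ p); split; [exact: Epow|by apply: (vgeX HF Hv); [|case: y0']|].
  by rewrite rhoX.
have := powers_free pchk Hk1 nk1 k1p.
move=> /(_ (fun j => rho (a j)))-/(_ _ _ i0).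
have -> : rho (a i0) = 1 by rewrite /a divff.
move=> H; have : (1 : k) = 0; last by move/eqP; rewrite oner_eq0.
apply: H => [j|]; first by exists (a j).
rewrite /zero_only.
have -> : \sum_j rho (a j) * rho y ^+ j = rho (\sum_j a j * y ^+ j).
  rewrite rhoS => [|j]; last by apply: (srM BR) => //; apply: (srX BR).
  by apply: eq_bigr => j _; rewrite rhoM ?rhoX //; apply: (srX BR).
apply/rho0.
  by apply: (sr_sum BR) => j _; apply: (srM BR) => //; apply: (srX BR).
have -> : \sum_j a j * y ^+ j = (\sum_j b j * y ^+ j) / b i0.
  by rewrite mulr_suml; apply: eq_bigr => j _; rewrite /a mulrAC.
apply: (@vge_le _ v 1 (n - m)); first by lia.
apply: (vgeM Hv) => //.
- by apply: sf_sum => // j _; apply: sfM => //; [apply: sE1F|apply: sfX].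
- by apply/sE1F/(sfV HE1).
- by right; rewrite (vV HF Hv) //; apply: sE1F.
Qed.

(** Either v h is a value of [E1], and dividing by an element of that value gives a unit whose
    residue is new; or v h is a new value, and the terms b_i h^i have pairwise distinct values. *)
Lemma optimal_orthogonal h n (b : 'I_p -> L) : optimal h -> (forall i, E1 (b i)) ->
  vge v n (\sum_i b i * h ^+ i) -> forall i, vge v n (b i * h ^+ i).
Proof.
move=> oh E1b nb; have h0 := optimal_neq0 oh; case: oh => Eh nE1h oh.
have Fh := sEF Eh.
have [dv|ndv] := boolP (eps1%:Z %| v h)%Z.
  have [c [E1c c0 vc]] := pi_power HF Hv HE1 sE1F Epi1 pi10 vpi1 dv.
  have Fc := sE1F E1c.
  pose y := h / c.
  have Ey : E y by apply: sfM => //; apply: sfV => //; apply: sE1E.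
  have y0 : y != 0 by rewrite mulf_neq0 // invr_eq0.
  have vy : v y = 0.
    by rewrite (vM Hv) ?invr_eq0 // ?(vV HF Hv) //; [lia|exact: sfV].
  have ny g : E1 g -> ~ vge v 1 (y - g).
    move=> E1g yg; apply: (oh (g * c)); first exact: sfM.
    have -> : h - g * c = c * (y - g) by rewrite mulrBr /y mulrCA divff // mulr1 [c * g]mulrC.
    rewrite -vc; apply: (vgeM Hv) => //; last by right.
    by apply: sfB => //; [apply: sEF|apply: sE1F].
  have E1bc i : E1 (b i * c ^+ i) by apply: sfM => //; apply: sfX.
  have hE i : b i * h ^+ i = b i * c ^+ i * y ^+ i.
    by rewrite /y expr_div_n -mulrA; congr (_ * _); rewrite mulrCA divff ?mulr1 // expf_neq0.
  move=> i; rewrite hE mulrC; apply: (vge0M Hv); [exact: (sEF (sfX HE i Ey))|exact: sE1F| |].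
    by apply: (vgeX HF Hv); [exact: sEF|right; rewrite vy].
  apply: (residue_independent Ey vy y0 ny (b := fun i => b i * c ^+ i) E1bc).
  by under eq_bigr do rewrite -hE.
(* Here p v(h) is a multiple of eps1 but v(h) is not, so the i v(h) with i < p are distinct modulo
   eps1. *)
apply: (distinct_values HF Hv) => // [i|i j].
  by apply: (sfM HF); [exact: sE1F|exact: sfX].
rewrite !mulf_eq0 !negb_or => /andP[bi hi] /andP[bj hj].
rewrite !(vM Hv) ?(vX HF Hv) //; try exact: sE1F; try exact: sfX.
move=> vij; apply/val_inj/eqP.
have dp : (eps1%:Z %| v h *+ p)%Z.
  by rewrite -(vX HF Hv) //; apply: eps1_dvd; [apply: Epow|apply: expf_neq0].
have wlog_lt (l m : nat) : (l < m)%N -> (m < p)%N -> (eps1%:Z %| v h *+ m - v h *+ l)%Z -> False.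
  move=> lm mp; rewrite -mulrnBr ?(ltnW lm) // => dm; move/negP: ndv; apply.
  have co : coprime (m - l) p.
    rewrite coprime_sym prime_coprime // gtnNdvd ?subn_gt0 //.
    by apply: leq_ltn_trans mp; apply: leq_subr.
  rewrite -mulr_natl natz dvdzE abszM !absz_nat in dp.
  rewrite -mulr_natl natz dvdzE abszM !absz_nat in dm.
  have := dvdn_gcd eps1 ((m - l) * `|v h|) (p * `|v h|); rewrite dp dm /= -muln_gcdl.
  by move/eqP: co => ->; rewrite mul1n.
have dij : (eps1%:Z %| v h *+ i - v h *+ j)%Z.
  have -> : v h *+ i - v h *+ j = v (b j) - v (b i) by lia.
  by apply: rpredB; apply: eps1_dvd.
case: (ltngtP i j) => // ij; exfalso; last exact: wlog_lt ij (ltn_ord i) dij.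
by apply: wlog_lt ij (ltn_ord j) _; rewrite -opprB rpredN.
Qed.

Lemma optimal_ball h (m : int) : optimal h ->
  ball v E m = direct_sum (fun i : 'I_p => ball v E1 (m - v h *+ i)) (fun i : 'I_p => h ^+ i).
Proof.
move=> oh; have h0 := optimal_neq0 oh; have [Eh nh _] := oh; have Fh := sEF Eh.
have vhX i : vge v (v h *+ i) (h ^+ i) by right; rewrite (vX HF Hv).
apply/predeqP => x; split=> [[Ex mx]|[b [bP ->]]].
  have [b [E1b xE]] := basis Eh nh Ex; exists b; split=> // i; split=> //.
  rewrite xE in mx; have := optimal_orthogonal oh E1b mx i.
  have [->|bi] := eqVneq (b i) 0; first by left.
  have bh : b i * h ^+ i != 0 by rewrite mulf_neq0 // expf_neq0.
  move=> /(vgeE v m bh); rewrite (vM Hv) ?(vX HF Hv) ?expf_neq0 //; [|exact: sE1F|exact: sfX].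
  by move=> H; right; lia.
split; first by apply: (sf_sum HE) => i _; apply: (sfM HE); [case: (bP i) => /sE1E|exact: sfX].
have Fb i : F (b i) by case: (bP i) => /sE1F.
apply: (vge_sum HF Hv) => i _; first exact: (sfM HF (Fb i) (sfX HF i Fh)).
rewrite -[m](subrK (v h *+ i)); apply: (vgeM Hv) => //; first exact: (sfX HF i Fh).
by case: (bP i).
Qed.

Lemma polys_direct_sum (R : L -> Prop) (y : L) : is_subring R ->
  direct_sum (fun i : 'I_p => R) (fun i : 'I_p => y ^+ i) =
  (fun x => exists f : {poly L}, [/\ poly_over R f, (size f <= p)%N & x = f.[y]]).
Proof.
move=> HR; apply/predeqP => x; split=> [[b [Rb ->]]|[f [Rf sf ->]]].
  pose c i := if insub i is Some j then b j else 0.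
  exists (\poly_(i < p) c i); split; [|exact: size_poly|].
    by apply: poly_over_poly => // i; rewrite /c; case: insub => [j|]; [exact: Rb|exact: sr0].
  by rewrite horner_poly; apply: eq_bigr => i _; rewrite /c valK.
exists (fun i : 'I_p => f`_i); split=> [i|]; first exact: Rf.
exact: horner_coef_wide.
Qed.

(** Polynomials over [R] of degree below p are stable under the substitution of X + g for X. A
    generator may thus be replaced by an optimal translate. *)
Lemma direct_sum_shift (R : L -> Prop) (y g : L) : is_subring R -> R g ->
  direct_sum (fun i : 'I_p => R) (fun i : 'I_p => y ^+ i) =
  direct_sum (fun i : 'I_p => R) (fun i : 'I_p => (y - g) ^+ i).
Proof.
move=> HR; have shift z c : R c -> forall x,
    direct_sum (fun i : 'I_p => R) (fun i : 'I_p => z ^+ i) x ->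
    direct_sum (fun i : 'I_p => R) (fun i : 'I_p => (z - c) ^+ i) x.
  move=> Rc x; rewrite !polys_direct_sum // => -[f [Rf sf ->]].
  exists (f \Po ('X + c%:P)); split.
  - by apply: poly_over_comp => //; apply: (poly_overD HR); [apply: poly_overX|apply: poly_overC].
  - by rewrite size_comp_poly2 // size_XaddC.
  - by rewrite horner_comp !hornerE subrK.
move=> Rg; apply/predeqP => x; split; first exact: shift.
by move/(shift _ _ (srN HR Rg)); rewrite opprK subrK.
Qed.

Variable d1 : nat.
Hypothesis dim1 : dimq K (ball v E1 0) (ball v E1 1) d1.

Lemma powers_free_pair h : E h -> ~ E1 h -> free_mod E1 (@zero_only L) (fun i : 'I_p => h ^+ i).
Proof. by move=> Eh nh; apply: powers_free => //; apply: Epow. Qed.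

(** The terms of index i and p - i add up to r - 1: i r and (p - i) r have sum p r, and neither is
    divisible by p, so their remainders have sum p. *)
Lemma floor_sum (r : nat) : (0 < r)%N -> coprime p r ->
  (2 * \sum_(i < p) (i * r) %/ p = (p - 1) * (r - 1))%N.
Proof.
move=> r0 co.
have -> : (\sum_(i < p) (i * r) %/ p = \sum_(i < p.-1) (i.+1 * r) %/ p)%N.
  rewrite -[in LHS](prednK p0).
  rewrite (big_ord_recl p.-1 (fun i : 'I_p.-1.+1 => ((i * r) %/ p.-1.+1)%N)) /= mul0n div0n add0n.
  by rewrite prednK.
rewrite mul2n -addnn {2}(reindex_inj rev_ord_inj) -big_split /=.
transitivity (\sum_(i < p.-1) (r - 1))%N; last by rewrite sum_nat_const card_ord !subn1.
apply: eq_bigr => i _.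
have ip : (i.+1 < p)%N by have := ltn_ord i; lia.
have -> : ((p.-1 - i.+1).+1 = p - i.+1)%N by have := ltn_ord i; lia.
have nd : ~~ (p %| i.+1 * r)%N.
  by rewrite Gauss_dvdl // gtnNdvd.
have := divn_eq (i.+1 * r) p; have := divn_eq ((p - i.+1) * r) p.
have m0 : (0 < (i.+1 * r) %% p)%N by rewrite lt0n.
have mp : ((i.+1 * r) %% p < p)%N by rewrite ltn_mod.
have m'p : (((p - i.+1) * r) %% p < p)%N by rewrite ltn_mod.
rewrite mulnBl.
set q1 := ((i.+1 * r) %/ p)%N; set q2 := ((p * r - i.+1 * r) %/ p)%N.
set x := ((i.+1 * r) %% p)%N in m0 mp *.
rewrite mulnBl in m'p; set y := ((p * r - i.+1 * r) %% p)%N in m'p *.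
have le1 : (i.+1 * r <= p * r)%N by rewrite leq_mul2r (ltnW ip) orbT.
move=> e2 e1.
have key : ((q1 + q2) * p + (x + y) = r * p)%N by move: e1 e2 le1; lia.
have : (x + y = p)%N.
  have dxy : (p %| x + y)%N.
    by rewrite -(dvdn_addr _ (dvdn_mull (q1 + q2) (dvdnn p))) key dvdn_mull.
  have [c cE] := dvdnP dxy.
  have : (c < 2)%N by rewrite -(ltn_pmul2r p0) -cE; lia.
  by case: c cE => [|[|c]] //; lia.
move=> xy; move: key; rewrite xy -[X in (_ + X)%N]mul1n -mulnDl => /eqP.
by rewrite eqn_pmul2r // => /eqP; lia.
Qed.

(** [optimal_ball] reduces both dimensions to balls of [E1]. Comparing values -i v(h) with 0 gives
    [c]; counting the i for which eps1 divides i v(h) gives [d]. *)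
Lemma optimal_dims h : optimal h -> 0 <= v h ->
  exists d c k, [/\ dimq K (ball v E 0) (ball v E 1) d,
    (d = d1 \/ d = p * d1)%N,
    dimq K (ball v E 0) (direct_sum (fun i : 'I_p => ball v E1 0) (fun i : 'I_p => h ^+ i)) c &
    (2 * c = (p - 1) * d * k)%N].
Proof.
move=> oh vh; have h0 := optimal_neq0 oh; have [Eh nh _] := oh; have Fh := sEF Eh.
have [r vr] : exists r : nat, v h = r%:Z by exists `|v h|%N; lia.
have fr := powers_free_pair Eh nh.
have bs n : subspace K (ball v E1 n) by apply: (ball_subspace Hv HE1).
have bE1 n x : ball v E1 n x -> E1 x by case.
pose e (i : 'I_p) := (if (eps1%:Z %| - (i * r)%N%:Z)%Z then d1 else 0)%N.
have step (i : 'I_p) : dimq K (ball v E1 (0 - v h *+ i)) (ball v E1 (1 - v h *+ i)) (e i).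
  have := dimq_ball_step HF Hv HE1 sE1F sKE1 K0 eps10 Epi1 pi10 vpi1 eps1_dvd dim1 (- (i * r)%N%:Z).
  have -> : v h *+ i = (i * r)%N%:Z by rewrite vr -mulr_natl natz PoszM.
  by rewrite sub0r [1 - _]addrC.
have down (i : 'I_p) : dimq K (ball v E1 (0 - v h *+ i)) (ball v E1 0) ((i * r) %/ eps1 * d1).
  have := dimq_ball HF Hv HE1 sE1F sKE1 K0 eps10 Epi1 pi10 vpi1 eps1_dvd HK dim1 (i * r).
  have -> : v h *+ i = (i * r)%N%:Z by rewrite vr -mulr_natl natz PoszM.
  by rewrite sub0r.
have D : dimq K (ball v E 0) (ball v E 1) (\sum_(i < p) e i).
  rewrite !(optimal_ball _ oh); apply: (dimq_direct_sum (E1 := E1)) => // i x; exact: bE1.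
have C : dimq K (ball v E 0)
    (direct_sum (fun i : 'I_p => ball v E1 0) (fun i : 'I_p => h ^+ i))
    (\sum_(i < p) (i * r) %/ eps1 * d1)%N.
  rewrite (optimal_ball _ oh); apply: (dimq_direct_sum (E1 := E1)) => // i x; exact: bE1.
have dvdE (n : nat) : (eps1%:Z %| - n%:Z)%Z = (eps1 %| n)%N by rewrite dvdzE abszN !absz_nat.
have [dr|ndr] := boolP (eps1 %| r)%N.
  (* The residue field grows by a factor p, and the sum of the i below p is p (p - 1) / 2. *)
  exists (p * d1)%N, (\sum_(i < p) (i * r) %/ eps1 * d1)%N, (r %/ eps1)%N; split=> //.
  - rewrite (_ : (p * d1)%N = (\sum_(i < p) e i)%N) //.
    by under eq_bigr do rewrite /e dvdE dvdn_mull //; rewrite sum_nat_const card_ord.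
  - by right.
  - rewrite -big_distrl /=; under eq_bigr do rewrite -muln_divA //.
    rewrite -big_distrl /=.
    have S : (2 * \sum_(i < p) i = p * (p - 1))%N.
      have -> : (\sum_(i < p) i = \sum_(0 <= i < p) i)%N by rewrite big_mkord.
      by rewrite bin2_sum -mul_bin_diag bin1 subn1.
    by rewrite mulnA mulnA S; lia.
have dpr : (eps1 %| p * r)%N.
  have := eps1_dvd (Epow Eh) (expf_neq0 _ h0); rewrite (vX HF Hv) // vr.
  by rewrite -mulr_natl natz dvdzE abszM !absz_nat.
have edr (i : nat) : (0 < i)%N -> (i < p)%N -> (eps1 %| i * r)%N = false.
  move=> i0 ip; apply/negP => dir; move/negP: ndr; apply.
  have := dvdn_gcd eps1 (i * r) (p * r); rewrite dir dpr /= -muln_gcdl.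
  have -> : gcdn i p = 1 by apply/eqP; rewrite -/(coprime i p) coprime_sym prime_coprime // gtnNdvd.
  by rewrite mul1n.
have [r2 r2E] := dvdnP dpr.
have r20 : (0 < r2)%N.
  rewrite lt0n; apply/eqP => r20; move: r2E; rewrite r20 mul0n => /eqP.
  by rewrite muln_eq0 (gtn_eqF p0) /= => /eqP r0; move: ndr; rewrite r0 dvdn0.
have co2 : coprime p r2.
  rewrite prime_coprime //; apply/negP => /dvdnP[c cE]; move/negP: ndr; apply.
  move: r2E; rewrite cE mulnAC [(c * _ * _)%N]mulnC => /eqP; rewrite eqn_pmul2l // => /eqP ->.
  exact: dvdn_mull.
(* The value group grows: r / eps1 = r2 / p in lowest terms, and [floor_sum] gives k = r2 - 1. Only
   i = 0 contributes to [d]. *)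
exists d1, (\sum_(i < p) (i * r) %/ eps1 * d1)%N, (r2 - 1)%N; split=> //.
- rewrite [X in dimq _ _ _ X](_ : d1 = (\sum_(i < p) e i)%N) //.
  rewrite (bigD1 (Ordinal p0)) //= /e mul0n oppr0 dvdz0 big1 ?addn0 // => i i0.
  by rewrite dvdE edr // lt0n; apply: contraNneq i0 => i0; apply/eqP/val_inj.
- by left.
- rewrite -big_distrl /=.
  have -> : (\sum_(i < p) (i * r) %/ eps1 = \sum_(i < p) (i * r2) %/ p)%N.
    apply: eq_bigr => i _.
    rewrite -(@divnMr p (i * r)%N eps1 p0) -(@divnMr eps1 (i * r2)%N p eps10).
    by rewrite -!mulnA -r2E [(p * eps1)%N]mulnC [(r * p)%N]mulnC.
  by rewrite mulnA floor_sum //; lia.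
Qed.

(** Write z as the sum of the b_i f^i. If g approximates f very well, then the sum of the b_i g^i
    approximates z too well, since f - g divides f^i - g^i. So v(f - g) is bounded for g in [E1],
    and a maximal value gives an optimal f - g. *)
Lemma optimal_shift z f : optimal z -> E f -> vge v 0 f -> ~ E1 f ->
  exists2 g, E1 g & optimal (f - g).
Proof.
move=> [Ez nz oz] Ef f0 nf; have [b [E1b zE]] := basis Ef nf Ez.
have Ff := sEF Ef.
pose B := (\sum_i `|v (b i)|)%N.
have bB i : vge v (- B%:Z) (b i).
  right; have : (`|v (b i)| <= B)%N by rewrite /B (bigD1 i) //= leq_addr.
  by lia.
(* As -B bounds the values of the b_i from below, v(f - g) >= N would give an approximation of z
   with error of value at least v z + 1. *)
pose N : nat := `|(v z + 1 + B%:Z)%R|%N.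
have bd g : E1 g -> ~ vge v N%:Z (f - g).
  move=> E1g Nfg; have Fg := sE1F E1g; have Ffg : F (f - g) by exact: sfB.
  have g0 : vge v 0 g.
    rewrite -[g](subKr f); apply: (vgeB HF Hv) => //.
    by apply: vge_le Nfg.
  apply: (oz (\sum_i b i * g ^+ i)); first by apply: sf_sum => // i _; apply: sfM => //; apply: sfX.
  rewrite {2}zE -sumrB; under eq_bigr do rewrite -mulrBr subrXX.
  have Fs (i : nat) : F (\sum_(j < i) f ^+ (i.-1 - j) * g ^+ j).
    by apply: sf_sum => // j _; apply: sfM => //; apply: sfX.
  apply: (vge_sum HF Hv) => i _; first by apply: (sfM HF); [exact: sE1F|exact: sfM].
  apply: (@vge_le _ v _ (- B%:Z + (N%:Z + 0))); first by rewrite /N; lia.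
  apply: (vgeM Hv) => //; [exact: sE1F|exact: sfM|].
  apply: (vgeM Hv) => //; apply: (vge_sum HF Hv) => j _; first by apply: sfM => //; apply: sfX.
  by apply: (vge0M Hv); try exact: sfX; apply: (vgeX HF Hv).
have nfg g : E1 g -> f - g != 0.
  by move=> E1g; apply/eqP => fg; apply: (bd g E1g); left.
pose P n := `[< exists2 g, E1 g & v (f - g) = N%:Z - n%:Z >].
have exP : exists n, P n.
  exists `|(N%:Z - v f)%R|%N; apply/asboolP; exists 0; first exact: sf0.
  rewrite subr0; have : ~ (N%:Z <= v f) by move=> H; apply: (bd 0); [exact: sf0|rewrite subr0; right].
  by move/negP; rewrite -ltNge; lia.
case: (ex_minnP exP) => n /asboolP[g E1g vg] minn.
exists g => //; split; [by apply: sfB => //; apply: sE1E| |].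
  by move=> E1fg; apply: nf; rewrite -[f](subrK g); apply: sfD.
move=> g' E1g' H; have E1s : E1 (g + g') by exact: sfD.
have v1 : v (f - g) + 1 <= v (f - (g + g')).
  by apply/(vgeE _ _ (nfg _ E1s)); rewrite opprD addrA.
have v2 : v (f - (g + g')) < N%:Z.
  by rewrite ltNge; apply/negP => H'; apply: (bd _ E1s); right.
have : P `|(N%:Z - v (f - (g + g')))%R|%N by apply/asboolP; exists (g + g') => //; lia.
by move/minn; lia.
Qed.

Lemma local_step z f : optimal z -> E f -> vge v 0 f -> ~ E1 f ->
  exists d c k, [/\ dimq K (ball v E 0) (ball v E 1) d,
    (d = d1 \/ d = p * d1)%N,
    dimq K (ball v E 0) (direct_sum (fun i : 'I_p => ball v E1 0) (fun i : 'I_p => f ^+ i)) c &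
    (2 * c = (p - 1) * d * k)%N].
Proof.
move=> oz Ef f0 nf; have [g E1g oh] := optimal_shift oz Ef f0 nf.
have Fg := sE1F E1g; have Ff := sEF Ef; have h0 := optimal_neq0 oh.
have vh : 0 <= v (f - g).
  rewrite leNgt; apply/negP => vh; case: oh => _ _ /(_ (- g) (sfN HE1 E1g)); apply.
  by rewrite opprK subrK; apply: vge_le f0; lia.
have g0 : vge v 0 g.
  rewrite -[g](subKr f); apply: (vgeB HF Hv) => //; first exact: sfB.
  by right.
rewrite (direct_sum_shift (R := ball v E1 0) f (g := g)) //; first exact: optimal_dims.
exact: (ball_ring HF Hv HE1 (fun x H => sE1F H)).
Qed.

Variables (eps : nat) (pi : L).
Hypotheses (eps0 : (0 < eps)%N) (Epi : E pi) (pi0 : pi != 0) (vpi : v pi = eps%:Z).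
Hypothesis eps_dvd : forall x, E x -> x != 0 -> (eps%:Z %| v x)%Z.

(** The generator is a unit with a new residue if v h is a value of [E1], and otherwise a
    uniformizer of [E]. In both cases the shifts by i v(z) in [optimal_ball] do not change the unit
    ball of [E1]. *)
Lemma monogenic h : optimal h ->
  exists z, [/\ E z, ~ E1 z, vge v 0 z &
    ball v E 0 = direct_sum (fun i : 'I_p => ball v E1 0) (fun i : 'I_p => z ^+ i)].
Proof.
move=> oh; have h0 := optimal_neq0 oh; have [Eh nh oh'] := oh; have Fh := sEF Eh.
have [dv|ndv] := boolP (eps1%:Z %| v h)%Z.
  have [c [E1c c0 vc]] := pi_power HF Hv HE1 sE1F Epi1 pi10 vpi1 dv.
  have Fc := sE1F E1c; have Ec := sE1E E1c.
  have vz : v (h / c) = 0.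
    by rewrite (vM Hv) ?invr_eq0 // ?(vV HF Hv) //; [lia|exact: sfV].
  have Ez : E (h / c) by apply: sfM => //; apply: sfV.
  have nz : ~ E1 (h / c) by move=> H; apply: nh; rewrite -[h](divfK c0); apply: sfM.
  have oz : optimal (h / c).
    split=> // g E1g; rewrite vz => zg; apply: (oh' (g * c)); first exact: sfM.
    have -> : h - g * c = c * (h / c - g) by rewrite mulrBr mulrCA divff // mulr1 [c * g]mulrC.
    rewrite -vc; apply: (vgeM Hv) => //; last by right.
    by apply: sfB => //; [apply: sEF|apply: sE1F].
  exists (h / c); split=> //; first by right; rewrite vz.
  rewrite (optimal_ball _ oz) vz; congr (direct_sum _ _).
  by apply: funext => i; rewrite mul0rn subr0.
have ne : ~~ (eps1%:Z %| eps%:Z)%Z.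
  by apply: contra ndv => H; apply: dvdz_trans H (eps_dvd Eh h0).
have npi : ~ E1 pi by move=> H; move/negP: ne; apply; rewrite -vpi; apply: eps1_dvd.
(* An approximation of [pi] from [E1] with a better error would have the value of [pi], which is not
   a value of [E1]. *)
have opi : optimal pi.
  split=> // g E1g H; have Fg := sE1F E1g; have Fpi := sEF Epi.
  have [g0|g0] := eqVneq g 0.
    by move: H; rewrite g0 subr0 vgeE //; lia.
  have : v g = v pi.
    apply/eqP; rewrite eq_le; apply/andP; split.
      rewrite leNgt; apply/negP => lt.
      have : vge v (v pi + 1) pi.
        rewrite -{2}[pi](subrK g); apply: (vgeD Hv) => //; first exact: sfB.
        by right; lia.
      by rewrite vgeE //; lia.
    apply/(vgeE _ _ g0); rewrite -[g](subKr pi); apply: (vgeB HF Hv) => //; [exact: sfB|by right|].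
    by apply: vge_le H; lia.
  by rewrite vpi => vg; move/negP: ne; apply; rewrite -vg; apply: eps1_dvd.
exists pi; split=> //; first by right; rewrite vpi.
have e1 : (eps %| eps1)%N.
  by have := eps_dvd (sE1E Epi1) pi10; rewrite vpi1 dvdzE !absz_nat.
have e2 : (eps1 %| eps * p)%N.
  have := eps1_dvd (Epow Epi) (expf_neq0 _ pi0); rewrite (vX HF Hv) ?vpi //; last exact: sEF.
  by rewrite -mulr_natl natz dvdzE abszM !absz_nat mulnC.
have eps1E : eps1 = (eps * p)%N.
  have [m mE] := dvdnP e1; rewrite mE mulnC.
  have : (m %| p)%N by move: e2; rewrite mE mulnC dvdn_pmul2l.
  have [m1|m1] := eqVneq m 1%N; last by move/(prime_nt_dvdP p_pr m1)->.
  by move: ne; rewrite dvdzE !absz_nat mE m1 mul1n dvdnn.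
rewrite (optimal_ball _ opi); congr (direct_sum _ _).
(* Values of [E1] are multiples of eps1 = eps p, so a value that is at least -i eps with i < p is
   already nonnegative. *)
apply: funext => i; apply/predeqP => x; rewrite vpi sub0r.
split=> [[E1x H]|]; last by apply: ball_le; lia.
split=> //; have [->|x0] := eqVneq x 0; first by left.
right; move: H; rewrite vgeE // => H.
have /dvdzP[q qE] := eps1_dvd E1x x0.
have ip := ltn_ord i.
move: H; rewrite qE -mulr_natl natz eps1E PoszM => H.
have : 0 <= q.
  rewrite leNgt; apply/negP => q0.
  have : q * (eps%:Z * p%:Z) <= - (eps%:Z * p%:Z) by nia.
  have : eps%:Z * (i : nat)%:Z < eps%:Z * p%:Z by nia.
  by lia.
by move=> q0; nia.
Qed.

End InseparablePair.

(** * Localization at a maximal ideal *)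

Section Localization.
Variables (L : fieldType) (B A : L -> Prop) (pi : L).
Hypotheses (HB : is_subfield B) (HA : is_subring A) (sBA : forall x, B x -> A x).
Hypotheses (Api : A pi) (pi0 : pi != 0).

Definition ideal_of (I : L -> Prop) := [/\ forall x, I x -> A x, I 0,
  forall x y, I x -> I y -> I (x + y) & forall x y, A x -> I y -> I (x * y)].

Definition ideal_adjoin (I : L -> Prop) z := fun y => exists i w, [/\ I i, A w & y = i + z * w].

Lemma ideal_adjoinP I z : ideal_of I -> A z ->
  [/\ ideal_of (ideal_adjoin I z), forall x, I x -> ideal_adjoin I z x & ideal_adjoin I z z].
Proof.
move=> [IA I0 ID IM] Az; split; [split|..].
- by move=> _ [i [w [Ii Aw ->]]]; apply: (srD HA); [apply: IA|apply: (srM HA)].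
- by exists 0, 0; split; [|exact: sr0|rewrite mulr0 addr0].
- move=> _ _ [i [w [Ii Aw ->]]] [j [u [Ij Au ->]]]; exists (i + j), (w + u).
  by split; [exact: ID|exact: srD|rewrite mulrDr addrACA].
- move=> x _ Ax [j [u [Ij Au ->]]]; exists (x * j), (x * u).
  by split; [exact: IM|exact: srM|rewrite mulrDr mulrCA].
- by move=> x Ix; exists x, 0; split=> //; [exact: sr0|rewrite mulr0 addr0].
- by exists 0, 1; split=> //; [exact: sr1|rewrite mulr1 add0r].
Qed.

Lemma ideal_adjoin_prod I x (rs : seq L) : ideal_of I -> A x -> (forall b, b \in rs -> B b) ->
  (forall b, b \in rs -> ideal_adjoin I (x - b) 1) ->
  ideal_adjoin I (\prod_(b <- rs) (x - b)) 1.
Proof.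
move=> II Ax; have [IA I0 ID IM] := II.
elim: rs => [|b rs IH] Brs H.
  by rewrite big_nil; exists 0, 1; split=> //; [exact: sr1|rewrite mulr1 add0r].
rewrite big_cons.
have [||i [w [Ii Aw E1]]] := IH.
- by move=> c crs; apply: Brs; rewrite inE crs orbT.
- by move=> c crs; apply: H; rewrite inE crs orbT.
have [j [u [Ij Au E2]]] := H b (mem_head _ _).
have Ap : A (\prod_(c <- rs) (x - c)).
  rewrite big_seq; elim/big_rec: _ => [|c y crs Ay]; first exact: sr1.
  by apply: (srM HA) => //; apply: (srB HA) => //; apply/sBA/Brs; rewrite inE crs orbT.
exists (j + (x - b) * u * i), (u * w); split; last 1 first.
- set P := \prod_(c <- rs) _ in E1 *.
  have -> : j + (x - b) * u * i + (x - b) * P * (u * w) = j + (x - b) * u * (i + P * w) by ring.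
  by rewrite -E1 mulr1.
- apply: (ID) => //; apply: (IM) => //; apply: (srM HA) => //; apply: (srB HA) => //.
  by apply/sBA/Brs; rewrite mem_head.
- exact: srM.
Qed.

Variables (n : nat) (x : 'I_n -> L) (rs : 'I_n -> seq L).
Hypothesis Ax : forall i, A (x i).
Hypothesis Brs : forall i b, b \in rs i -> B b.
Hypothesis urs : forall i, uniq (rs i).
Hypothesis rs_root : forall i, exists2 w, A w & \prod_(b <- rs i) (x i - b) = pi * w.
Hypothesis gen_x : forall z, A z ->
  exists c : 'I_n -> L, (forall i, B (c i)) /\ exists2 w, A w & z = \sum_i c i * x i + pi * w.
Hypothesis divides : forall z, A z -> z != 0 -> exists w k, A w /\ z * w = pi ^+ k.

(** The ideal is enlarged once for each generator [x i]. The product of the x_i - b over [rs i] lies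
    in pi A, hence in [I], so by [ideal_adjoin_prod] some x_i - b can be added without reaching
    1. *)
Lemma residue_ideal I0 : ideal_of I0 -> I0 pi -> ~ I0 1 ->
  exists I, [/\ ideal_of I, forall z, I0 z -> I z, ~ I 1 &
    forall i, exists2 b, b \in rs i & I (x i - b)].
Proof.
move=> II0 I0pi nI0; suff H k : (k <= n)%N -> exists I, [/\ ideal_of I, forall z, I0 z -> I z, ~ I 1 &
    forall i : 'I_n, (i < k)%N -> exists2 b, b \in rs i & I (x i - b)].
  by have [I [H1 H2 H3 H4]] := H n (leqnn n); exists I; split=> // i; apply: H4.
elim: k => [|k IH] kn; first by exists I0.
have [I [II sI nI IP]] := IH (ltnW kn); pose i := Ordinal kn.
have [b bi nb] : exists2 b, b \in rs i & ~ ideal_adjoin I (x i - b) 1.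
  apply: contrapT => nex; apply: nI.
  have [||j [w [Ij Aw ->]]] := @ideal_adjoin_prod I (x i) (rs i) II (Ax i); first exact: Brs.
    by move=> b bi; apply: contrapT => nb; apply: nex; exists b.
  have [w' Aw' ->] := rs_root i; case: II => IA I00 ID IM; apply: (ID) => //.
  by rewrite -mulrA mulrC; apply: (IM); [exact: srM|exact: sI].
have Axb : A (x i - b) by apply: (srB HA) => //; apply/sBA/(Brs bi).
have [II' sII' Ib] := ideal_adjoinP II Axb.
exists (ideal_adjoin I (x i - b)); split=> //; first by move=> z /sI/sII'.
move=> j; rewrite ltnS leq_eqVlt => /orP[/eqP ji|/IP[c cj Ic]]; last by exists c => //; apply: sII'.
by have -> : j = i; [exact: val_inj|exists b].
Qed.

(* Enlarge [I0] to a maximal ideal [I] with residue field [B].  As [x i - b] is a simple factor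
   of an element of [pi A], it lies in [pi A_I]; hence the localization [A_I] is a valuation ring
   with uniformizer [pi]. *)
Lemma valuation_localization I0 : ideal_of I0 -> I0 pi -> ~ I0 1 -> exists D : L -> Prop,
  [/\ is_subring D, forall z, A z -> D z, ~ D pi^-1,
      forall z, A z -> z != 0 -> exists u (k : nat), unit_of D u /\ z = u * pi ^+ k &
      (forall z, I0 z -> z != 0 -> ~ D z^-1) /\
      (forall z c, A z -> B c -> c != 0 -> I0 (z - c) -> D z^-1)].
Proof.
move=> II0 I0pi nI0; have [I [II sI nI IP]] := residue_ideal II0 I0pi nI0.
have [IA I00 ID IM] := II; have [b bP] := choice (fun i => let: ex_intro2 b h1 h2 := IP i in
  ex_intro (fun b => b \in rs i /\ I (x i - b)) b (conj h1 h2)).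
have Ipi : I pi by exact: sI.
have BI c : B c -> I c -> c = 0.
  move=> Bc Ic; apply: contrapT => /eqP c0; apply: nI; rewrite -(mulVf c0).
  by apply: (IM) => //; apply/sBA/(sfV HB).
have IN z : I z -> I (- z).
  by rewrite -mulN1r; apply: (IM); apply: (srN HA); exact: sr1.
have IB z w : I z -> I w -> I (z - w) by move=> Iz Iw; apply: (ID) => //; apply: (IN).
have AI z : A z -> exists2 c, B c & I (z - c).
  move=> /gen_x[c [Bc [w Aw ->]]]; exists (\sum_i c i * b i).
    by apply: (sf_sum HB) => i _; apply: (sfM HB) => //; case: (bP i) => /Brs.
  rewrite addrAC -sumrB; apply: (ID); last by rewrite mulrC; apply: (IM).
  elim/big_rec: _ => // i y _ Iy; apply: (ID) => //; rewrite -mulrBr; apply: (IM); first exact: sBA.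
  by case: (bP i).
have I_prime z w : A z -> A w -> ~ I z -> ~ I w -> ~ I (z * w).
  move=> Az Aw nz nw Izw; have [c Bc Ic] := AI z Az; have [e Be Ie] := AI w Aw.
  have : I (c * e).
    have -> : c * e = z * w - w * (z - c) - c * (w - e) by ring.
    by apply: (IB); [apply: (IB) => //|]; apply: (IM) => //; apply: sBA.
  move/(BI _ (sfM HB Bc Be))/eqP; rewrite mulf_eq0 => /orP[] /eqP z0.
    by apply: nz; move: Ic; rewrite z0 subr0.
  by apply: nw; move: Ie; rewrite z0 subr0.
pose D z := exists a w, [/\ A a, A w, ~ I w & z = a / w].
have nz w : ~ I w -> w != 0 by move=> nw; apply/eqP => w0; apply: nw; rewrite w0.
have AD z : A z -> D z by move=> Az; exists z, 1; split=> //; [exact: sr1|rewrite divr1].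
have HD : is_subring D.
  split; first by apply: (AD); apply: sr1.
  move=> _ _ [a [w [Aa Aw nw ->]]] [a' [w' [Aa' Aw' nw' ->]]]; split.
    exists (a * w' - a' * w), (w * w'); split; [|exact: srM|exact: I_prime|].
      by apply: (srB HA); apply: (srM HA).
    by have := nz w nw; have := nz w' nw' => h1 h2; field; rewrite h1 h2.
  by exists (a * a'), (w * w'); split; [exact: srM|exact: srM|exact: I_prime|rewrite invfM mulrACA].
have DM := srM HD; have DD := srD HD.
have Dinv z : A z -> ~ I z -> D z^-1.
  by move=> Az nIz; exists 1, z; split=> //; [exact: sr1|rewrite div1r].
have noninv z : I z -> z != 0 -> ~ D z^-1.
  move=> Iz z0 [a [w [Aa Aw nw E]]]; apply: (nw).
  have -> : w = a * z by rewrite -[a](mulfVK (nz w nw)) -E mulrAC mulVf // mul1r.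
  exact: IM.
have npi : ~ D pi^-1 by exact: noninv.
(* Modulo pi, z is a combination of the x_i - b_i, and each of these is pi w / g with g, the product
   of the other factors, outside [I]: distinct elements of [B] are incongruent modulo [I]. *)
have Ires z : I z -> D (z / pi).
  move=> Iz; have Dx i : D ((x i - b i) / pi).
    have [bi Ib] := bP i; have [w Aw E] := rs_root i.
    rewrite (big_rem _ bi) /= in E.
    set g := \prod_(c <- rem (b i) (rs i)) (x i - c) in E.
    have [Ag ng] : A g /\ ~ I g.
      rewrite /g big_seq; apply: (big_rec (fun y => A y /\ ~ I y)) => [|c y crs [Ay nIy]].
        by split=> //; exact: sr1.
      have Bc := Brs (mem_rem crs).
      have Ac : A (x i - c) by apply: (srB HA) => //; apply: sBA.
      split; first exact: srM.
      apply: (I_prime) => // Ic; have cb : c = b i.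
        have : I (b i - c) by rewrite (_ : _ - _ = (x i - c) - (x i - b i)); [exact: IB|ring].
        by move/(BI _ (sfB HB (Brs bi) Bc))/eqP; rewrite subr_eq0 => /eqP.
      by move: crs; rewrite cb mem_rem_uniq // inE eqxx.
    exists w, g; split=> //; have g0 := nz g ng.
    by apply: (mulIf g0); rewrite mulfVK // mulrAC E mulrAC mulfV // mul1r.
  have [c [Bc [w Aw zE]]] := gen_x (IA z Iz).
  have c0 : \sum_i c i * b i = 0.
    apply: BI; first by apply: (sf_sum HB) => i _; apply: (sfM HB) => //; case: (bP i) => /Brs.
    have -> : \sum_i c i * b i = z - pi * w - \sum_i c i * (x i - b i).
      by rewrite zE addrK -sumrB; apply: eq_bigr => i _; ring.
    apply: (IB); first by apply: (IB) => //; rewrite mulrC; apply: (IM).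
    elim/big_rec: _ => // i y _ Iy; apply: (ID) => //; apply: (IM); first exact: sBA.
    by case: (bP i).
  have -> : z / pi = \sum_i c i * ((x i - b i) / pi) + w.
    rewrite zE mulrDl mulrAC mulfV // mul1r; congr (_ + _).
    have -> : \sum_i c i * x i = \sum_i c i * (x i - b i).
      rewrite -[LHS]subr0 -[X in _ - X]c0 -sumrB; apply: eq_bigr => i _; by rewrite mulrBr.
    by rewrite mulr_suml; apply: eq_bigr => i _; rewrite mulrA.
  by apply: (DD); [apply: (sr_sum HD) => i _; apply: (DM) => //; apply/AD/sBA|exact: AD].
(* Induction on k: if the numerator of z lies in [I], then z / pi is still in [D] and divides
   pi^(k-1); otherwise z is a unit. *)
have Dunit k : forall z w, D z -> z != 0 -> D w -> z * w = pi ^+ k ->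
    exists u (e : nat), unit_of D u /\ z = u * pi ^+ e.
  elim: k => [|k IH] z w Dz z0 Dw zw.
    exists z, 0%N; rewrite expr0 mulr1; split=> //; split=> //.
    by rewrite -[z^-1]mulr1 -(expr0 pi) -zw mulKf.
  case: (Dz) => a [y [Aa Ay ny zE]]; case: (pselect (I a)) => [Ia|nIa].
    have [||||u [e [Du zuE]]] := IH (z / pi) w => //.
    - rewrite zE mulrAC; apply: (DM); first exact: Ires.
      exact: Dinv.
    - by rewrite mulf_neq0 ?invr_eq0.
    - by rewrite mulrAC zw exprS mulrAC mulfV // mul1r.
    - by exists u, e.+1; rewrite exprSr mulrA -zuE mulfVK.
  exists z, 0%N; rewrite expr0 mulr1; split=> //; split=> //.
  by rewrite zE invf_div; exists y, a.
exists D; split=> //.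
- by move=> z Az z0; have [w [k [Aw zw]]] := divides Az z0; apply: Dunit zw => //; apply: AD.
(* These two facts about [I0] serve to tell apart the primes obtained from two different ideals. *)
- split=> [z I0z z0|z c Az Bc c0 I0z]; first by apply: noninv => //; apply: sI.
  apply: Dinv => // Iz; move/eqP: c0; apply; apply: BI => //.
  by rewrite -[c](subKr z); apply: (IB) => //; apply: sI.
Qed.
End Localization.

Lemma quot_field_subfield (L : fieldType) (R : L -> Prop) : is_subring R -> is_subfield (quot_field R).
Proof.
move=> HR; split; first split.
- by exists 1, 1; split; [exact: sr1|exact: sr1|exact: oner_neq0|rewrite divr1].
- move=> _ _ [a [b [Ra Rb b0 ->]]] [c [e [Rc Re e0 ->]]]; split.
    exists (a * e - c * b), (b * e); split; [|exact: srM|exact: mulf_neq0|by field; rewrite b0 e0].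
    by apply: (srB HR); apply: (srM HR).
  by exists (a * c), (b * e); split; [exact: srM|exact: srM|exact: mulf_neq0|rewrite invfM mulrACA].
- move=> _ [a [b [Ra Rb b0 ->]]] ab0; exists b, a; split=> //; last by rewrite invf_div.
  by apply: contraNneq ab0 => ->; rewrite mul0r.
Qed.

(** * The numerical argument *)

Section Arithmetic.
Variables (p s delta : nat) (q d : nat -> nat) (sep : nat -> Prop).
Hypotheses (p1 : (1 < p)%N) (s0 : (0 < s)%N) (delta0 : (0 < delta)%N).
Hypothesis sum_le : forall N, (\sum_(a < N) q a <= delta)%N.
Hypothesis sum_ge : exists N, (delta <= \sum_(a < N) q a)%N.
Hypothesis qrec : forall a, exists k, (2 * q a = (p - 1) * d a.+1 * k + 2 * p * q a.+1)%N.
Hypothesis dstep : forall a, (d a.+1 = d a.+2 \/ d a.+1 = p * d a.+2)%N.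
Hypothesis dpos : forall a, (0 < d a)%N.
Hypothesis sep_stable : forall a, q a = 0%N -> d a.+1 = d a -> sep a.
Hypothesis sep_mono : forall a b, (a <= b)%N -> sep a -> sep b.
Hypothesis sep_d : forall a, sep a -> d a = s.

Lemma sum_eventually_zero : exists J, [/\ (0 < q J)%N, forall a, (J < a)%N -> q a = 0%N &
  delta = (\sum_(a < J.+1) q a)%N].
Proof.
have [N geN] := sum_ge.
have q0 a : (N <= a)%N -> q a = 0%N.
  move=> Na; have := sum_le a.+1; rewrite big_ord_recr /=.
  have : (\sum_(i < N) q i <= \sum_(i < a) q i)%N.
    by rewrite -(big_mkord xpredT) -(big_mkord xpredT q) (big_cat_nat (leq0n N) Na) //= leq_addr.
  by move/(leq_trans geN) => le1 le2; apply/eqP; rewrite -leqn0 -(leq_add2l (\sum_(i < a) q i)) addn0 (leq_trans le2).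
have sumN : delta = (\sum_(a < N) q a)%N by apply/eqP; rewrite eqn_leq geN sum_le.
have exq : exists a, (0 < q a)%N.
  apply: contrapT => nex; move: delta0; rewrite sumN big1 // => i _.
  by apply/eqP; rewrite -leqn0 leqNgt; apply/negP => H; apply: nex; exists i.
have bq a : (0 < q a)%N -> (a <= N)%N.
  by move=> qa; case: (leqP a N) => // /ltnW/q0 H; rewrite H in qa.
case: (ex_maxnP exq bq) => J qJ maxJ.
have qz a : (J < a)%N -> q a = 0%N.
  by move=> Ja; apply/eqP; rewrite -leqn0 leqNgt; apply/negP => /maxJ; rewrite leqNgt Ja.
exists J; split=> //.
have JN : (J.+1 <= N)%N by rewrite ltnNge; apply/negP => /q0 H; rewrite H in qJ.
rewrite sumN -(big_mkord xpredT) (big_cat_nat (leq0n J.+1) JN) //= big_mkord.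
by rewrite [X in (_ + X)%N]big_nat [X in (_ + X)%N]big1 ?addn0 // => i /andP[/qz].
Qed.

Lemma geometric_sum n : ((p - 1) * (\sum_(0 <= k < n) p ^ k) + 1 = p ^ n)%N.
Proof.
elim: n => [|n IH]; first by rewrite big_nil muln0.
by rewrite big_nat_recr //= mulnDr addnAC IH expnS mulnBl mul1n addnC subnK // leq_pmull // ltnW.
Qed.

Lemma shifted_geometric m n :
  (\sum_(m <= k < m + n) p ^ k = p ^ m * \sum_(0 <= k < n) p ^ k)%N.
Proof.
rewrite -{1}[m]add0n [(m + n)%N]addnC big_addn addnK big_distrr /=.
by apply: eq_bigr => i _; rewrite expnD mulnC.
Qed.

(* [J] counts the levels up to the last nonzero [q], [d J = p ^ m * s], and [U] is the sum of
   the integers [u a] given by [2 * q a = (p - 1) * d J * u a], which satisfy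
   [u a >= p * u a.+1]. *)
Lemma inseparable_bounds : exists m J U,
  [/\ (0 < J)%N, (\sum_(0 <= k < J) p ^ k <= U)%N, (2 * delta = (p - 1) * s * (p ^ m * U))%N &
      forall n, ~ sep n -> (n < J + m)%N].
Proof.
have p0 : (0 < p)%N by exact: ltnW.
have [j [qj qz dE]] := sum_eventually_zero.
have stepJ a : (j < a)%N -> ~ sep a -> d a = (p * d a.+1)%N.
  case: a => // a ja nsep; case: (dstep a) => // H.
  by exfalso; apply: nsep; apply: sep_stable; [apply: qz|].
(* Otherwise the positive number [d j.+1] would be divisible by every power of p. *)
have exs : exists m, `[< sep (j.+1 + m) >].
  apply: contrapT => nex.
  have nsep m : ~ sep (j.+1 + m) by move=> H; apply: nex; exists m; apply/asboolP.
  have dm m : d j.+1 = (p ^ m * d (j.+1 + m))%N.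
    elim: m => [|m IH]; first by rewrite mul1n addn0.
    by rewrite IH stepJ //; [rewrite expnSr mulnA addnS|lia].
  have := ltn_expl (d j.+1) p1; rewrite ltnNge => /negP; apply.
  by rewrite [leqRHS](dm (d j.+1)) leq_pmulr.
case: (ex_minnP exs) => m /asboolP sepm minm.
have nsep i : (i < m)%N -> ~ sep (j.+1 + i).
  by move=> im /asboolP/minm; rewrite leqNgt im.
have dJ : d j.+1 = (p ^ m * s)%N.
  rewrite -(sep_d sepm); suff H i : (i <= m)%N -> d j.+1 = (p ^ i * d (j.+1 + i))%N by exact: H.
  elim: i => [|i IH] im; first by rewrite mul1n addn0.
  rewrite IH 1?ltnW // stepJ; [by rewrite expnSr mulnA addnS|lia|exact: nsep].
have dmul i : (i <= j)%N -> exists c, d (j - i).+1 = (c * d j.+1)%N.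
  elim: i => [|i IH] ij; first by exists 1%N; rewrite subn0 mul1n.
  have [c cE] := IH (ltnW ij); have E : ((j - i.+1).+2 = (j - i).+1)%N by lia.
  case: (dstep (j - i.+1)); rewrite E cE => ->; first by exists c.
  by exists (p * c)%N; rewrite mulnA.
have qmul i : (i <= j)%N -> exists2 u, (2 * q (j - i) = (p - 1) * d j.+1 * u)%N & (p ^ i <= u)%N.
  elim: i => [|i IH] ij.
    rewrite subn0; have [k kE] := qrec j; rewrite (qz j.+1) // muln0 addn0 in kE.
    exists k => //; rewrite expn0 lt0n; apply/eqP => k0; rewrite k0 in kE; lia.
  have [u uE pu] := IH (ltnW ij); have [k kE] := qrec (j - i.+1).
  have [c cE] := dmul i.+1 ij; have E : ((j - i.+1).+1 = j - i)%N by lia.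
  rewrite E in kE cE; rewrite cE in kE.
  exists (c * k + p * u)%N; last by rewrite expnS; nia.
  rewrite kE (_ : 2 * p * q (j - i) = p * (2 * q (j - i)))%N; first by rewrite uE; ring.
  by ring.
have [U UE] : exists u : 'I_j.+1 -> nat, forall i : 'I_j.+1,
    (2 * q (j - i) = (p - 1) * d j.+1 * u i)%N /\ (p ^ i <= u i)%N.
  have H (i : 'I_j.+1) : exists u, (2 * q (j - i) = (p - 1) * d j.+1 * u)%N /\ (p ^ i <= u)%N.
    by have [|u] := qmul i; [rewrite -ltnS|exists u].
  by have [u uP] := choice H; exists u.
exists m, j.+1, (\sum_i U i)%N; split=> //.
- by rewrite big_mkord; apply: leq_sum => i _; case: (UE i).
- have -> : ((p - 1) * s * (p ^ m * \sum_i U i) = (p - 1) * d j.+1 * \sum_i U i)%N.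
    by rewrite dJ; ring.
  rewrite big_distrr /= dE big_distrr /= (reindex_inj rev_ord_inj) /=.
  by apply: eq_bigr => i _; rewrite subSS; case: (UE i) => <-.
- move=> n nsn; rewrite ltnNge; apply/negP => H; apply: nsn; exact: sep_mono sepm.
Qed.

Lemma separable_large n : (2 * delta + s <= s * p ^ n)%N -> sep n.
Proof.
move=> H; apply: contrapT => nsep.
have [m [J [U [J0 GU dE nsepb]]]] := inseparable_bounds.
have nJ := nsepb n nsep; have gJ := geometric_sum J.
have le1 : (p ^ n * p <= p ^ m * p ^ J)%N by rewrite -expnSr -expnD leq_exp2l // addnC.
have le2 : (p ^ m * p <= p ^ m * p ^ J)%N by rewrite leq_mul2l -(prednK J0) expnS leq_pmulr ?orbT // expn_gt0 ltnW.
have le3 : (s * (p ^ m * p ^ J) + s <= s * p ^ n + s * p ^ m)%N.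
  rewrite -gJ mulnDr mulnDr muln1; move: H; rewrite dE.
  have : ((p - 1) * s * (p ^ m * \sum_(0 <= k < J) p ^ k) <= (p - 1) * s * (p ^ m * U))%N.
    by rewrite !leq_mul2l GU !orbT.
  have -> : ((p - 1) * s * (p ^ m * \sum_(0 <= k < J) p ^ k) =
    s * (p ^ m * ((p - 1) * \sum_(0 <= k < J) p ^ k)))%N by ring.
  lia.
have {}le3 : (p ^ m * p ^ J + 1 <= p ^ n + p ^ m)%N.
  by rewrite -(leq_pmul2l s0) !mulnDr muln1.
(* Now y + 1 <= x + z, while x and z are at most y / p <= y / 2. *)
move: le1 le2 le3; move: (p ^ n)%N (p ^ m * p ^ J)%N (p ^ m)%N => x y z.
nia.
Qed.

Lemma separable_large_strict n :
  ~ (exists j i, (j <= i)%N /\ (2 * delta = (p - 1) * s * \sum_(j <= k < i.+1) p ^ k)%N) ->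
  (2 * delta + s <= s * p ^ n.+1)%N -> sep n.
Proof.
move=> ncons H; apply: contrapT => nsep.
have [m [J [U [J0 GU dE nsepb]]]] := inseparable_bounds.
have nJ := nsepb n nsep; have gJ := geometric_sum J.
(* Equality would express 2 delta / ((p - 1) s) as p^m + ... + p^(m+J-1), which is excluded. *)
have {}GU : (\sum_(0 <= k < J) p ^ k < U)%N.
  rewrite ltn_neqAle GU andbT; apply/eqP => UE; apply: ncons.
  exists m, (m + J.-1)%N; split; first exact: leq_addr.
  by rewrite -addnS prednK // shifted_geometric UE.
have le1 : (p ^ n.+1 <= p ^ m * p ^ J)%N by rewrite -expnD leq_exp2l // addnC.
have le3 : (s * (p ^ m * p ^ J) + s * (p ^ m * (p - 1)) + s <= s * p ^ n.+1 + s * p ^ m)%N.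
  rewrite -gJ !mulnDr muln1; move: H; rewrite dE.
  have : ((p - 1) * s * (p ^ m * (\sum_(0 <= k < J) p ^ k).+1) <= (p - 1) * s * (p ^ m * U))%N.
    by rewrite !leq_mul2l GU !orbT.
  have -> : ((p - 1) * s * (p ^ m * (\sum_(0 <= k < J) p ^ k).+1) =
    s * (p ^ m * ((p - 1) * \sum_(0 <= k < J) p ^ k)) + s * (p ^ m * (p - 1)))%N by ring.
  lia.
have {}le3 : (p ^ m * p ^ J + p ^ m * (p - 1) + 1 <= p ^ n.+1 + p ^ m)%N.
  by rewrite -(leq_pmul2l s0) !mulnDr muln1.
(* The additional unit in U contributes z (p - 1) >= z, so y + 1 <= x, against x <= y. *)
move: le1 le3; move: (p ^ n.+1)%N (p ^ m * p ^ J)%N (p ^ m)%N => x y z.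
nia.
Qed.

End Arithmetic.

Lemma dim_mod_le (L : fieldType) (P K M : L -> Prop) d n (y : 'I_n -> L) :
  K 0 -> dim_mod P K M d -> (forall i, P (y i)) -> indep_mod K M y -> (n <= d)%N.
Proof.
move=> K0 [_ maxd] Py fy; rewrite leqNgt; apply/negP => ltdn.
apply: (maxd (fun i => y (widen_ord ltdn i))) => // c Kc Mc i.
pose e (j : 'I_n) := if insub (val j) is Some i then c i else 0.
have eE k : e (widen_ord ltdn k) = c k by rewrite /e /= valK.
rewrite -eE; apply: fy => [j|]; first by rewrite /e; case: insub.
have -> : \sum_j e j * y j = \sum_k c k * y (widen_ord ltdn k).
  rewrite (bigID (fun j : 'I_n => (j < d.+1)%N)) /= [X in _ + X]big1 ?addr0; last first.
    by move=> j nj; rewrite /e insubF ?mul0r //; apply/negbTE.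
  rewrite (big_ord_narrow ltdn); apply: eq_bigr => k _; by rewrite eE.
by [].
Qed.

(** * The chain of Frobenius pullbacks *)

Section Chain.
Variables (L : closedFieldType) (p : nat) (K F : L -> Prop) (t : L) (v : L -> int).
Hypotheses (pchL : p \in [pchar L]) (HK : is_subfield K) (HF : is_subfield F).
Hypotheses (sKF : forall x, K x -> F x) (Ft : F t) (trt : ~ algebraic_over K t).
Hypothesis sepF : forall x, F x -> separable_over (ratfun_field K t) x.
Hypothesis finF : fin_gen (ratfun_field K t) F.
Hypothesis finFx : forall x, F x -> ~ K x -> fin_gen (ratfun_field K x) F.
Hypothesis algK : forall x, F x -> Kbar K x -> K x.
Hypotheses (Hv : is_valuation F v) (K0 : forall x, K x -> vge v 0 x).
Variable pi : L.
Hypotheses (Fpi : F pi) (pi0 : pi != 0) (vpi : v pi = 1).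

Local Notation Fa a := (frob_span p K a F).
Local Notation O := (ball v F 0).
Local Notation Oa a := (ball v (Fa a) 0).
Local Notation ma a := (ball v (Fa a) 1).

Let p_pr : prime p := pcharf_prime pchL.
Let p0 : (0 < p)%N. Proof. exact: prime_gt0. Qed.
Let HFa a : is_subfield (Fa a) := Fa_field pchL HK HF sKF a.
Let FaF a x : Fa a x -> F x.
Proof. exact: Fa_sub. Qed.
Let KFa a x : K x -> Fa a x.
Proof. exact: Fa_K. Qed.
Let PF b (I : finType) (f : I -> L) : (forall i, F (f i)) ->
  free_mod K (@zero_only L) f -> free_mod K (@zero_only L) (fun i => f i ^+ (p ^ b)).
Proof. exact: (pow_free pchL HK HF trt sepF finF). Qed.
Let KFree (I : finType) (f : I -> L) : (forall i, F (f i)) ->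
  free_mod K (@zero_only L) f -> free_mod (Kbar K) (@zero_only L) f.
Proof. exact: (Kbar_free pchL HK HF sKF algK PF). Qed.
Let ORing : is_subring O := ball_ring HF Hv HF (fun _ H => H).
Let OaRing a : is_subring (Oa a) := ball_ring HF Hv (HFa a) (FaF (a := a)).
Let sK n a : subspace K (ball v (Fa a) n) :=
  ball_subspace Hv (HFa a) (FaF (a := a)) (KFa a) K0 n.

Lemma pow_ball a b x : Oa a x -> Oa (a + b) (x ^+ (p ^ b)).
Proof.
move=> [Fx x0]; split; first exact: Fa_pow.
by apply: (vgeX HF Hv) => //; apply: FaF Fx.
Qed.

Lemma pow_ball1 a x : Oa a x -> Oa a.+1 (x ^+ p).
Proof. by move/(pow_ball 1); rewrite addn1 expn1. Qed.

Lemma O_Oa0 : Oa 0 = O.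
Proof. by rewrite frob_span0 //; apply: subring_subspace (sf_ring HF) sKF. Qed.

Lemma K_Oa a : forall x, K x -> Oa a x.
Proof. by move=> x Kx; split; [apply: KFa|apply: K0]. Qed.

Lemma frob_span_Oa a b : forall x, frob_span p K b (Oa a) x -> Oa (a + b) x.
Proof.
apply: span_prod_min; first by apply: subring_subspace => // x; apply: K_Oa.
by move=> _ [y [Oy ->]]; apply: pow_ball.
Qed.

Lemma frob_span_subspace b V : subspace K (frob_span p K b V).
Proof. exact: span_prod_subspace. Qed.

Lemma frob_span_O_le a b : forall x, frob_span p K (a + b) O x -> frob_span p K b (Oa a) x.
Proof.
move=> x; rewrite -frob_span_comp // -O_Oa0.
by apply: frob_span_mono => y; apply: frob_span_Oa.
Qed.

(** * Finiteness of the residue degrees *)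

Section ResidueDegree.

Lemma pi_notin_K : ~ K pi.
Proof.
move=> Kpi; have := K0 (sfV HK Kpi).
by rewrite vgeE ?invr_eq0 // (vV HF Hv) // vpi.
Qed.

(** In a relation with polynomial coefficients H_i(pi), the constant terms give a relation modulo
    the maximal ideal and so vanish; dividing by pi lowers the degree. Hence [F : K(pi)] bounds the
    residue degree. *)
Lemma residue_free n (x : 'I_n -> L) : (forall i, O (x i)) -> free_mod K (ball v F 1) x ->
  free_mod (ratfun_field K pi) (@zero_only L) x.
Proof.
move=> Ox fx c Kc; rewrite /zero_only => c0.
have KR := sf_ring HK.
have [G [b [KG Kb b0 GP]]] := common_denominator HK Kc.
have key m : forall H : 'I_n -> {poly L}, (forall i, poly_over K (H i)) ->
    (forall i, (size (H i) <= m)%N) -> \sum_i (H i).[pi] * x i = 0 -> forall i, H i = 0.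
  elim: m => [|m IH] H KH sH H0 i.
    by apply/eqP; rewrite -size_poly_leq0.
  pose H' i := \poly_(j < m) (H i)`_j.+1.
  have HE j : H j = H' j * 'X + ((H j)`_0)%:P.
    apply/polyP => l; rewrite coefD coefMX coefC coef_poly.
    case: l => [|l] /=; first by rewrite add0r.
    rewrite addr0; case: ltnP => // ml.
    by rewrite nth_default // (leq_trans (sH j)).
  have KH' j : poly_over K (H' j) by apply: poly_over_poly => // l; apply: KH.
  have OH' j : O (H' j).[pi].
    apply: (sr_horner ORing); last by split=> //; right; rewrite vpi.
    by move=> l; rewrite -O_Oa0; apply/K_Oa/KH'.
  have Hx j : (H j).[pi] = (H' j).[pi] * pi + (H j)`_0 by rewrite {1}HE !hornerE.
  have h0 j : (H j)`_0 = 0.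
    apply: (fx (fun j => (H j)`_0)) => [l|]; first exact: KH.
    have -> : \sum_j (H j)`_0 * x j = - (pi * \sum_j (H' j).[pi] * x j).
      apply/eqP; rewrite -addr_eq0 addrC mulr_sumr -big_split /= -[X in _ == X]H0.
      apply/eqP/eq_bigr => l _; rewrite Hx mulrDl; congr (_ + _).
      by rewrite mulrA [pi * _]mulrC.
    have OS : O (\sum_j (H' j).[pi] * x j) by apply: (sr_sum ORing) => l _; apply: srM.
    split; first by apply: sfN => //; apply: sfM => //; case: OS.
    apply: (vgeN HF Hv); first by apply: sfM => //; case: OS.
    rewrite -[1]addr0; apply: (vgeM Hv) => //; [by case: OS|by right; rewrite vpi|by case: OS].
  have H'0 : H' i = 0.
    apply: (IH H') => // [j|]; first exact: size_poly.
    apply: (mulfI pi0); rewrite mulr0 -[RHS]H0 mulr_sumr; apply: eq_bigr => j _.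
    by rewrite Hx h0 addr0 mulrA [pi * _]mulrC.
  by rewrite HE H'0 mul0r add0r h0.
have cG : forall i, G i = 0.
  apply: (key (\max_i size (G i))) => // [i|]; first exact: leq_bigmax.
  apply: (mulIf (x := b.[pi]^-1)); first by rewrite invr_eq0.
  rewrite mul0r -[RHS]c0 mulr_suml; apply: eq_bigr => i _.
  by rewrite GP mulrAC.
by move=> i; rewrite GP cG horner0 mul0r.
Qed.

Lemma residue_bound : exists D, forall n (x : 'I_n -> L), (forall i, O (x i)) ->
  free_mod K (ball v F 1) x -> (n <= D)%N.
Proof.
have [D [e ge]] := finFx Fpi pi_notin_K; exists D => n x Ox fx.
have fr := residue_free Ox fx.
have := steinitz (ratfun_subfield HK pi) (subspace_zero _) ge _ fr.
by rewrite !card_ord; apply=> i; case: (Ox i).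
Qed.

Lemma residue_degree : exists d : nat -> nat, forall a, dimq K (Oa a) (ma a) (d a).
Proof.
have [D bD] := residue_bound.
suff H a : exists d, dimq K (Oa a) (ma a) d by have [d dP] := choice H; exists d.
have [||d _ dP] := @dimq_bounded _ _ HK (Oa a) (ma a) D; last by exists d.
  exact: sK.
move=> n y Oy fy; apply: (bD n y) => [i|]; first by case: (Oy i) => /FaF.
move=> c Kc [_ c1]; apply: fy => //; split=> //.
by apply: (sf_sum (HFa a)) => i _; apply: (sfM (HFa a)); [apply: KFa|case: (Oy i)].
Qed.

End ResidueDegree.

(** * The sums of the q_a are bounded by delta *)

Section SingularityDegree.
Variable delta : nat.
Hypothesis sing : geom_sing_deg K F O delta.

Let BK := Kbar_subfield HK.

Lemma proot_Kbar b x : Kbar K (x ^+ (p ^ b)) -> Kbar K x.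
Proof.
move=> Kx; have BR := sf_ring BK; apply: (Kbar_closed HK).
have q0 : (0 < p ^ b)%N by rewrite expn_gt0 p0.
exists ('X^(p ^ b) - (x ^+ (p ^ b))%:P); split.
  by rewrite -size_poly_gt0 size_XnsubC.
split; last by rewrite rootE !hornerE subrr.
by apply: (poly_overB BR); [apply/(poly_overXn BR)/(poly_overX BR)|apply: (poly_overC BR)].
Qed.

Lemma Kbar_field_span x : span_prod (Kbar K) F x -> Kbar_field K F x.
Proof.
move=> Sx; exists x, 1; split=> //; rewrite ?oner_eq0 ?divr1 //.
by apply: span_prod_subr; [apply: sf1|apply: sf1].
Qed.

(** Roots of the coefficients from [K] exist in Kbar, and the other factors are already p^N-th
    powers of elements of [F]. *)
Lemma Kbar_span_proot N x y : Fa N x -> y ^+ (p ^ N) = x -> span_prod (Kbar K) F y.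
Proof.
move=> [m [k [u [Kk Fu xE]]]] yx.
have [g gP] := choice Fu; have [r rP] := choice (fun l => proot pchL (k l) N).
have -> : y = \sum_l r l * g l.
  apply: (pow_inj pchL (b := N)); rewrite yx xE (pow_sum pchL).
  by apply: eq_bigr => l _; rewrite exprMn rP; case: (gP l) => _ ->.
apply: span_prod_fin => l; last by case: (gP l).
by apply: (proot_Kbar (b := N)); rewrite rP; apply: (Kbar_sub HK).
Qed.

(* Taking [p ^ N]-th roots turns elements that are independent modulo [K[O^(p^N)]] into
   elements of the integral closure of [Kbar O] that are independent modulo [Kbar O],
   because [F] and [Kbar K] are linearly disjoint. *)
Lemma sing_bound N n (x : 'I_n -> L) : (forall i, Oa N (x i)) ->
  free_mod K (frob_span p K N O) x -> (n <= delta)%N.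
Proof.
move=> Ox fx; have [y yP] := choice (fun i => proot pchL (x i) N).
have q0 : (0 < p ^ N)%N by rewrite expn_gt0 p0.
have BRing : is_subring (Kbar_ring K O) by apply: span_prod_ring => //; apply: sf_ring BK.
apply: (dim_mod_le (y := y) (sf0 BK) sing) => [i|c Bc Oc i].
  split.
    by apply/Kbar_field_span/(Kbar_span_proot _ (yP i)); case: (Ox i).
  exists ('X^(p ^ N) - (x i)%:P); split.
  - by rewrite monicXnsubC.
  - apply: (poly_overB BRing); first exact/(poly_overXn BRing)/(poly_overX BRing).
    apply: (poly_overC BRing); apply: span_prod_subr; first exact: sf1.
    by case: (Ox i) => /FaF.
  - by rewrite rootE !hornerE yP subrr.
have W := frob_span_subspace N O.
have WF z : frob_span p K N O z -> F z.
  rewrite -O_Oa0 => /frob_span_Oa[]; by move/FaF.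
(* With b = 0 this is plain base change from [K] to Kbar, by linear disjointness. *)
have fK := free_mod_frob pchL HK (b := 0) (K' := Kbar K) (F := F) _ BK _ W WF _ fx.
apply: (pow_inj pchL (b := N)); rewrite (pow0 pchL).
apply: (fK _ _ _ (fun j => c j ^+ (p ^ N)) _ _ i) => [k|I f Ff ff|j|j|].
- by move/(Kbar_sub HK); rewrite expn0 expr1.
- by under eq_fun do rewrite expn0 expr1; apply: KFree.
- by case: (Ox j) => /FaF.
- exact: sfX.
case: Oc => m [b [o [Bb Oo cE]]].
have -> : \sum_j c j ^+ (p ^ N) * x j ^+ (p ^ 0) = (\sum_j c j * y j) ^+ (p ^ N).
  by rewrite (pow_sum pchL); apply: eq_bigr => j _; rewrite exprMn yP expn0 expr1.
rewrite cE (pow_sum pchL); under eq_bigr do rewrite exprMn.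
apply: span_prod_fin => j; first exact: sfX.
exists (o j ^+ (p ^ N)); rewrite expn0 expr1; split=> //.
by apply: frob_span_pow => //; apply: sf1.
Qed.

Lemma frob_span_O_sub a : forall x, frob_span p K a.+1 O x -> frob_span p K 1 (Oa a) x.
Proof. by rewrite -addn1 => x; apply: frob_span_O_le. Qed.

Lemma sing_step : exists q : nat -> nat, forall a,
  dimq K (Oa a.+1) (frob_span p K 1 (Oa a)) (q a).
Proof.
suff H a : exists d, dimq K (Oa a.+1) (frob_span p K 1 (Oa a)) d.
  by have [q qP] := choice H; exists q.
have [||d _ dP] := @dimq_bounded _ _ HK (Oa a.+1) (frob_span p K 1 (Oa a)) delta; last by exists d.
  exact: frob_span_subspace.
move=> n y Oy fy; apply: (sing_bound Oy); apply: free_mod_sub fy.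
exact: frob_span_O_sub.
Qed.

(** K[O_N^p] lies between K[O^(p^(N+1))] and O_{N+1}. The lower quotient is the Frobenius transform
    of O_N / K[O^(p^N)] and has the same dimension by [dimq_frob]. *)
Lemma sing_sum q : (forall a, dimq K (Oa a.+1) (frob_span p K 1 (Oa a)) (q a)) ->
  forall N, dimq K (Oa N) (frob_span p K N O) (\sum_(a < N) q a).
Proof.
move=> qP; elim=> [|N IH].
  rewrite big_ord0 O_Oa0 frob_span0 //; last by apply: subring_subspace => // x /K_Oa-/(_ 0); rewrite O_Oa0.
  by apply: dimq_refl => //; apply: subring_subspace => // x /K_Oa-/(_ 0); rewrite O_Oa0.
rewrite big_ord_recr /= addnC.
have e : frob_span p K N.+1 O = frob_span p K 1 (frob_span p K N O) by rewrite frob_span_comp // addn1.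
apply: (dimq_add (W := frob_span p K 1 (Oa N)) HK) => //.
- exact: frob_span_subspace.
- exact: frob_span_subspace.
- by move=> z /frob_span_Oa; rewrite addn1.
- exact: frob_span_O_sub.
- rewrite e; apply: (dimq_frob pchL HK (F := F) (b := 1)) => //.
  + by move=> J f; apply: PF.
  + exact: frob_span_subspace.
  + by move=> z; rewrite -O_Oa0 => /frob_span_Oa[/FaF].
  + by move=> z [/FaF].
Qed.

Lemma sing_sum_le q : (forall a, dimq K (Oa a.+1) (frob_span p K 1 (Oa a)) (q a)) ->
  forall N, (\sum_(a < N) q a <= delta)%N.
Proof.
move=> qP N; have [x [Ox fx _]] := dimq_ord (sing_sum qP N).
exact: sing_bound Ox fx.
Qed.

End SingularityDegree.

(** * Levels a with q_a = 0 *)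

Section Stability.

(** Each residue is a polynomial over [K] in its p-th power. In this form separability passes at
    once to the smaller rings O_b with b >= a. *)
Definition separable_level a :=
  forall x, Oa a x -> exists2 h, poly_over K h & vge v 1 (x - h.[x ^+ p]).

Lemma Oa_anti a b : (a <= b)%N -> forall x, Oa b x -> Oa a x.
Proof.
move=> /subnKC <-; elim: (b - a)%N => [|n IH] x; first by rewrite addn0.
rewrite addnS => -[Fx x0]; apply: IH; split=> //.
exact: (Fa_anti pchL HK HF sKF).
Qed.

Lemma separable_level_mono a b : (a <= b)%N -> separable_level a -> separable_level b.
Proof. by move=> ab sa x /(Oa_anti ab)/sa. Qed.

Lemma Fa_succ_pow a x : Fa a x -> Fa a.+1 (x ^+ p).
Proof. by move=> Fx; have := Fa_pow pchL HK 1 Fx; rewrite addn1 expn1. Qed.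

Lemma val_K c : K c -> c != 0 -> v c = 0.
Proof.
move=> Kc c0; have := K0 Kc; have := K0 (sfV HK Kc).
by rewrite !vgeE ?invr_eq0 // (vV HF Hv) //; [lia|exact: sKF].
Qed.

Lemma vge_pow n m x : F x -> (0 < m)%N -> 0 <= n -> vge v n x -> vge v n (x ^+ m).
Proof.
move=> Fx m0 n0 nx; rewrite -(prednK m0) exprS mulrC; apply: (vge0M Hv) => //.
  exact: sfX.
by apply: (vgeX HF Hv) => //; apply: vge_le nx.
Qed.

Lemma residue_pow_gen a (I : finType) (e : I -> L) :
  (forall x, Oa a.+1 x -> frob_span p K 1 (Oa a) x) ->
  gen_mod K (ma a) e (Oa a) -> (forall i, Oa a (e i)) ->
  gen_mod K (ma a.+1) (fun i => e i ^+ p) (Oa a.+1).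
Proof.
move=> stab ge Oe y Oy; have [m [k [w [Kk Ow yE]]]] := stab y Oy.
have [z zP] := choice Ow.
have [c cP] := choice (fun l => ge _ (proj1 (zP l))).
pose r l := z l - \sum_i c l i * e i.
exists (fun i => \sum_l k l * c l i ^+ p); split=> [i|].
  by apply: sf_sum => // l _; apply: sfM => //; apply: sfX => //; case: (cP l).
have -> : y - \sum_i (\sum_l k l * c l i ^+ p) * e i ^+ p = \sum_l k l * r l ^+ p.
  rewrite yE; under [X in _ - X]eq_bigr do rewrite mulr_suml.
  rewrite exchange_big -sumrB; apply: eq_bigr => l _ /=.
  have [_ ->] := zP l; rewrite -[in RHS](expn1 p) /r (powB pchL) (pow_sum pchL) mulrBr !expn1.
  congr (_ - _); rewrite mulr_sumr; apply: eq_bigr => i _.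
  by rewrite exprMn mulrA.
apply: (subspace_sum _ (sK 1 a.+1)) => l _; case: (sK 1 a.+1) => _ _; apply=> //.
have [Kc [Fr r1]] := cP l; have Fr' := FaF Fr; split.
  exact: Fa_succ_pow.
exact: vge_pow.
Qed.

(** For a basis the p-th powers generate by [residue_pow_gen] and are as many as the dimension. For
    any free family, the matrix of coordinates has independent rows over [K], hence over [L], where
    p-th roots of the coefficients of a relation exist. *)
Lemma residue_pow_free a d :
  (forall x, Oa a.+1 x -> frob_span p K 1 (Oa a) x) ->
  dimq K (Oa a) (ma a) d -> dimq K (Oa a.+1) (ma a.+1) d ->
  forall (I : finType) (x : I -> L), (forall i, Oa a (x i)) -> free_mod K (ma a) x ->
  free_mod K (ma a.+1) (fun i => x i ^+ p).
Proof.
move=> stab da da1 I x Ox fx; have [e [Oe fe ge]] := dimq_ord da.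
have fep : free_mod K (ma a.+1) (fun j => e j ^+ p).
  apply: (gen_dimq_free HK (sK 1 a.+1) (V := Oa a.+1)); first by rewrite card_ord.
  exact: residue_pow_gen.
have [c cP] := choice (fun i => ge _ (Ox i)).
move=> b Kb b1 i; have [g gP] := choice (fun i => proot pchL (b i) 1).
have bc j : \sum_i b i * c i j ^+ p = 0.
  apply: (fep (fun j => \sum_i b i * c i j ^+ p)) => [k|].
    by apply: sf_sum => // l _; apply: sfM => //; apply: sfX => //; case: (cP l).
  have -> : \sum_j (\sum_i b i * c i j ^+ p) * e j ^+ p =
      \sum_i b i * x i ^+ p - \sum_i b i * (x i - \sum_j c i j * e j) ^+ p.
    rewrite -sumrB; under eq_bigr do rewrite mulr_suml.
    rewrite exchange_big; apply: eq_bigr => l _ /=.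
    rewrite -[in RHS](expn1 p) (powB pchL) mulrBr subKr (pow_sum pchL) expn1 mulr_sumr.
    by apply: eq_bigr => j' _; rewrite exprMn mulrA.
  apply: (subspaceB HK (sK 1 a.+1)) => //.
  apply: (subspace_sum _ (sK 1 a.+1)) => l _; case: (sK 1 a.+1) => _ _; apply=> //.
  have [Kc [Fr r1]] := cP l; have Fr' := FaF Fr; split.
    exact: Fa_succ_pow.
  exact: vge_pow.
have gi0 : g i = 0.
  apply: (free_rows_ext HK (A := c)) => [k j|h Kh h0|j]; first by case: (cP k).
    apply: fx => //.
    have -> : \sum_k h k * x k = \sum_k h k * (x k - \sum_j c k j * e j).
      under [RHS]eq_bigr do rewrite mulrBr.
      rewrite sumrB [X in _ - X](_ : _ = 0) ?subr0 //.
      under eq_bigr do rewrite mulr_sumr.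
      rewrite exchange_big big1 //= => j _.
      by under eq_bigr do rewrite mulrA; rewrite -mulr_suml h0 mul0r.
    by apply: (subspace_lin (sK 1 a)) => // k; case: (cP k).
  apply: (pow_inj pchL (b := 1)); rewrite (pow_sum pchL) (pow0 pchL) -[RHS](bc j).
  by apply: eq_bigr => k _; rewrite exprMn gP expn1.
by rewrite -(gP i) gi0 (pow0 pchL).
Qed.

(* Stability makes [x] congruent to [h(x^p)] for some [h] over [K]; the polynomial
   [X - h(X^p)] has derivative 1, so the residue of [x] is separable over [K]. *)
Lemma separable_of_stable a d :
  (forall x, Oa a.+1 x -> frob_span p K 1 (Oa a) x) ->
  dimq K (Oa a) (ma a) d -> dimq K (Oa a.+1) (ma a.+1) d -> separable_level a.
Proof.
move=> stab da da1 x Ox.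
pose U z := exists2 g, poly_over K g & z = g.[x].
have UO z : U z -> Oa a z.
  by move=> [g Kg ->]; apply: (sr_horner (OaRing a)) => // i; apply: K_Oa.
have [|e _ /dimq_ord[u [Uu fu gu]]] := dimq_sub HK (sK 1 a) (sK 1 a) _ UO da; first by [].
have [g gP] : exists g : 'I_e -> {poly L}, forall j, poly_over K (g j) /\ u j = (g j).[x].
  have H j : exists f, poly_over K f /\ u j = f.[x] by have [f Kf uE] := Uu j; exists f.
  by have [g gP] := choice H; exists g.
have exg j : exists f, poly_over K f /\ (g j).[x] ^+ p = f.[x ^+ p].
  by have [f Kf fE] := frob_poly pchL HK (proj1 (gP j)); exists f.
have [g' g'P] := choice exg.
have upE j : u j ^+ p = (g' j).[x ^+ p].
  by case: (gP j) => _ ->; case: (g'P j).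
have fup : free_mod K (ma a) (fun j => u j ^+ p).
  have H := residue_pow_free stab da da1 (fun j => UO _ (Uu j)) fu.
  move=> c Kc [_ c1]; apply: H => //; split=> //.
  apply: (sf_sum (HFa a.+1)) => j _; apply: (sfM (HFa a.+1)); first exact: KFa.
  by have [Fu _] := UO _ (Uu j); apply: Fa_succ_pow.
have KR := sf_ring HK.
have Up j : U (u j ^+ p).
  exists (g' j \Po 'X^p); last by rewrite upE horner_comp hornerXn.
  by apply: poly_over_comp => //; [case: (g'P j)|apply/(poly_overXn KR)/(poly_overX KR)].
have dU : dimq K U (ma a) #|'I_e|.
  by rewrite card_ord; exists 'I_e, u; split; [rewrite card_ord|split].
have gup := free_dimq_gen HK (sK 1 a) dU Up fup.
have [c [Kc [_ c1]]] : exists c : 'I_e -> L, (forall j, K (c j)) /\ ma a (x - \sum_j c j * u j ^+ p).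
  by apply: gup; exists 'X; rewrite ?hornerX //; apply: poly_overX.
exists (\sum_j c j *: g' j).
  by apply: (poly_over_sum KR) => j _; apply: (poly_overZ KR) => //; case: (g'P j).
rewrite horner_sum; move: c1; congr (vge v 1 (x - _)).
by apply: eq_bigr => j _; rewrite hornerZ upE.
Qed.

Lemma Fa_value_group a : exists (eps : nat) (w : L),
  [/\ (0 < eps)%N, Fa a w, w != 0, v w = eps%:Z &
    forall x, Fa a x -> x != 0 -> (eps%:Z %| v x)%Z].
Proof.
apply: (value_group HF Hv (HFa a) (FaF (a := a))).
exists (pi ^+ (p ^ a)); split.
- by apply: frob_span_pow => //; apply: sf1.
- exact: expf_neq0.
- by rewrite (vX HF Hv) // vpi -mulr_natl mulr1 natz; have := expn_gt0 p a; rewrite p0; lia.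
Qed.

(** Let x = sum of k_l z_l^p, and split each z_l into a combination of the residue basis [e] and w
    r_l. Then x = S + w^p x', with S a combination of the e_i^p. If v(x) > 0, then S = 0 and the
    argument continues with x', of smaller value. *)
Lemma stable_values a d eps w :
  (forall x, Oa a.+1 x -> frob_span p K 1 (Oa a) x) ->
  dimq K (Oa a) (ma a) d -> dimq K (Oa a.+1) (ma a.+1) d ->
  (0 < eps)%N -> Fa a w -> w != 0 -> v w = eps%:Z ->
  (forall x, Fa a x -> x != 0 -> (eps%:Z %| v x)%Z) ->
  forall x, Oa a.+1 x -> x != 0 -> ((p * eps)%N%:Z %| v x)%Z.
Proof.
move=> stab da da1 eps0 Fw w0 vw epsP.
have [e [Oe fe ge]] := dimq_ord da.
have fep := residue_pow_free stab da da1 Oe fe.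
have Ow : Oa a w by split=> //; right; rewrite vw.
have Fw' := FaF Fw.
suff H n : forall x, Oa a.+1 x -> x != 0 -> v x < n%:Z -> ((p * eps)%N%:Z %| v x)%Z.
  by move=> x Ox x0; apply: (H (`|v x|.+1)%N) => //; lia.
elim: n => [|n IH] x Ox x0 vx.
  by case: Ox => _ /(vgeE _ _ x0); lia.
have [vx0|vx0] := eqVneq (v x) 0; first by rewrite vx0 dvdz0.
have vx1 : vge v 1 x by right; case: Ox => _ /(vgeE _ _ x0); lia.
have [m [k [u [Kk Ou xE]]]] := stab x Ox.
have [z zP] := choice Ou; have [c cP] := choice (fun l => ge _ (proj1 (zP l))).
pose r l := (z l - \sum_i c l i * e i) / w.
have Or l : Oa a (r l).
  have [_ [Fr r1]] := cP l; split; first by apply: (sfM (HFa a)) => //; apply: (sfV (HFa a)).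
  have [r0|r0] := eqVneq (z l - \sum_i c l i * e i) 0; first by left; rewrite /r r0 mul0r.
  have Fr2 := FaF Fr; right; rewrite /r (vM Hv) ?invr_eq0 //; last exact: sfV.
  rewrite (vV HF Hv) // vw; move: r1; rewrite vgeE //.
  have /dvdzP[s ->] := epsP _ Fr r0 => s1.
  have : 1 <= s by rewrite leNgt; apply/negP => s0; nia.
  by nia.
pose S := \sum_i (\sum_l k l * c l i ^+ p) * e i ^+ p.
pose x' := \sum_l k l * r l ^+ p.
have xS : x = S + w ^+ p * x'.
  rewrite /S /x' xE mulr_sumr; under [X in X + _]eq_bigr do rewrite mulr_suml.
  rewrite exchange_big -big_split; apply: eq_bigr => l _ /=.
  have [_ ->] := zP l; rewrite mulrCA -exprMn /r [w * _]mulrC divfK //.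
  rewrite -[in RHS](expn1 p) (powB pchL) (pow_sum pchL) !expn1 mulrBr.
  rewrite [X in _ = X + _](_ : _ = k l * \sum_i (c l i * e i) ^+ p); last first.
    by rewrite mulr_sumr; apply: eq_bigr => i _; rewrite exprMn mulrA.
  by rewrite addrC subrK.
have Ox' : Oa a.+1 x'.
  apply: (sr_sum (OaRing a.+1)) => l _; apply: (srM (OaRing a.+1)); first exact: K_Oa.
  exact: pow_ball1.
have Owp := pow_ball1 Ow.
have wx'1 : vge v 1 (w ^+ p * x').
  rewrite mulrC; apply: (vge0M Hv); [by case: Ox' => /FaF|exact: sfX|by case: Ox'|].
  by apply: vge_pow => //; right; rewrite vw; lia.
(* S lies in the maximal ideal, and the e_i^p are free over [K] modulo it. *)
have S0 : S = 0.
  rewrite /S big1 // => i _.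
  rewrite (fep (fun i => \sum_l k l * c l i ^+ p) _ _ i) ?mul0r // => [j|].
    by apply: sf_sum => // l _; apply: sfM => //; apply: sfX => //; case: (cP l).
  have -> : \sum_i (\sum_l k l * c l i ^+ p) * e i ^+ p = x - w ^+ p * x'.
    by rewrite xS addrK.
  split; first by apply: (sfB (HFa a.+1)); [case: Ox|apply: (sfM (HFa a.+1)); [case: Owp|case: Ox']].
  apply: (vgeB HF Hv) => //; first by case: Ox => /FaF.
  by apply: sfM => //; [exact: sfX|case: Ox' => /FaF].
rewrite S0 add0r in xS.
have x'0 : x' != 0 by apply: contraNneq x0 => x'0; rewrite xS x'0 mulr0.
have wp0 : w ^+ p != 0 by exact: expf_neq0.
have Fx' : F x' by case: Ox' => /FaF.
have vxE : v x = (p * eps)%N%:Z + v x'.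
  by rewrite xS (vM Hv) ?(vX HF Hv) // ?vw; [rewrite -mulr_natl natz PoszM|exact: sfX].
rewrite vxE; apply: rpredD; first exact: dvdzz.
apply: IH => //; move: vx; rewrite vxE.
have : (0 < p * eps)%N by rewrite muln_gt0 p0.
by lia.
Qed.

End Stability.

(** * Absence of defect and the recurrence for q_a *)

Section LocalStructure.
Variable delta : nat.
Hypothesis sing : geom_sing_deg K F O delta.

(** Without an optimal element every error x - g can be approximated in turn with a gain of at least
    1 in value. *)
Lemma approx_of_no_optimal a : ~ (exists z, optimal (Fa a) (Fa a.+1) v z) ->
  forall n x, Oa a x -> exists2 g, Oa a.+1 g & vge v n%:Z (x - g).
Proof.
move=> nopt; elim=> [|n IH] x Ox.
  exists 0; first exact: (sr0 (OaRing a.+1)).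
  by rewrite subr0; case: Ox.
have [g Og xg] := IH x Ox.
have Oxg : Oa a (x - g) by apply: (srB (OaRing a)) => //; apply: Oa_anti Og.
have [Fxg|nFxg] := EM (Fa a.+1 (x - g)).
  exists x; last by rewrite subrr; left.
  by rewrite -[x](subrK g); apply: (srD (OaRing a.+1)) => //; split=> //; case: Oxg.
have [g' [Fg' H]] : exists g', Fa a.+1 g' /\ vge v (v (x - g) + 1) (x - g - g').
  apply: contrapT => ng; apply: nopt; exists (x - g); split=> //; first by case: Oxg.
  by move=> g' Fg' H; apply: ng; exists g'.
have xg0 : x - g != 0 by apply/eqP => xg0; apply: nFxg; rewrite xg0; apply: (sf0 (HFa a.+1)).
have nv : n%:Z <= v (x - g) by apply/(vgeE _ _ xg0).
have Fxg : F (x - g) by case: Oxg => /FaF.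
have Fg'2 := FaF Fg'.
have Og' : Oa a.+1 g'.
  split=> //; rewrite -[g'](subKr (x - g)); apply: (vgeB HF Hv) => //.
  - exact: sfB.
  - by case: Oxg.
  - by apply: vge_le H; lia.
exists (g + g'); first exact: (srD (OaRing a.+1)).
by rewrite opprD addrA; apply: vge_le H; lia.
Qed.

(* Otherwise [O_{N+1}], whose values are multiples of [p * eps], approximates every element of
   [K[O^(p^N)]] arbitrarily well, and the powers [w ^+ (p * i).+1] of a uniformizer [w] of [O_N]
   would be independent modulo [K[O^(p^N)]], against [sing_bound]. *)
Lemma exists_optimal a N d : (a <= N)%N ->
  (forall x, Oa N.+1 x -> frob_span p K 1 (Oa N) x) ->
  dimq K (Oa N) (ma N) d -> dimq K (Oa N.+1) (ma N.+1) d ->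
  exists z, optimal (Fa a) (Fa a.+1) v z.
Proof.
move=> aN stab dN dN1; apply: contrapT => /approx_of_no_optimal approx.
have [eps [w [eps0 Fw w0 vw epsP]]] := Fa_value_group N.
have vals := stable_values stab dN dN1 eps0 Fw w0 vw epsP.
have Fw' := FaF Fw.
have Ow : Oa N w by split=> //; right; rewrite vw.
pose b := (N - a)%N; have abN : (a + b = N)%N by rewrite /b subnKC.
have approx_span n x : frob_span p K b (Oa a) x -> exists2 g, Oa N.+1 g & vge v n%:Z (x - g).
  move=> [m [k [u [Kk Ou ->]]]]; have [z zP] := choice Ou.
  have exg l : exists g, Oa a.+1 g /\ vge v n%:Z (z l - g).
    by have [g Og zg] := approx n (z l) (proj1 (zP l)); exists g.
  have [g gP] := choice exg.
  exists (\sum_l k l * g l ^+ (p ^ b)).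
    apply: (sr_sum (OaRing N.+1)) => l _; apply: (srM (OaRing N.+1)); first exact: K_Oa.
    by have := pow_ball b (proj1 (gP l)); rewrite addSn abN.
  rewrite -sumrB; apply: (vge_sum HF Hv) => l _.
    have [[/FaF Fz _] uE] := zP l; have [[/FaF Fg _] _] := gP l.
    apply: sfB => //; apply: sfM => //; try exact: sKF; last exact: sfX.
    by rewrite uE; apply: sfX.
  have [[/FaF Fz _] ->] := zP l; have [[/FaF Fg _] zg] := gP l.
  rewrite -mulrBr -(powB pchL); apply: (vge0M Hv); [exact: sKF|exact: (sfX HF _ (sfB HF Fz Fg))|exact: K0|].
  by apply: vge_pow => //; [exact: sfB|rewrite expn_gt0 p0].
(* The values eps (p i + 1) are distinct and prime to divisibility by p eps, so they also differ
   from the value of any nonzero element of O_{N+1}. There is one element more than delta allows. *)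
pose x (i : 'I_delta.+1) := w ^+ (p * i).+1.
have Ox i : Oa N (x i) by apply: (srX (OaRing N)).
have vx i : v (x i) = (eps * (p * i).+1)%N%:Z.
  by rewrite (vX HF Hv) // vw -mulr_natl natz PoszM mulrC.
have x0 i : x i != 0 by exact: expf_neq0.
suff fx : free_mod K (frob_span p K N O) x by have := sing_bound sing Ox fx; rewrite ltnn.
move=> c Kc; rewrite -{1}abN => /frob_span_O_le.
(* This exceeds the values of all [x i], so a term c_i x_i of value at least n0 must vanish. *)
pose n0 := (eps * (p * delta).+1).+1.
case/(approx_span n0) => g Og Xg i.
have Fx j : F (x j) by exact: sfX.
pose z (o : option 'I_delta.+1) := if o is Some j then c j * x j else - g.
have Fg : F g by case: Og => /FaF.
have Fz o : F (z o) by case: o => [j|] /=; [apply: sfM => //; apply: sKF|apply: sfN].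
have vz j : c j * x j != 0 -> v (c j * x j) = (eps * (p * j).+1)%N%:Z.
  rewrite mulf_eq0 negb_or => /andP[cj xj].
  by rewrite (vM Hv) // ?(val_K _ cj) ?add0r ?vx //; apply: sKF.
have vgne j : g != 0 -> v (- g) = (eps * (p * j).+1)%N%:Z -> False.
  move=> g0; rewrite (vN HF Hv) // => vg; have := vals g Og g0.
  rewrite vg dvdzE !absz_nat [(p * eps)%N]mulnC dvdn_pmul2l // -addn1 dvdn_addr ?dvdn_mulr //.
  by rewrite dvdn1 => /eqP p1; move: p_pr; rewrite p1.
have := distinct_values HF Hv Fz (n := n0%:Z).
move=> /(_ _ _ (Some i)); rewrite /z; case.
- case=> [j|] [j'|] //=.
  + move=> H1 H2; rewrite !vz // => -[] /eqP; rewrite eqn_pmul2l // eqSS eqn_pmul2l // => /eqP e.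
    by congr Some; apply: val_inj.
  + by rewrite oppr_eq0 => H1 H2; rewrite vz // => /esym /vgne; case.
  + by rewrite oppr_eq0 => H1 H2; rewrite vz // => /vgne; case.
- by rewrite big_option /= addrC.
- by move/eqP; rewrite mulf_eq0 (negPf (x0 i)) orbF => /eqP.
have [->//|ci] := eqVneq (c i) 0.
have cx0 : c i * x i != 0 by rewrite mulf_neq0.
rewrite vz // => H; exfalso; move: H; rewrite /n0.
have : (eps * (p * i).+1 <= eps * (p * delta).+1)%N.
  by rewrite leq_mul2l ltnS leq_mul2l -ltnS ltn_ord !orbT.
by lia.
Qed.

Let sFa a : forall x, Fa a.+1 x -> Fa a x := Fa_anti pchL HK HF sKF (a := a).

(* Write [O_a = (+) O_{a+1} z^i] and [w = z^p].  In the chain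
   [K[O_a^p] = (+) K[O_{a+1}^p] w^i <= (+) O_{a+2} w^i <= O_{a+1}] the first quotient has
   dimension [p * q a.+1] and the second one is computed by [local_step]. *)
Lemma sing_recurrence a (q d : nat -> nat) :
  (forall a, dimq K (Oa a.+1) (frob_span p K 1 (Oa a)) (q a)) ->
  (forall a, dimq K (Oa a) (ma a) (d a)) ->
  (exists z, optimal (Fa a) (Fa a.+1) v z) ->
  (exists z, optimal (Fa a.+1) (Fa a.+2) v z) ->
  (exists k, 2 * q a = (p - 1) * d a.+1 * k + 2 * p * q a.+1)%N /\
  (d a.+1 = d a.+2 \/ d a.+1 = p * d a.+2)%N.
Proof.
move=> qP dP [h oh] [h' oh'].
have [eps [w0 [eps0 Fw0 w00 vw0 epsP]]] := Fa_value_group a.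
have [eps1 [w1 [eps10 Fw1 w10 vw1 eps1P]]] := Fa_value_group a.+1.
have [eps2 [w2 [eps20 Fw2 w20 vw2 eps2P]]] := Fa_value_group a.+2.
have [z [Fz nFz z0 Oz]] := monogenic pchL HF (HFa a) (HFa a.+1) Hv (@sFa a) (@FaF a)
  (@Fa_succ_pow a) (Fa_basis pchL HK HF sKF Ft trt sepF finF (a := a))
  eps10 Fw1 w10 vw1 eps1P eps0 Fw0 w00 vw0 epsP oh.
have Oaz : Oa a z by [].
pose w := z ^+ p.
have Ow : Oa a.+1 w by exact: pow_ball1.
have nFw : ~ Fa a.+2 w.
  have := @frob_span_notin _ _ _ _ _ pchL HK HF trt sepF finF 1 (Fa a.+1) z.
  rewrite expn1 -Fa_succ //; apply=> //; last exact: FaF Fz.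
    by apply: subring_subspace => //; [apply: sf_ring|apply: KFa].
  exact: FaF.
have [Fw wge0] := Ow.
have [d' [c [k [d'P d'E cP cE]]]] := local_step pchL HK HF (HFa a.+1) (HFa a.+2) Hv (@sFa a.+1)
  (@FaF a.+1) (@KFa a.+2) K0 (@Fa_succ_pow a.+1)
  (Fa_basis pchL HK HF sKF Ft trt sepF finF (a := a.+1))
  eps20 Fw2 w20 vw2 eps2P (dP a.+2) oh' Fw wge0 nFw.
have d'd : d' = d a.+1 := dimq_unique HK (sK 1 a.+1) d'P (dP a.+1).
rewrite d'd in d'E cE; split=> //; exists k.
pose S := direct_sum (fun _ : 'I_p => Oa a.+2) (fun i : 'I_p => w ^+ i).
have fspE : frob_span p K 1 (Oa a) =
    direct_sum (fun _ : 'I_p => frob_span p K 1 (Oa a.+1)) (fun i : 'I_p => w ^+ i).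
  apply/predeqP => x; split.
    move: x; apply: span_prod_min; first by apply: direct_sum_subspace => i; apply: frob_span_subspace.
    move=> _ [y [+ ->]]; rewrite Oz => -[b [Ob ->]].
    exists (fun i => b i ^+ (p ^ 1)); split=> [i|].
      by apply: frob_span_pow => //; apply: sf1.
    by rewrite (pow_sum pchL); apply: eq_bigr => i _; rewrite exprMn expn1 exprAC.
  have R1 : is_subring (frob_span p K 1 (Oa a)) by exact: frob_span_ring.
  move=> [b [fb ->]]; apply: (sr_sum R1) => i _; apply: (srM R1).
    apply: frob_span_mono (fb i) => y; exact: Oa_anti.
  apply: (srX R1); rewrite /w -[p in z ^+ p]expn1; apply: frob_span_pow => //; exact: sf1.
have fw : free_mod (Fa a.+2) (@zero_only L) (fun i : 'I_p => w ^+ i).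
  by apply: powers_free => //; apply: Fa_succ_pow.
have dS : dimq K S (frob_span p K 1 (Oa a)) (p * q a.+1).
  have -> : (p * q a.+1 = \sum_(i < p) q a.+1)%N by rewrite sum_nat_const card_ord.
  rewrite fspE; apply: (dimq_direct_sum (E1 := Fa a.+2)) => // i.
  - exact: frob_span_subspace.
  - by move=> x [].
  - by move=> x /frob_span_Oa; rewrite addn1 => -[].
have dT : dimq K (Oa a.+1) (frob_span p K 1 (Oa a)) (c + p * q a.+1).
  apply: (dimq_add (W := S) HK _ _ _ _ cP dS).
  - exact: frob_span_subspace.
  - by apply: direct_sum_subspace => i; apply: sK.
  - move=> x [b [Ob ->]]; apply: (sr_sum (OaRing a.+1)) => i _; apply: (srM (OaRing a.+1)).
      by apply: Oa_anti (Ob i).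
    exact: (srX (OaRing a.+1)).
  - move=> x; rewrite fspE => -[b [fb ->]]; exists b; split=> // i.
    by have := frob_span_Oa (fb i); rewrite addn1.
rewrite (dimq_unique HK (frob_span_subspace _ _) (qP a) dT) mulnDr cE mulnA //.
Qed.

End LocalStructure.

(** * The lower bound for delta, and the separable residue degree *)

Section Comparison.

Lemma valuation_int_closed a x : Fa a x -> integral_over (Oa a) x -> Oa a x.
Proof.
move=> Fx [f [mf Of fx]]; split=> //; apply: contrapT => nx.
have Fx' := FaF Fx; have [x0 _] := v_neg HF Hv Fx' nx.
have vx : v x < 0 by rewrite ltNge; apply/negP => H; apply: nx; right.
have f0 : f != 0 by exact: monic_neq0.
pose n := (size f).-1; have sf : size f = n.+1 by rewrite prednK // size_poly_gt0.
have fn : f`_n = 1 by move/monicP: mf.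
have xnE : x ^+ n = - \sum_(i < n) f`_i * x ^+ i.
  move: fx; rewrite rootE horner_coef sf big_ord_recr /= fn mul1r addrC addr_eq0.
  by move/eqP.
have Ff i : F f`_i by case: (Of i) => /FaF.
have : vge v (v x *+ n + 1) (x ^+ n).
  rewrite xnE; apply: (vgeN HF Hv); first by apply: sf_sum => // i _; apply: sfM => //; apply: sfX.
  apply: (vge_sum HF Hv) => i _; first by apply: sfM => //; apply: sfX.
  apply: (vge0M Hv) => //; [exact: sfX|by case: (Of i)|].
  right; rewrite (vX HF Hv) //.
  have [k nk] : exists k : nat, n = (i + k.+1)%N by exists (n - i).-1; have := ltn_ord i; lia.
  have -> : v x *+ n = v x *+ i + v x *+ k.+1 by rewrite -mulrnDr -nk.
  have : v x *+ k <= 0 by rewrite mulrn_wle0 // ltW.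
  by move=> vk; rewrite mulrS; lia.
by rewrite vgeE ?expf_neq0 // (vX HF Hv) //; lia.
Qed.

(** For large N the p^N-th powers of the finitely many coefficients lie in an extension K' of [K]
    generated by separable elements. [separable_tower], applied to the integrally closed ring O_N,
    then puts y^(p^N) into Kbar O_N. *)
Lemma Kbar_closure_power y : Kbar_closure K F O y ->
  exists N0, forall N, (N0 <= N)%N -> span_prod (Kbar K) (Oa N) (y ^+ (p ^ N)).
Proof.
have BK := Kbar_subfield HK.
move=> [[num [den [[m1 [b1 [f1 [Bb1 Ff1 numE]]]] [m2 [b2 [f2 [Bb2 Ff2 denE]]]] den0 yE]]] [f [mf Of fy]]].
have /choice [D DP] l : exists D : {m : nat & ('I_m -> L) * ('I_m -> L)}%type,
    [/\ forall i, Kbar K ((tagged D).1 i), forall i, O ((tagged D).2 i) &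
        f`_l = \sum_i (tagged D).1 i * (tagged D).2 i].
  by have [m [b [o H]]] := Of l; exists (existT (fun m => ('I_m -> L) * ('I_m -> L))%type m (b, o)).
pose m l := tag (D l); pose be l : 'I_(m l) -> L := (tagged (D l)).1.
pose o l : 'I_(m l) -> L := (tagged (D l)).2.
have oP l : [/\ forall i, Kbar K (be l i), forall i, O (o l i) & f`_l = \sum_i be l i * o l i].
  exact: DP.
pose n := (size f).-1.
(* All elements of Kbar involved: those in the numerator and the denominator of y and in the
   non-leading coefficients of its equation. *)
pose c (s : 'I_m1 + 'I_m2 + {l : 'I_n & 'I_(m l)}) : L :=
  match s with inl (inl i) => b1 i | inl (inr i) => b2 i | inr t => be (tag t) (tagged t) end.
have Bc s : Kbar K (c s).
  by case: s => [[i|i]|[l i]] //=; case: (oP l).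
have [N [s [seps sP]]] := separable_powers pchL HK Bc.
exists N => N' /subnKC <-.
have [K' [F' [HK' HF' [sK1 sK's] [K'B sF'] [sKF' _ intR]]]] :=
  separable_tower HK (HFa N) (@KFa N) (fun x Fx => algK (FaF Fx)) seps.
have Kc := sP K' HK' sK's.
have [R' [HR' sK'R' sOR' R'sp intR']] := intR _ (OaRing N) (@K_Oa N) (fun x H => proj1 H)
  (@valuation_int_closed N).
have Fq x : F x -> F' (x ^+ (p ^ N)).
  by move=> Fx; apply: sF'; apply: frob_span_pow => //; apply: sf1.
have F'y : F' (y ^+ (p ^ N)).
  rewrite yE expr_div_n numE denE !(pow_sum pchL); apply: (sfM HF'); last apply: (sfV HF').
    apply: (sf_sum HF') => i _; rewrite exprMn; apply: (sfM HF'); last exact: Fq.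
    exact: (sKF' _ (Kc (inl (inl i)))).
  apply: (sf_sum HF') => i _; rewrite exprMn; apply: (sfM HF'); last exact: Fq.
  exact: (sKF' _ (Kc (inl (inr i)))).
have R'y : R' (y ^+ (p ^ N)).
  apply: intR' => //; pose g := 'X^n + \poly_(l < n) (f`_l ^+ (p ^ N)).
  have f0 : f != 0 by exact: monic_neq0.
  have sf : size f = n.+1 by rewrite prednK // size_poly_gt0.
  exists g; split.
  - by rewrite /g monicE lead_coefDl ?lead_coefXn // size_polyXn ltnS size_poly.
  - apply: (poly_overD HR'); first exact/(poly_overXn HR')/(poly_overX HR').
    move=> l; rewrite coef_poly; case: ifP => [ln|_]; last exact: (sr0 HR').
    have [_ Oo ->] := oP l; rewrite (pow_sum pchL); apply: (sr_sum HR') => i _.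
    rewrite exprMn; apply: (srM HR').
      exact: (sK'R' _ (Kc (inr (Tagged (fun l : 'I_n => 'I_(m l)) (i : 'I_(m (Ordinal ln))))))).
    apply: sOR'; have := pow_ball N (a := 0) (x := o l i); rewrite add0n O_Oa0; apply.
    exact: Oo.
  - have fn : f`_n = 1 by move/monicP: mf.
    move: fy; rewrite !rootE /g hornerD hornerXn horner_poly => /eqP fy.
    have := congr1 (fun z => z ^+ (p ^ N)) fy; rewrite /= (pow0 pchL) => E.
    apply/eqP; rewrite -[RHS]E horner_coef sf big_ord_recr /= fn mul1r (powD pchL) (pow_sum pchL).
    rewrite [LHS]addrC; congr (_ + _); last exact: exprAC.
    by apply: eq_bigr => i _; rewrite exprMn exprAC.
have [k [a [w [Ba Ow yqE]]]] := R'sp _ R'y.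
rewrite expnD exprM yqE (pow_sum pchL).
apply: span_prod_sum => i _; rewrite exprMn; apply: span_prodM; first exact: sfX.
exact: pow_ball.
Qed.

(** The p^N-th powers of delta independent classes lie in Kbar O_N and stay independent modulo the
    Kbar-span of O^(p^N), since a relation has p^N-th roots over Kbar. By [sing_sum] that quotient
    is generated by as many elements as the sum of the q_a. *)
Lemma sing_exact delta q : geom_sing_deg K F O delta ->
  (forall a, dimq K (Oa a.+1) (frob_span p K 1 (Oa a)) (q a)) ->
  exists N0, forall N, (N0 <= N)%N -> (delta <= \sum_(a < N) q a)%N.
Proof.
have BK := Kbar_subfield HK.
move=> [[y [Cy fy]] _] qP.
have [N0 N0P] := choice (fun i => Kbar_closure_power (Cy i)).
exists (\max_i N0 i) => N leN.
have [x [Ox fx gx]] := dimq_ord (sing_sum qP N).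
pose W := span_prod (Kbar K) (frob_set p N O).
have sW : subspace (Kbar K) W by exact: span_prod_subspace.
have gW : gen_mod (Kbar K) W x (span_prod (Kbar K) (Oa N)).
  move=> z [m [b [o [Bb Oo ->]]]]; have [a aP] := choice (fun l => gx _ (Oo l)).
  exists (fun j => \sum_l b l * a l j); split=> [j|].
    apply: (sf_sum BK) => l _; apply: (sfM BK) => //; apply: (Kbar_sub HK).
    by case: (aP l).
  have -> : \sum_l b l * o l - \sum_j (\sum_l b l * a l j) * x j =
      \sum_l b l * (o l - \sum_j a l j * x j).
    under [X in _ - X]eq_bigr do rewrite mulr_suml.
    rewrite exchange_big -sumrB; apply: eq_bigr => l _ /=.
    by rewrite mulrBr mulr_sumr; congr (_ - _); apply: eq_bigr => j _; rewrite mulrA.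
  apply: (subspace_sum _ sW) => l _; case: sW => _ _; apply=> //.
  by have [_] := aP l; apply: span_prod_mono => // c Kc; apply: (Kbar_sub HK).
have Sy i : span_prod (Kbar K) (Oa N) (y i ^+ (p ^ N)).
  by apply: N0P; apply: leq_trans leN; apply: leq_bigmax.
suff fyN : free_mod (Kbar K) W (fun i => y i ^+ (p ^ N)).
  by have := steinitz BK sW gW Sy fyN; rewrite !card_ord.
move=> c Bc Wc i; have [g gP] := choice (fun i => proot pchL (c i) N).
case: Wc => m [b [w [Bb Ow cE]]].
have [r rP] := choice (fun l => proot pchL (b l) N); have [o oP] := choice Ow.
rewrite -(gP i) (fy g _ _ i) ?(pow0 pchL) // => [j|].
  by apply: (proot_Kbar (b := N)); rewrite gP.
have -> : \sum_j g j * y j = \sum_l r l * o l.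
  apply: (pow_inj pchL (b := N)); rewrite !(pow_sum pchL).
  under eq_bigr do rewrite exprMn gP.
  by rewrite cE; apply: eq_bigr => l _; rewrite exprMn rP; case: (oP l) => _ ->.
apply: span_prod_fin => l; last by case: (oP l).
by apply: (proot_Kbar (b := N)); rewrite rP.
Qed.

Lemma maxideal_ball E : is_subfield E -> (forall x, E x -> F x) ->
  maxideal (ball v E 0) = ball v E 1.
Proof.
move=> HE sEF; apply/predeqP => x; split.
  move=> [[Ex x0] H]; split=> //; case: H => [->|nx]; first by left.
  have Fx := sEF x Ex; have [->|xn0] := eqVneq x 0; first by left.
  right; rewrite -gtz0_ge1; case: (ltP 0 (v x)) => // vx.
  by exfalso; apply: nx; split; [apply: sfV|right; rewrite (vV HF Hv) //; lia].
move=> [Ex x1]; split; first by split=> //; apply: vge_le x1.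
have [->|xn0] := eqVneq x 0; first by left.
right=> -[_]; rewrite vgeE ?invr_eq0 // (vV HF Hv) //; last exact: sEF.
by move: x1; rewrite vgeE //; lia.
Qed.

Lemma separable_level_sep_mod a x : separable_level a -> Oa a x -> sep_mod K (Oa a) x.
Proof.
move=> sepa Ox; have [h Kh hx] := sepa x Ox; have KR := sf_ring HK.
pose f := 'X - (h \Po 'X^p).
have f' : f^`() = 1.
  rewrite derivB derivX deriv_comp derivXn -mulr_natl [_%:R](_ : _ = 0) ?mul0r ?mulr0 ?subr0 //.
  by rewrite -polyC_natr (pcharf0 pchL).
have Kf : poly_over K f by apply: (poly_overB KR); [apply: poly_overX|apply: comp_Xp_over].
exists f; split=> //.
- by apply/eqP => f0; move/eqP: f'; rewrite f0 deriv0 eq_sym oner_eq0.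
- by rewrite f' coprimep1.
- rewrite (maxideal_ball (HFa a) (@FaF a)).
  split.
    by apply: (sr_horner (sf_ring (HFa a))) => [i|]; [apply/KFa/Kf|case: Ox].
  by rewrite /f !hornerE horner_comp hornerXn.
Qed.

(* If [x = h(x^p)] modulo the maximal ideal, an approximation [y] of [x] at level [a] yields
   the approximation [h(y^p)] at level [a + 1]. *)
Lemma sep_mod_approx x a : O x -> sep_mod K O x -> exists2 y, Oa a y & vge v 1 (x - y).
Proof.
move=> Ox [f [f0 Kf cop fm]]; have KR := sf_ring HK.
rewrite (maxideal_ball HF) // in fm.
have KO (g : {poly L}) z : poly_over K g -> O z -> O g.[z].
  by move=> Kg Oz; apply: (sr_horner ORing) => // i; rewrite -O_Oa0; apply: K_Oa.
have [h Kh hdvd] := separable_frob pchL HK f0 Kf cop.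
have xh : vge v 1 (x - h.[x ^+ p]).
  have -> : x - h.[x ^+ p] = (('X - (h \Po 'X^p)) %/ f).[x] * f.[x].
    by rewrite -hornerM divpK // !hornerE horner_comp hornerXn.
  have Kq : poly_over K (('X - (h \Po 'X^p)) %/ f).
    by apply: poly_over_div => //; apply: (poly_overB KR); [apply: poly_overX|apply: comp_Xp_over].
  have [Fq q0] := KO _ x Kq Ox; have [Ff f1] := fm.
  exact: (vge0M Hv).
elim: a => [|a [y Oy xy]]; first by exists x; rewrite ?O_Oa0 // subrr; left.
have Oyp := pow_ball1 Oy.
have Kha : poly_over (Oa a.+1) h by move=> i; apply: K_Oa.
exists h.[y ^+ p]; first exact: (sr_horner (OaRing a.+1)).
have -> : x - h.[y ^+ p] = (x - h.[x ^+ p]) + (h.[x ^+ p] - h.[y ^+ p]) by rewrite addrA subrK.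
have O' : O y by rewrite -O_Oa0; apply: Oa_anti Oy.
have Oxp : O (x ^+ p) by exact: (srX ORing).
have Oyp' : O (y ^+ p) by exact: (srX ORing).
have Fxy : F (x - y) by apply: sfB => //; [case: Ox|case: O'].
have [Fh1 _] := KO h _ Kh Oxp; have [Fh2 _] := KO h _ Kh Oyp'.
apply: (vgeD Hv) => //; [by apply: sfB => //; case: Ox|exact: sfB|].
rewrite !horner_coef -sumrB; apply: (vge_sum HF Hv) => i _.
  apply: sfB => //; apply: sfM => //; try exact/sKF/Kh; apply: sfX => //.
    by case: Oxp.
  by case: Oyp'.
rewrite -mulrBr subrXX; apply: (vge0M Hv); [exact: sKF|..]; [|exact: K0|].
  apply: sfM => //; first by apply: sfB => //; [case: Oxp|case: Oyp'].
  by apply: sf_sum => // j _; apply: sfM => //; apply: sfX => //; [case: Oxp|case: Oyp'].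
rewrite mulrC; apply: (vge0M Hv).
- by apply: sf_sum => // j _; apply: sfM => //; apply: sfX => //; [case: Oxp|case: Oyp'].
- by apply: sfB => //; [case: Oxp|case: Oyp'].
- have : O (\sum_(j < i) (x ^+ p) ^+ (i.-1 - j) * (y ^+ p) ^+ j); last by case.
  by apply: (sr_sum ORing) => j _; apply: (srM ORing); apply: (srX ORing).
- have -> : x ^+ p - y ^+ p = (x - y) ^+ p by rewrite -[in RHS](expn1 p) (powB pchL) !expn1.
  exact: vge_pow.
Qed.

(** At a separable level all residues of O_a are separable residues of [O], so d <= s; conversely
    [sep_mod_approx] finds every separable residue of [O] in O_a. *)
Lemma sep_degree s d a : sep_res_deg K O s -> dimq K (Oa a) (ma a) d -> separable_level a -> d = s.
Proof.
move=> sepO da sepa; apply/eqP; rewrite eqn_leq; apply/andP; split.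
  have [x [Ox fx _]] := dimq_ord da.
  apply: (dim_mod_le (y := x) (sf0 HK) sepO) => [i|c Kc].
    split; first by rewrite -O_Oa0; apply: Oa_anti (Ox i).
    have [f [f0 Kf cop fm]] := separable_level_sep_mod sepa (Ox i).
    exists f; split=> //; move: fm; rewrite (maxideal_ball (HFa a) (@FaF a)) (maxideal_ball HF) //.
    by case=> /FaF.
  rewrite (maxideal_ball HF) // => -[_ c1]; apply: fx => //; split=> //.
  by apply: (sf_sum (HFa a)) => i _; apply: (sfM (HFa a)); [apply: KFa|case: (Ox i)].
case: sepO => [[x [Sx fx]] _].
have exy i : exists y, Oa a y /\ vge v 1 (x i - y).
  by case: (Sx i) => Ox sx; have [y Oy xy] := sep_mod_approx a Ox sx; exists y.
have [y yP] := choice exy.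
rewrite -[s]card_ord; apply: (free_dimq_le HK (sK 1 a) da (x := y)) => [i|c Kc [_ c1]].
  by case: (yP i).
apply: fx => //; rewrite (maxideal_ball HF) //.
have Fx i : F (x i) by case: (Sx i) => -[].
have Fy i : F (y i) by case: (yP i) => -[/FaF].
have -> : \sum_i c i * x i = \sum_i c i * y i + \sum_i c i * (x i - y i).
  by rewrite -big_split /=; apply: eq_bigr => i _; rewrite -mulrDr addrC subrK.
have F1 : F (\sum_i c i * y i) by apply: sf_sum => // i _; apply: sfM => //; apply: sKF.
have F2 i : F (c i * (x i - y i)) by apply: sfM => //; [apply: sKF|apply: sfB].
split; first by apply: sfD => //; apply: sf_sum.
apply: (vgeD Hv) => //; first exact: sf_sum.
apply: (vge_sum HF Hv) => // i _; apply: (vge0M Hv); [exact: sKF|exact: sfB|exact: K0|].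
by case: (yP i).
Qed.

Lemma residue_degree_pos d a : dimq K (Oa a) (ma a) d -> (0 < d)%N.
Proof.
move=> da; have := free_dimq_le HK (sK 1 a) da (x := fun _ : 'I_1 => 1).
rewrite card_ord; apply=> [i|c Kc]; first exact: (sr1 (OaRing a)).
rewrite big_ord1 mulr1 => -[_ c1] i; rewrite (ord1 i); apply: contrapT => /eqP c0.
by move: c1; rewrite vgeE // val_K.
Qed.

Lemma residue_degree_anti (d : nat -> nat) a : (forall a, dimq K (Oa a) (ma a) (d a)) ->
  (d a.+1 <= d a)%N.
Proof.
move=> dP; have [x [Ox fx _]] := dimq_ord (dP a.+1).
rewrite -[d a.+1]card_ord; apply: (free_dimq_le HK (sK 1 a) (dP a) (x := x)) => [i|c Kc [_ c1]].
  exact: Oa_anti (Ox i).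
apply: fx => //; split=> //.
by apply: (sf_sum (HFa a.+1)) => i _; apply: (sfM (HFa a.+1)); [apply: KFa|case: (Ox i)].
Qed.

End Comparison.

(** * Primes of Kbar F above a separable level *)

Section Decomposition.
Variable N : nat.
Hypothesis sepN : separable_level N.

Local Notation B := (Kbar K).
Local Notation A := (span_prod (Kbar K) (Oa N)).

Let HB : is_subfield B := Kbar_subfield HK.
Let HA : is_subring A := span_prod_ring (sf_ring HB) (OaRing N).
Let sBA x : B x -> A x. Proof. by move=> Bx; apply: span_prod_subl => //; exact: sr1 (OaRing N). Qed.
Let sOA x : Oa N x -> A x. Proof. by move=> Ox; apply: span_prod_subr => //; exact: sf1 HB. Qed.

Variables (eps : nat) (w : L).
Hypotheses (eps0 : (0 < eps)%N) (Fw : Fa N w) (w0 : w != 0) (vw : v w = eps%:Z).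
Hypothesis epsP : forall x, Fa N x -> x != 0 -> (eps%:Z %| v x)%Z.

Let Ow : Oa N w. Proof. by split=> //; right; rewrite vw. Qed.
Let Aw : A w. Proof. exact: sOA. Qed.

Lemma maximal_principal x : ma N x -> exists2 y, Oa N y & x = w * y.
Proof.
move=> [Fx x1]; have [->|x0] := eqVneq x 0; first by exists 0; rewrite ?mulr0 //; exact: sr0 (OaRing N).
exists (x / w); last by rewrite mulrC mulfVK.
split; first by apply: (sfM (HFa N)) => //; apply: (sfV (HFa N)).
right; have /dvdzP[k vx] := epsP Fx x0; move: x1; rewrite vgeE //.
have Fx' := FaF Fx; have Fw' := FaF Fw; have Fw'' := sfV HF Fw'.
by rewrite (vM Hv) ?invr_eq0 // (vV HF Hv) // vw vx; move: eps0; case: (ltP 0 k) => k0; nia.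
Qed.

Lemma span_prod_maximal x : span_prod B (ma N) x -> exists2 y, A y & x = w * y.
Proof.
move=> [m [b [o [Bb mo ->]]]].
have H i : exists y, Oa N y /\ o i = w * y by have [y Oy oy] := maximal_principal (mo i); exists y.
have [y yP] := choice H; exists (\sum_i b i * y i).
  by apply: span_prod_fin => // i; case: (yP i).
by rewrite mulr_sumr; apply: eq_bigr => i _; case: (yP i) => _ ->; rewrite mulrCA.
Qed.

Lemma principal_maximal y : A y -> span_prod B (ma N) (w * y).
Proof.
move=> [m [b [o [Bb Oo ->]]]]; rewrite mulr_sumr.
under eq_bigr do rewrite mulrCA.
apply: span_prod_fin => // i; case: (Oo i) => Fo o0; split; first exact: (sfM (HFa N)).
rewrite mulrC; apply: (vge0M Hv) => //; [exact: FaF Fo|exact: FaF Fw|].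
by right; rewrite vw; move: eps0; lia.
Qed.

(** The roots are those of a separable polynomial over [K] that annihilates the residue of x. Their
    simplicity is the input to [valuation_localization]. *)
Lemma residue_roots x : Oa N x -> exists rs : seq L,
  [/\ forall b, b \in rs -> B b, uniq rs & exists2 y, A y & \prod_(b <- rs) (x - b) = w * y].
Proof.
move=> Ox; have [f [f0 Kf cop]] := separable_level_sep_mod sepN Ox.
rewrite (maxideal_ball (HFa N) (@FaF N)) => /maximal_principal[y Oy fx].
have [rs fE] := closed_field_poly_normal f; exists rs.
have lf0 : lead_coef f != 0 by rewrite lead_coef_eq0.
have Klf : K (lead_coef f) by rewrite lead_coefE.
split.
- move=> b brs; exists f; split=> //; split=> //.
  by rewrite fE rootZ // root_prod_XsubC.
- rewrite -separable_prod_XsubC; set P := \prod_(b <- rs) _ in fE *.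
  have : coprimep (lead_coef f *: P) (lead_coef f *: P)^`() by rewrite -fE.
  by rewrite derivZ coprimepZl // coprimepZr // unlock.
- exists ((lead_coef f)^-1 * y).
    by apply: (srM HA); [apply/sBA/(sfV HB)/(Kbar_sub HK)|apply: sOA].
  rewrite mulrCA -fx fE hornerZ lead_coefZ horner_prod.
  rewrite (monicP (monic_prod_XsubC _ _ _)) mulr1 mulKf //.
  by apply: eq_bigr => b _; rewrite !hornerE.
Qed.

(** z is integral over O_N and divides the constant term of its equation, which is a unit of O_N
    times a power of w once it is nonzero. *)
Lemma divides_power z : A z -> z != 0 -> exists y k, A y /\ z * y = w ^+ k.
Proof.
move=> Az z0; have intz : integral_over (Oa N) z.
  case: Az => m [b [o [Bb Oo ->]]]; have IR := integral_ring (OaRing N).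
  apply: (sr_sum IR) => i _; apply: (srM IR); last exact: (integral_self (OaRing N)).
  apply: (integral_sub_ring (R := K)) => [c|]; first exact: K_Oa.
  by apply/(integral_algebraicP (b i) HK); apply: Bb.
have [f [mf Of fz] fn0] : exists2 f : {poly L}, [/\ f \is monic, poly_over (Oa N) f & root f z] & f`_0 != 0.
  case: intz => f [mf Of fz]; have [n] := ubnP (size f); elim: n f mf Of fz => // n IH f mf Of fz sf.
  have [f00|] := eqVneq f`_0 0; last by exists f.
  have fE : f = (f %/ 'X) * 'X.
    by rewrite divpK // -['X]subr0 -polyC0 dvdp_XsubCl rootE horner_coef0 f00.
  have mg : f %/ 'X \is monic by move: mf; rewrite {1}fE monicMr ?monicX.
  apply: (IH (f %/ 'X)) => //.
  - by move=> i; have := Of i.+1; rewrite {1}fE coefMX.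
  - by move: fz; rewrite {1}fE rootM rootX (negPf z0) orbF.
  - have s0 : (0 < size f)%N by rewrite size_poly_gt0 monic_neq0.
    by rewrite size_divp ?polyX_eq0 // size_polyX subn1 -ltnS prednK.
have Of0 := Of 0%N; have [Ff0 vf0] := Of0.
pose g := \sum_(i < (size f).-1) f`_i.+1 * z ^+ i.
have Ag : A g.
  by apply: (sr_sum HA) => i _; apply: (srM HA); [apply: sOA|apply: (srX HA)].
have f0E : f`_0 = - (z * g).
  move: fz; rewrite rootE horner_coef.
  have -> : size f = (size f).-1.+1 by rewrite prednK // size_poly_gt0 monic_neq0.
  rewrite big_ord_recl expr0 mulr1 addr_eq0 => /eqP ->; congr (- _).
  by rewrite mulr_sumr; apply: eq_bigr => i _; rewrite exprS mulrCA.
have /dvdzP[k vk] := epsP Ff0 fn0.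
have k0 : 0 <= k by move: vf0; rewrite vgeE // vk; nia.
pose c := w ^+ `|k| / f`_0.
have Oc : Oa N c.
  split; first by apply: (sfM (HFa N)); [apply: (sfX (HFa N))|apply: (sfV (HFa N))].
  have Fw' := FaF Fw; have Fwk := sfX HF `|k| Fw'; have Ff' := FaF Ff0; have Ffi := sfV HF Ff'.
  right; rewrite (vM Hv) ?expf_neq0 ?invr_eq0 // (vV HF Hv) // (vX HF Hv) // vw vk; nia.
exists (- (g * c)), `|k|%N; split; first by apply: (srN HA); apply: (srM HA) => //; apply: sOA.
by rewrite mulrN mulrA -mulNr -f0E mulrC mulfVK.
Qed.

Let HBF : is_subfield (Kbar_field K F).
Proof. exact/quot_field_subfield/(span_prod_ring (sf_ring HB))/(sf_ring HF). Qed.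

(** For f in [F] the power f^(p^N) lies in F_N, so a power of w clears its denominator. *)
Lemma Kbar_field_frac y : Kbar_field K F y ->
  exists a b, [/\ A a, A b, b != 0 & y ^+ (p ^ N) = a / b].
Proof.
have H z : span_prod B F z -> exists k, A (z ^+ (p ^ N) * w ^+ k).
  move=> [m [b [f [Bb Ff ->]]]].
  have Hk i : exists k, Oa N (f i ^+ (p ^ N) * w ^+ k).
    have Fq : Fa N (f i ^+ (p ^ N)) by apply: frob_span_pow => //; exact: sf1.
    have [->|fi0] := eqVneq (f i ^+ (p ^ N)) 0; first by exists 0%N; rewrite mul0r; exact: sr0 (OaRing N).
    have /dvdzP[k vk] := epsP Fq fi0; exists `|k|%N.
    split; first by apply: (sfM (HFa N)) => //; apply: (sfX (HFa N)).
    have Fw' := FaF Fw; have Fwk := sfX HF `|k| Fw'; have Fq' := FaF Fq.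
    have wk0 := expf_neq0 `|k| w0.
    right; rewrite (vM Hv) // vk (vX HF Hv) // vw; nia.
  have [k kP] := choice Hk; exists (\max_i k i)%N.
  rewrite (pow_sum pchL) mulr_suml; apply: (sr_sum HA) => i _; rewrite exprMn -mulrA.
  apply: (srM HA); first by apply/sBA/(sfX HB).
  have -> : (\max_i k i = k i + (\max_i k i - k i))%N by rewrite subnKC // leq_bigmax.
  by rewrite exprD mulrA; apply: (srM HA); [apply: sOA|apply: (srX HA)].
move=> [a [b [/H[k Ak] /H[l Al] b0 ->]]].
exists (a ^+ (p ^ N) * w ^+ k * w ^+ l), (b ^+ (p ^ N) * w ^+ l * w ^+ k); split.
- by apply: (srM HA) => //; apply: (srX HA).
- by apply: (srM HA) => //; apply: (srX HA).
- by rewrite !mulf_neq0 ?expf_neq0.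
- rewrite expr_div_n; have := expf_neq0 k w0; have := expf_neq0 l w0.
  have := expf_neq0 (p ^ N) b0 => h1 h2 h3; field; by rewrite h1 h2 h3.
Qed.

(* The prime consists of the elements whose [p ^ N]-th power lies in the localization of
   [A = Kbar O_N] at a maximal ideal containing [I0]. *)
Lemma prime_over_ideal I0 : ideal_of A I0 -> I0 w -> ~ I0 1 ->
  exists P, prime_over K F O P /\
    forall x b y, Oa N x -> B b -> x != b -> y ^+ (p ^ N) = (x - b)^-1 ->
      (I0 (x - b) -> ~ P y) /\ (forall c, B c -> c != 0 -> I0 (x - b - c) -> P y).
Proof.
move=> II0 I0w nI0.
have [m [r [Or _ gr]]] : exists m (r : 'I_m -> L), basis_mod K (Oa N) (ma N) r.
  by have [d dP] := residue_degree; have [r rP] := dimq_ord (dP N); exists (d N), r.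
have [rs rsP] := choice (fun i => residue_roots (Or i)).
have gen_r z : A z -> exists c : 'I_m -> L, (forall i, B (c i)) /\
    exists2 y, A y & z = \sum_i c i * r i + w * y.
  move=> [k [b [o [Bb Oo ->]]]]; have [a aP] := choice (fun i => gr _ (Oo i)).
  exists (fun j => \sum_i b i * a i j); split=> [j|].
    apply: (sf_sum HB) => i _; apply: (sfM HB) => //; apply: (Kbar_sub HK).
    by case: (aP i).
  have [|y Ay yE] := @span_prod_maximal (\sum_i b i * (o i - \sum_j a i j * r j)).
    by apply: span_prod_fin => // i; case: (aP i).
  exists y => //; rewrite -yE.
  have -> : \sum_j (\sum_i b i * a i j) * r j = \sum_i b i * \sum_j a i j * r j.
    under eq_bigr do rewrite mulr_suml.
    rewrite exchange_big; apply: eq_bigr => i _ /=.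
    by rewrite mulr_sumr; apply: eq_bigr => j _; rewrite mulrA.
  by rewrite -big_split; apply: eq_bigr => i _ /=; rewrite -mulrDr addrC subrK.
have [|||D [HD AD nDw Dval [D1 D2]]] := @valuation_localization L B A w HB HA sBA w0 m r rs
    (fun i => sOA (Or i)) _ _ _ gen_r divides_power I0 II0 I0w nI0.
- by move=> i b bi; case: (rsP i) => + _ _; apply.
- by move=> i; case: (rsP i).
- by move=> i; case: (rsP i).
have q0 : (0 < p ^ N)%N by rewrite expn_gt0 p0.
have unitM x y : unit_of D x -> unit_of D y -> unit_of D (x * y).
  move=> [Dx x0 Dx'] [Dy y0 Dy']; split; [exact: (srM HD)|exact: mulf_neq0|].
  by rewrite invfM; apply: (srM HD).
have unitV x : unit_of D x -> unit_of D x^-1.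
  by move=> [Dx x0 Dx']; split; rewrite ?invr_eq0 ?invrK.
have unitX x k : unit_of D x -> unit_of D (x ^ (k : int)).
  move=> Dx; have H n : unit_of D (x ^+ n).
    elim: n => [|n IH]; last by rewrite exprS; apply: unitM.
    by split; rewrite ?expr0 ?invr1 ?oner_neq0 //; exact: sr1 HD.
  by case: k => n; [exact: H|apply/unitV/H].
have val y : Kbar_field K F y -> y != 0 -> exists u (k : int), unit_of D u /\ y ^+ (p ^ N) = u * w ^ k.
  move=> /Kbar_field_frac[a [b [Aa Ab b0 yE]]] y0.
  have a0 : a != 0.
    by apply: contraTneq (expf_neq0 (p ^ N) y0) => a0; rewrite yE a0 mul0r eqxx.
  have [u [k [Du aE]]] := Dval a Aa a0; have [u' [k' [Du' bE]]] := Dval b Ab b0.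
  exists (u * u'^-1), (k%:Z - k'%:Z); split; first by apply: unitM => //; apply: unitV.
  by rewrite yE aE bE expfzDr // -!exprnP -invr_expz invfM mulrACA -exprnP.
have nonneg u k : unit_of D u -> D (u * w ^ (k : int)) -> 0 <= k.
  move=> [Du u0 Du'] Dk; rewrite leNgt; apply/negP => k0; apply: nDw.
  have -> : w^-1 = u^-1 * (u * w ^ k) * w ^+ `|k + 1|.
    rewrite mulKf // exprnP -expfzDr // -[LHS]exprN1; congr (_ ^ _); lia.
  by apply: (srM HD); [apply: (srM HD)|apply: (srX HD); apply: AD].
pose P y := Kbar_field K F y /\ D (y ^+ (p ^ N)).
have sFB x : F x -> Kbar_field K F x.
  by move=> Fx; apply: Kbar_field_span; apply: span_prod_subr => //; exact: sf1 HB.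
have sBB x : B x -> Kbar_field K F x.
  by move=> Bx; apply: Kbar_field_span; apply: span_prod_subl => //; exact: sf1.
have HP : is_subring P.
  split; first by split; [exact: sf1 HBF|rewrite expr1n; exact: sr1 HD].
  move=> x y [Fx Dx] [Fy Dy]; split; split.
  - exact: (sfB HBF).
  - by rewrite (powB pchL); apply: (srB HD).
  - exact: (sfM HBF).
  - by rewrite exprMn; apply: (srM HD).
have unitP y u : Kbar_field K F y -> unit_of D u -> y ^+ (p ^ N) = u -> unit_of P y.
  move=> Fy [Du u0 Du'] yu; split; first by split=> //; rewrite yu.
    by apply: contraNneq u0 => y0; rewrite -yu y0 expr0n gtn_eqF.
  by split; [exact: (sfV HBF)|rewrite exprVn yu].
(* Only some exponents of w are attained by p^N-th powers; an element attaining the least positive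
   one is a uniformizer of [P]. The element w shows that p^N is attained. *)
pose Q n := `[< (0 < n)%N /\ exists y u, [/\ Kbar_field K F y, y != 0, unit_of D u & y ^+ (p ^ N) = u * w ^+ n] >].
have exQ : exists n, Q n.
  exists (p ^ N)%N; apply/asboolP; split=> //; exists w, 1; split=> //; last by rewrite mul1r.
    exact/sFB/(FaF Fw).
  by split; rewrite ?invr1 ?oner_neq0 //; exact: sr1 HD.
case: (ex_minnP exQ) => e /asboolP[e0 [y [u [Fy y0 Du yE]]]] mine.
exists P; split; first split.
- split=> //.
  + by move=> b Bb; split; [exact: sBB|apply/AD/sBA/(sfX HB)].
  + by move=> z [].
  + exists y; split=> //.
    * split=> //; rewrite yE; case: Du => Du _ _; apply: (srM HD) => //.
      by apply: (srX HD); apply: AD.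
    * move=> [_]; rewrite exprVn yE invfM => Dy.
      by have := nonneg u^-1 (- e%:Z) (unitV _ Du); rewrite -invr_expz -exprnP => /(_ Dy); lia.
    * move=> z Fz z0; have [u' [k [Du' zE]]] := val z Fz z0.
      have [y' [Fy' y'0 y'E]] : exists y', [/\ Kbar_field K F y', y' != 0 & y' = z / y ^ (k %/ e%:Z)%Z].
        exists (z / y ^ (k %/ e%:Z)%Z); split=> //; last first.
          by rewrite mulf_neq0 ?invr_eq0 ?expfz_neq0.
        apply: (sfM HBF) => //; apply: (sfV HBF).
        by case: (k %/ _)%Z => n; [apply: (sfX HBF)|apply: (sfV HBF); apply: (sfX HBF)].
      have y'v : y' ^+ (p ^ N) = u' * (u ^ (k %/ e%:Z)%Z)^-1 * w ^ (k %% e%:Z)%Z.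
        have yj : (y ^ (k %/ e%:Z)%Z) ^+ (p ^ N) = u ^ (k %/ e%:Z)%Z * w ^ (e%:Z * (k %/ e%:Z)%Z).
          by rewrite [LHS]exprnP exprzAC -exprnP yE expfzMl exprnP exprz_exp.
        rewrite y'E expr_div_n zE yj invfM mulrACA; congr (_ * _).
        by rewrite invr_expz -expfzDr //; congr (_ ^ _); rewrite /modz mulrC.
      have Du'' : unit_of D (u' * (u ^ (k %/ e%:Z)%Z)^-1).
        by apply: unitM => //; apply/unitV/unitX.
      have r0 : (k %% e%:Z)%Z = 0.
        apply/eqP; apply: contraT => r0.
        have re : ((k %% e%:Z)%Z < e%:Z) by rewrite ltz_pmod //; lia.
        have r1 : 0 <= (k %% e%:Z)%Z by rewrite modz_ge0 //; lia.
        have : Q `|(k %% e%:Z)%Z|%N.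
          apply/asboolP; split; first by lia.
          by exists y', (u' * (u ^ (k %/ e%:Z)%Z)^-1); split=> //; rewrite y'v exprnP gez0_abs.
        by move/mine; lia.
      exists y', (k %/ e%:Z)%Z; split; last by rewrite y'E mulfVK // expfz_neq0.
      by apply: unitP Du'' _ => //; rewrite y'v r0 mulr1.
- move=> x Fx; split; last first.
    move=> Ox; split; first exact: sFB.
    by apply/AD/sOA; have := pow_ball N (a := 0) (x := x); rewrite O_Oa0 add0n; apply.
  move=> [_ Dx]; apply: contrapT => nOx; have nx : ~ vge v 0 x by move=> x0; apply: nOx.
  have [x0 xv] := v_neg HF Hv Fx nx.
  have Fxi : F x^-1 by exact: sfV.
  have [|z Oz zE] := @maximal_principal (x^-1 ^+ (p ^ N)).
    split; first by apply: frob_span_pow => //; exact: sf1.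
    by apply: vge_pow.
  apply: nDw; have -> : w^-1 = z * x ^+ (p ^ N).
    by apply: (mulfI w0); rewrite mulfV // mulrA -zE exprVn mulVf // expf_neq0.
  by apply: (srM HD) => //; apply/AD/sOA.
- move=> x b z Ox Bb xb zE; have xb0 : x - b != 0 by rewrite subr_eq0.
  split=> [Ixb [_]|c Bc c0 Ic]; first by rewrite zE; apply: D1.
  have Axb : A (x - b) by apply: (srB HA); [apply: sOA|apply: sBA].
  split; last by rewrite zE; apply: (D2 _ c).
  have [x' x'E] := proot pchL x N; have [b' b'E] := proot pchL b N.
  have -> : z = (x' - b')^-1.
    by apply: (pow_inj pchL (b := N)); rewrite exprVn (powB pchL) x'E b'E.
  apply: (sfV HBF); apply: (sfB HBF).
    by apply/Kbar_field_span/(Kbar_span_proot _ x'E); case: Ox.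
  by apply/sBB/(proot_Kbar (b := N)); rewrite b'E.
Qed.

(* If [d > 1], some separable residue [x] has two distinct conjugates [a], [a'] over [K]; the
   ideals generated by [w] and [x - a], resp. [x - a'], give two primes over [O]. *)
Lemma non_decomposed_degree d : non_decomposed K F O -> dimq K (Oa N) (ma N) d -> d = 1%N.
Proof.
move=> nd dP; apply/eqP; rewrite eqn_leq (residue_degree_pos dP) andbT leqNgt; apply/negP => d2.
have [x Ox xK] : exists2 x, Oa N x & forall c, K c -> ~ ma N (x - c).
  apply: contrapT => nex; move: d2; rewrite ltnNge => /negP; apply.
  have [r [Or fr _]] := dimq_ord dP; rewrite -[d]card_ord -card_unit.
  apply: (steinitz HK (sK 1 N) (V := Oa N) (x := fun _ : unit => 1)) => // z Oz.
  apply: contrapT => nz; apply: nex; exists z => // c Kc zc; apply: nz.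
  by exists (fun=> c); split=> //; rewrite (big_pred1 tt) => [|[]//]; rewrite mulr1.
(* 1 and x are free over [K] modulo the maximal ideal of O_N, hence free over Kbar modulo its
   Kbar-span, by [free_mod_frob] with b = 0. *)
have xB a : B a -> ~ exists2 y, A y & x - a = w * y.
  move=> Ba [y Ay xa]; have := principal_maximal Ay; rewrite -xa => xam.
  pose f (i : bool) := if i then x else 1.
  have ff : free_mod K (ma N) f.
    move=> c Kc; rewrite big_bool /= mulr1 => cm.
    have cx : c true = 0.
      apply: contrapT => /eqP c0; apply: (xK (- (c true)^-1 * c false)).
        by apply: (sfM HK) => //; apply: (sfN HK); apply: (sfV HK).
      have -> : x - - (c true)^-1 * c false = (c true)^-1 * (c true * x + c false).
        by rewrite mulrDr mulKf // mulNr opprK.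
      have [_ _] := sK 1 N; apply=> //; exact: (sfV HK).
    case; first exact: cx.
    move: cm; rewrite cx mul0r add0r => -[_ c1]; apply: contrapT => /eqP c0.
    by move: c1; rewrite vgeE // val_K.
  have fK := free_mod_frob pchL HK (b := 0) (K' := B) (F := F) _ HB _ (sK 1 N) _ _ ff.
  suff : 1 = 0 :> L by move/eqP; rewrite oner_eq0.
  apply: (fK _ _ _ _ (fun i : bool => if i then 1 else - a) _ _ true).
  - by move=> c Kc; rewrite expn0 expr1; apply: (Kbar_sub HK).
  - by move=> J g Fg fg; under eq_fun do rewrite expn0 expr1; apply: KFree.
  - by move=> z [/FaF].
  - by case; rewrite /f; [case: Ox => /FaF|exact: sf1].
  - by case; [exact: sf1 HB|exact: (sfN HB)].
  - rewrite big_bool /= mul1r mulr1 !expn0 !expr1; apply: span_prod_mono xam => // z mz.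
    by exists z; rewrite expn0 expr1.
pose I1 z := exists2 y, A y & z = w * y.
have II1 : ideal_of A I1.
  split.
  - by move=> _ [y Ay ->]; apply: (srM HA).
  - by exists 0; [exact: sr0 HA|rewrite mulr0].
  - by move=> _ _ [y Ay ->] [z Az ->]; exists (y + z); [exact: (srD HA)|rewrite mulrDr].
  - by move=> z _ Az [y Ay ->]; exists (z * y); [exact: (srM HA)|rewrite mulrCA].
have I1w : I1 w by exists 1; [exact: sr1 HA|rewrite mulr1].
have nI1 : ~ I1 1.
  move=> [y Ay E]; apply: (xB 0); first exact: sf0 HB.
  by exists (x * y); [apply: (srM HA) => //; apply: sOA|rewrite subr0 mulrCA -E mulr1].
have Ax := sOA Ox; have [rs [Brs urs rsI]] := residue_roots Ox.
have Axb b : B b -> A (x - b) by move=> Bb; apply: (srB HA) => //; apply: sBA.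
have escape s : (forall b, b \in s -> B b) -> ~ ideal_adjoin A I1 (\prod_(b <- s) (x - b)) 1 ->
    exists2 b, b \in s & ~ ideal_adjoin A I1 (x - b) 1.
  move=> Bs ns; apply: contrapT => nex; apply: ns; apply: (ideal_adjoin_prod HA sBA) => // b bs.
  by apply: contrapT => nb; apply: nex; exists b.
have [a ars na] : exists2 a, a \in rs & ~ ideal_adjoin A I1 (x - a) 1.
  apply: escape => // -[i [z [Ii Az E]]]; apply: nI1; rewrite E; case: (II1) => _ _ ID IM.
  by apply: ID => //; rewrite mulrC; apply: IM.
have Ba := Brs a ars.
have Bs b : b \in rem a rs -> B b by move/mem_rem/Brs.
(* If every other root gave the unit ideal, so would the product of the other factors; as the full
   product lies in w A, so would x - a, against [xB]. *)
have [a' ars' na'] : exists2 a', a' \in rem a rs & ~ ideal_adjoin A I1 (x - a') 1.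
  apply: escape => // -[i [z [Ii Az E]]]; apply: (xB a Ba); case: (II1) => _ _ ID IM.
  rewrite -[x - a]mulr1 E mulrDr mulrA; apply: ID; first by apply: IM => //; apply: Axb.
  by move: rsI; rewrite (big_rem _ ars) /= => rsI; rewrite mulrC; apply: IM.
have aa' : a' != a by move: ars'; rewrite mem_rem_uniq // inE => /andP[].
have Ba' := Bs a' ars'.
have [II Iw Ia] := ideal_adjoinP HA II1 (Axb a Ba).
have [II' Iw' Ia'] := ideal_adjoinP HA II1 (Axb a' Ba').
have [P [PO PP]] := prime_over_ideal II (Iw _ I1w) na.
have [P' [PO' PP']] := prime_over_ideal II' (Iw' _ I1w) na'.
have xa : x != a.
  apply/eqP => xa; apply: (xB a Ba); exists 0; first exact: sr0 HA.
  by rewrite xa subrr mulr0.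
(* This element separates the two primes: x - a is a nonunit for the first one, but is congruent to
   a' - a, which is nonzero, for the second. *)
have [y yE] := proot pchL (x - a)^-1 N.
have [nPy _] := PP x a y Ox Ba xa yE; have [_ Py] := PP' x a y Ox Ba xa yE.
apply: nPy => //; apply/(nd P P' PO PO'); apply: (Py (a' - a)).
- exact: (sfB HB).
- by rewrite subr_eq0.
- by rewrite opprB addrA subrK.
Qed.

End Decomposition.

(** * Combination with the numerical argument *)

Section SeparabilityBounds.
Variables (delta s : nat).
Hypotheses (sing : geom_sing_deg K F O delta) (delta0 : (0 < delta)%N).
Hypothesis sepO : sep_res_deg K O s.

Lemma sep_degree_pos : (0 < s)%N.
Proof.
have OR := ORing; have O1 := sr1 OR.
apply: (dim_mod_le (y := fun _ : 'I_1 => 1) (sf0 HK) sepO) => [_|c Kc].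
  split=> //; exists ('X - 1%:P); rewrite derivB derivX derivC subr0 coprimep1 !hornerE subrr.
  rewrite polyXsubC_eq0; split=> //.
    have KR := sf_ring HK.
    by apply: (poly_overB KR); [apply: (poly_overX KR)|apply: (poly_overC KR); apply: sf1].
  by split; [exact: sr0 OR|left].
rewrite (maxideal_ball HF) // big_ord1 mulr1 => -[_ c1] i; rewrite (ord1 i).
by apply: contrapT => /eqP c0; move: c1; rewrite vgeE // val_K.
Qed.

Lemma separability_bounds :
  (forall n, (2 * delta + s <= s * p ^ n)%N -> separable_level n) /\
  (~ (exists j i, (j <= i)%N /\ (2 * delta = (p - 1) * s * \sum_(j <= k < i.+1) p ^ k)%N) ->
   forall n, (2 * delta + s <= s * p ^ n.+1)%N -> separable_level n).
Proof.
have [q qP] := sing_step sing; have [d dP] := residue_degree.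
have sum_le := sing_sum_le sing qP.
have sum_ge : exists N, (delta <= \sum_(a < N) q a)%N.
  by have [N NP] := sing_exact sing qP; exists N; apply: NP.
have p1 : (1 < p)%N by exact: prime_gt1.
have [J [_ qz _]] := sum_eventually_zero delta0 sum_le sum_ge.
have d_anti := residue_degree_anti _ dP.
have stab a : q a = 0%N -> forall x, Oa a.+1 x -> frob_span p K 1 (Oa a) x.
  by move=> qa; have := qP a; rewrite qa => /dimq0_sub.
(* As d does not increase, it is stationary for one step beyond any level; taking this level above J
   gives q N = 0 too, as [exists_optimal] requires. *)
have d_stable M : exists N, (M <= N)%N /\ d N.+1 = d N.
  have [m] := ubnP (d M); elim: m M => // m IH M dm.
  have [E|ne] := eqVneq (d M.+1) (d M); first by exists M.
  have [|N [MN E]] := IH M.+1; last by exists N; split=> //; apply: ltnW.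
  by have := d_anti M; move: dm ne; lia.
have optimal_ex a : exists z, optimal (Fa a) (Fa a.+1) v z.
  have [N [MN E]] := d_stable (maxn a J.+1).
  have aN : (a <= N)%N by lia.
apply: (exists_optimal sing aN (d := d N)).
  - by apply/stab/qz; lia.
  - exact: dP.
  - by rewrite -E; apply: dP.
have rec a := sing_recurrence qP dP (optimal_ex a) (optimal_ex a.+1).
have sep_stable a : q a = 0%N -> d a.+1 = d a -> separable_level a.
  move=> qa da; apply: (separable_of_stable (d := d a)); [exact: stab|exact: dP|].
  by rewrite -da; apply: dP.
have dpos a := residue_degree_pos (dP a).
have sd a := @sep_degree s (d a) a sepO (dP a).
split.
- by move=> n; apply: (separable_large p1 sep_degree_pos delta0 sum_le sum_ge (fun a => proj1 (rec a))
    (fun a => proj2 (rec a)) dpos sep_stable separable_level_mono sd).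
- by move=> nc n; apply: (separable_large_strict p1 sep_degree_pos delta0 sum_le sum_ge
    (fun a => proj1 (rec a)) (fun a => proj2 (rec a)) dpos sep_stable separable_level_mono sd nc).
Qed.

Lemma non_decomposed_sep_degree : non_decomposed K F O -> s = 1%N.
Proof.
move=> nd; have [sepb _] := separability_bounds.
have p1 : (1 < p)%N by exact: prime_gt1.
(* Since p^N > N, the bound 2 delta + s <= s p^N holds for every s > 0. *)
pose N := (2 * delta).+1; have sN : separable_level N.
  have := ltn_expl N p1; have := sep_degree_pos; move=> s0 lN.
  by apply: sepb; move: lN; rewrite /N; move: (p ^ _)%N => P; nia.
have [d dP] := residue_degree.
have [eps [w [eps0 Fw w0 vw epsP]]] := Fa_value_group N.
rewrite -(sep_degree sepO (dP N) sN).
exact: (non_decomposed_degree sN eps0 Fw w0 vw epsP nd (dP N)).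
Qed.

End SeparabilityBounds.

End Chain.

Lemma quot_field_id (L : fieldType) (E : L -> Prop) : is_subfield E -> quot_field E = E.
Proof.
move=> HE; apply/predeqP => x; split=> [[a [b [Ea Eb b0 ->]]]|Ex].
  by apply: (sfM HE) => //; apply: (sfV HE).
by exists x, 1; split; [|exact: sf1|exact: oner_neq0|rewrite divr1].
Qed.

(** Logarithms and quotients are cleared: n >= log_p (2 delta / s + 1) becomes s p^n >= 2 delta + s,
    and the improvement by 1 replaces n by n + 1 there. The second part reduces to s = 1, where a
    separable level has residue degree 1. *)
Theorem theorem2p21 (L : closedFieldType) (p : nat) (K F O : L -> Prop)
  (delta s : nat) :
  prime p -> p \in [pchar L] ->
  function_field K F -> is_prime K F O ->
  geom_sing_deg K F O delta -> (0 < delta)%N ->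
  sep_res_deg K O s ->
  ( (forall n : nat, (2 * delta + s <= s * p ^ n)%N ->
       prime_separable K (restr_prime O (frob_pullback p K F n)))
    /\ (~ (exists j i : nat, (j <= i)%N /\
             (2 * delta = (p - 1) * s * \sum_(j <= k < i.+1) p ^ k)%N) ->
        forall n : nat, (2 * delta + s <= s * p ^ n.+1)%N ->
          prime_separable K (restr_prime O (frob_pullback p K F n))) )
  /\
  (non_decomposed K F O ->
    (forall n : nat, (2 * delta + 1 <= p ^ n)%N ->
       prime_rational K (restr_prime O (frob_pullback p K F n)))
    /\ (~ (exists j i : nat, (j <= i)%N /\
             (2 * delta = (p - 1) * \sum_(j <= k < i.+1) p ^ k)%N) ->
        forall n : nat, (2 * delta + 1 <= p ^ n.+1)%N ->
          prime_rational K (restr_prime O (frob_pullback p K F n)))).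
Proof.
move=> _ pchL ffF primeO sing delta0 sepO.
have [HK HF [sKF _] _ algK] := ffF.
have [t [Ft trt sepF finF]] := function_field_sep ffF.
have finFx := function_field_fin ffF.
have [v [Hv Ov [pi [Fpi pi0 vpi]]]] := prime_valuation HF primeO.
have [_ sKO sOF _] := primeO.
have K0 x : K x -> vge v 0 x by move=> Kx; apply/Ov; [exact: sKF|exact: sKO].
have OE : O = ball v F 0.
  apply/predeqP => x; split=> [Ox|[Fx x0]]; last exact/Ov.
  by split; [exact: sOF|apply/Ov => //; exact: sOF].
rewrite {}OE in sing sepO *.
have HFn n := Fa_field pchL HK HF sKF n.
have FnF n x : frob_span p K n F x -> F x by exact: Fa_sub.
have KFn n x : K x -> frob_span p K n F x by exact: Fa_K.
have restrE n : restr_prime (ball v F 0) (frob_pullback p K F n) = ball v (frob_span p K n F) 0.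
  rewrite /frob_pullback quot_field_id; last exact: HFn.
  by apply/predeqP => x; split=> [[[Fx x0] Fnx]|[Fnx x0]]; do ?split=> //; exact: FnF Fnx.
have [sep1 sep2] := separability_bounds pchL HK HF sKF Ft trt sepF finF finFx algK Hv K0 Fpi pi0 vpi
  sing delta0 sepO.
have prime_sep n : separable_level p K F v n ->
    prime_separable K (restr_prime (ball v F 0) (frob_pullback p K F n)).
  by rewrite restrE => sn x Ox; exact: (separable_level_sep_mod pchL HK HF sKF Hv pi0 vpi sn Ox).
split; first by split=> [n /sep1/prime_sep|nc n /(sep2 nc)/prime_sep].
move=> nd; have s1 := non_decomposed_sep_degree pchL HK HF sKF Ft trt sepF finF finFx algK Hv K0 Fpi pi0 vpi
  sing delta0 sepO nd.
rewrite s1 in sepO sep1 sep2.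
have [d dP] := residue_degree pchL HK HF sKF finFx Hv K0 Fpi pi0 vpi.
have prime_rat n : separable_level p K F v n ->
    prime_rational K (restr_prime (ball v F 0) (frob_pullback p K F n)).
  move=> sn; rewrite restrE /prime_rational /res_deg (maxideal_ball pchL HF Hv pi0 vpi (HFn n) (@FnF n)).
  have subs := ball_subspace Hv (HFn n) (@FnF n) (@KFn n) K0.
  apply/(dimqE HK); [exact: subs|exact: subs|].
  by rewrite -(sep_degree pchL HK HF sKF Hv K0 pi0 vpi sepO (dP n) sn).
split=> [n nb|nc n nb]; apply: prime_rat; first by apply: sep1; rewrite mul1n.
apply: sep2; last by rewrite mul1n.
by move=> [j [i [ji E]]]; apply: nc; exists j, i; split=> //; rewrite E muln1.
Qed.
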